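(* Let $m\ge1$ and let $\gamma_1,\dots,\gamma_m>0$. Consider the power-allocation problem $$\min_{\{\alpha_1,\dots,\alpha_m\}}\ P_B(\alpha_1,\dots,\alpha_m)=1-\prod_{i=1}^m\bigl(1-P_e(\alpha_i\gamma_i)\bigr)\quad\text{subject to}\quad\sum_{i=1}^m\alpha_i=m ,\qquad \alpha_i\ge0,$$ where $P_e(\cdot)$ is either the instantaneous symbol error rate of the constellation in use, in the AWGN channel with maximum-likelihood detection (then $P_B$ is the instantaneous block error rate, BLER), or the average symbol error rate in a fading channel (then $P_B$ is the average BLER). This problem has a unique global solution for either: (i) 1-D or 2-D constellations, in terms of the instantaneous BLER or of the average BLER in Rayleigh, Rice and Nakagami fading channels; or (ii) symmetric constellations of any dimension $\ge1$, in terms of the instantaneous BLER; or (iii) any constellation at sufficiently high SNR.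
   Context: This is the power allocation problem for the zero-forcing successive-interference-cancellation V-BLAST with $m$ streams (transmitters): $P_B$ is the block error rate, i.e. the probability of at least one error in the detected transmit vector, $\gamma_i$ is the SNR (average SNR in the average case) of the $i$-th stream under uniform power allocation $\alpha_i=1$, and $\alpha_i$ is the (normalized) power allocated to the $i$-th stream; the constraint fixes the total transmit power. Symbol error rate: a constellation is a set of $M\ge2$ distinct points $\mathbf{s}_1,\dots,\mathbf{s}_M\in\mathbb{R}^n$ ($n$ is its dimension), normalized by $\frac1M\sum_i|\mathbf{s}_i|^2=1$, with prior probabilities $\Pr[\mathbf{s}=\mathbf{s}_i]$ summing to 1. With decision regions $\Omega_i=\{\mathbf{x}\in\mathbb{R}^n:\ (\mathbf{s}_j-\mathbf{s}_i)^T\mathbf{x}\le\frac12|\mathbf{s}_j-\mathbf{s}_i|^2\ \forall j\ne i\}$, set $P_{ei}(\gamma)=1-\int_{\Omega_i}\left(\frac{\gamma}{2\pi}\right)^{n/2}e^{-\gamma|\mathbf{x}|^2/2}\,d\mathbf{x}$ for SNR $\gamma>0$, and $P_e=\sum_iP_{ei}\Pr[\mathbf{s}=\mathbf{s}_i]$; $P_e(0)$ is the limit as $\gamma\to0^+$. The constellation is symmetric if $P_e=P_{e1}=P_{e2}=\dots=P_{eM}$ (as functions of $\gamma$). Fading (frequency-flat, slow): the average symbol error rate at average SNR $\gamma_0$ is $\overline{P}_e(\gamma_0)=\mathbb{E}[P_e(\gamma_0T)]$, where $T\ge0$ is the normalized instantaneous SNR with $\mathbb{E}T=1$ and a fixed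 distribution: exponential for Rayleigh fading, gamma for Nakagami fading, and the normalized squared magnitude of a non-central circular complex Gaussian variable for Rice fading. *)

(* Defs.v *)
From HB Require Import structures.
From mathcomp Require Import all_boot all_order all_algebra.
From mathcomp Require Import all_classical all_reals all_analysis.

Set Implicit Arguments.
Unset Strict Implicit.
Unset Printing Implicit Defensive.

Import Order.TTheory GRing.Theory Num.Theory.
Import numFieldNormedType.Exports.

Local Open Scope classical_set_scope.
Local Open Scope ring_scope.

(* R^n, with the product sigma-algebra that the library puts on tuples (this
   is the Borel sigma-algebra of R^n). *)
Notation Rn R n := (n.-tuple (measurableTypeR R)).

Section LebesgueRn.
Context (R : realType).
Local Open Scope ereal_scope.

Definition consRn n (p : measurableTypeR R * Rn R n) : Rn R n.+1 :=
  [tuple of p.1 :: p.2].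

Lemma measurable_consRn n :
  measurable_fun [set: measurableTypeR R * Rn R n] (@consRn n).
Proof. exact: measurable_cons. Qed.

(* Lebesgue measure on R^n as an iterated product measure; a Fixpoint cannot
   carry the sigma-finite structure along, so it is recovered afterwards. *)
Fixpoint lebesgue_Rn (n : nat) : set (Rn R n) -> \bar R :=
  match n with
  | 0 => \d_([tuple] : Rn R 0)
  | n'.+1 => pushforward (lebesgue_measure \x @lebesgue_Rn n') (@consRn n')
  end.
Arguments lebesgue_Rn n : clear implicits.

Section step.
Context n (mu : {sigma_finite_measure set (Rn R n) -> \bar R}).

Let nu : set (Rn R n.+1) -> \bar R :=
  pushforward (lebesgue_measure \x mu) (@consRn n).

Let mpre (A : set (Rn R n.+1)) : measurable A -> measurable (@consRn n @^-1` A).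
Proof.
by move=> mA; rewrite -[X in measurable X]setTI; exact: measurable_consRn.
Qed.

Let nu0 : nu set0 = 0.
Proof. by rewrite /nu /pushforward preimage_set0 measure0. Qed.

Let nu_ge0 A : 0 <= nu A.
Proof. by rewrite /nu /pushforward; exact: measure_ge0. Qed.

Let nu_sigma_additive : semi_sigma_additive nu.
Proof.
move=> F mF tF mUF; rewrite /nu /pushforward preimage_bigcup.
apply: measure_semi_sigma_additive.
- by move=> k; exact: mpre.
- apply/trivIsetP => /= i j _ _ ij; rewrite -preimage_setI.
  by move/trivIsetP : tF => /(_ _ _ _ _ ij) ->//; rewrite preimage_set0.
- by rewrite -preimage_bigcup; exact: mpre.
Qed.

HB.instance Definition _ := isMeasure.Build _ _ _ nu
  nu0 nu_ge0 nu_sigma_additive.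

Let uncons (t : Rn R n.+1) : measurableTypeR R * Rn R n :=
  (thead t, [tuple of behead t]).

Let measurable_uncons : measurable_fun setT uncons.
Proof.
apply/measurable_fun_pairP; split; first exact: measurable_tnth.
exact: measurable_behead.
Qed.

Let unconsK p : uncons (consRn p) = p.
Proof.
by case: p => x t; congr pair => //; apply/val_inj.
Qed.

Let nu_sigma_finite : sigma_finite setT nu.
Proof.
have /sigma_finiteP[F [TF ndF Foo]] := sigma_finiteT (@lebesgue_measure R).
have /sigma_finiteP[G [TG ndG Goo]] := sigma_finiteT mu.
exists (fun k => uncons @^-1` (F k `*` G k)).
  rewrite -preimage_bigcup (_ : \bigcup_k _ = setT) ?preimage_setT//.
  rewrite -subTset -setXTT TF TG => -[x y] [/= [a _ Fax] [b _ Gby]].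
  exists (maxn a b) => //; split.
    by move: x Fax; exact/subsetPset/ndF/leq_maxl.
  by move: y Gby; exact/subsetPset/ndG/leq_maxr.
move=> k; have [mF Fk] := Foo k; have [mG Gk] := Goo k; split.
  rewrite -[X in measurable X]setTI; apply: measurable_uncons => //.
  exact: measurableX.
rewrite /nu /pushforward -comp_preimage (_ : uncons \o _ = id).
  by rewrite preimage_id product_measure1E// lte_mul_pinfty// ge0_fin_numE.
by apply/funext => p /=; exact: unconsK.
Qed.

HB.instance Definition _ := Measure_isSigmaFinite.Build _ _ _ nu nu_sigma_finite.

Lemma lebesgue_Rn_step : exists mu' : {sigma_finite_measure set _ -> \bar R},
  pushforward (lebesgue_measure \x mu) (@consRn n) = mu' :> (set _ -> \bar R).
Proof. by exists nu. Qed.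

End step.

Lemma lebesgue_Rn_sigma_finite_measure n :
  exists mu : {sigma_finite_measure set (Rn R n) -> \bar R},
    lebesgue_Rn n = mu :> (set _ -> \bar R).
Proof.
elim: n => [|n [mu IH]]; first by exists (\d_([tuple] : Rn R 0)).
by rewrite /= IH; exact: lebesgue_Rn_step.
Qed.

Section instances.
Context (n : nat).

Let L0 : lebesgue_Rn n set0 = 0.
Proof.
by have [mu ->] := lebesgue_Rn_sigma_finite_measure n; exact: measure0.
Qed.

Let L_ge0 A : 0 <= lebesgue_Rn n A.
Proof.
by have [mu ->] := lebesgue_Rn_sigma_finite_measure n; exact: measure_ge0.
Qed.

Let L_sigma_additive : semi_sigma_additive (lebesgue_Rn n).
Proof.
have [mu ->] := lebesgue_Rn_sigma_finite_measure n.
exact: measure_semi_sigma_additive.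
Qed.

HB.instance Definition _ := isMeasure.Build _ _ _ (lebesgue_Rn n)
  L0 L_ge0 L_sigma_additive.

Let L_sigma_finite : sigma_finite setT (lebesgue_Rn n).
Proof.
by have [mu ->] := lebesgue_Rn_sigma_finite_measure n; exact: sigma_finiteT.
Qed.

HB.instance Definition _ := Measure_isSigmaFinite.Build _ _ _ (lebesgue_Rn n)
  L_sigma_finite.
End instances.

End LebesgueRn.
Arguments lebesgue_Rn R n : clear implicits.

Section Constellation.
Context (R : realType) (n M : nat).
Implicit Types (s : 'I_M -> Rn R n) (p : 'I_M -> R).

Definition dotRn (x y : Rn R n) : R := \sum_(k < n) tnth x k * tnth y k.

Definition subRn (x y : Rn R n) : Rn R n :=
  [tuple (tnth x k : R) - tnth y k | k < n].

Definition sqnormRn (x : Rn R n) : R := dotRn x x.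

Definition is_constellation s : Prop :=
  [/\ (2 <= M)%N, injective s & M%:R^-1 * \sum_(i < M) sqnormRn (s i) = 1].

Definition is_prior p : Prop :=
  (forall i, 0 <= p i) /\ \sum_(i < M) p i = 1.

(* Expressed in the noise variable: x is the received vector minus s i. *)
Definition decision_region s (i : 'I_M) : set (Rn R n) :=
  [set x | forall j, j != i ->
     dotRn (subRn (s j) (s i)) x <= 2^-1 * sqnormRn (subRn (s j) (s i))].

Definition Pei s (i : 'I_M) (g : R) : R :=
  1 - Rintegral (lebesgue_Rn R n) (decision_region s i)
        (fun x => (g / (2 * pi)) `^ (n%:R / 2) * expR (- (g * sqnormRn x / 2))).

Definition Pe_pos s p (g : R) : R := \sum_(i < M) Pei s i g * p i.

(* The value at 0 is the limit at 0^+; arguments are never negative, since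
   powers, SNRs and T are nonnegative. *)
Definition Pe s p (g : R) : R :=
  if 0 < g then Pe_pos s p g else lim (Pe_pos s p h @[h --> 0^'+]).

Definition symmetric_constellation s p : Prop :=
  forall (i : 'I_M) (g : R), 0 < g -> Pei s i g = Pe s p g.

End Constellation.

Section Fading.
Context (R : realType) (d : measure_display) (Om : measurableType d)
  (P : probability Om R).
Implicit Types T : {RV P >-> R}.

Definition has_law T (mu : set (measurableTypeR R) -> \bar R) : Prop :=
  forall A : set (measurableTypeR R), measurable A -> distribution P T A = mu A.

(* Only the family of the law is fixed here; the normalization 'E_P[T] = 1 is
   imposed in fading below. *)
Definition Rayleigh_fading T : Prop :=
  exists2 rate : R, 0 < rate & has_law T (exponential_prob rate).

(* Euler's Gamma function, absent from the library. *)
Definition Gamma_fun (k : R) : R :=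
  Rintegral lebesgue_measure `]0, +oo[%classic
    (fun t : R => t `^ (k - 1) * expR (- t)).

Definition gamma_pdf (k rate t : R) : R :=
  rate `^ k / Gamma_fun k * t `^ (k - 1) * expR (- (rate * t)).

Definition gamma_law (k rate : R) (A : set (measurableTypeR R)) : \bar R :=
  (\int[lebesgue_measure]_(t in A `&` `]0%R, +oo[) (gamma_pdf k rate t)%:E)%E.

Definition Nakagami_fading T : Prop :=
  exists k rate : R, [/\ 0 < k, 0 < rate & has_law T (gamma_law k rate)].

(* Law of |h|^2 for h circular complex Gaussian with mean a + ib, i.e. with
   independent real and imaginary parts N(a, sigma^2) and N(b, sigma^2). *)
Definition Rice_law (a b sigma : R) : set (measurableTypeR R) -> \bar R :=
  pushforward (normal_prob a sigma \x normal_prob b sigma)%E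
    (fun z : measurableTypeR R * measurableTypeR R =>
       (z.1 : R) ^+ 2 + (z.2 : R) ^+ 2 : measurableTypeR R).

Definition Rice_fading T : Prop :=
  exists a b sigma : R, 0 < sigma /\ has_law T (Rice_law a b sigma).

Definition fading T : Prop :=
  [/\ forall w, 0 <= T w, ('E_P[T] = 1)%E &
      [\/ Rayleigh_fading T, Rice_fading T | Nakagami_fading T]].

Definition avgPe n M (s : 'I_M -> Rn R n) (p : 'I_M -> R) T (g0 : R) : R :=
  fine ('E_P[fun w => Pe s p (g0 * T w)])%E.

End Fading.

Section PowerAllocation.
Context (R : realType) (m : nat).

(* pe is the symbol error rate, either Pe s p (instantaneous) or
   avgPe s p T (average). *)
Definition BLER (pe : R -> R) (gamma alpha : 'I_m -> R) : R :=
  1 - \prod_(i < m) (1 - pe (alpha i * gamma i)).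

Definition feasible (alpha : 'I_m -> R) : Prop :=
  (forall i, 0 <= alpha i) /\ \sum_(i < m) alpha i = m%:R.

Definition global_solution (pe : R -> R) (gamma alpha : 'I_m -> R) : Prop :=
  feasible alpha /\
  forall beta : 'I_m -> R, feasible beta ->
    BLER pe gamma alpha <= BLER pe gamma beta.

Definition unique_global_solution (pe : R -> R) (gamma : 'I_m -> R) : Prop :=
  exists! alpha : {ffun 'I_m -> R}, global_solution pe gamma alpha.

End PowerAllocation.

(* Main.v *)
(** Up to Gaussian scaling, the probability of correct detection of [s i] at SNR [g] is
    [H g], the standard Gaussian mass of [Q <= g], where [Q] is the squared Minkowski
    functional of the decision region. Averaged over the fading variable [T], the increment
    of [H] between [g1] and [g2] is the integral over the shell [g1 < Q x <= g2] of
    [Phi (|x|^2)], with [Phi q] proportional to [E[T^(n/2) exp (- T q / 2)]]. Integrating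
    along rays shows that [H] is strictly concave beyond a multiple of [z0] as soon as
    [z^(n/2 - 1) * Phi z] decreases for [z > z0]; one may take [z0 = 0] when [n <= 2], and
    each fading law admits some finite [z0] in every dimension. For a symmetric
    constellation, Prekopa-Leindler makes [u |-> H (u^2)] log-concave, and since [H]
    increases strictly this yields strict midpoint log-concavity of [H] itself.

    The block success probability is a product of such factors; comparing two optimal
    allocations with their midpoint gives uniqueness, and compactness of the simplex gives
    existence. At high SNR an allocation leaving some stream below the threshold is beaten
    by the uniform one, so that only the strictly log-concave range matters. *)

Require Import Defs.
From HB Require Import structures.
From mathcomp Require Import all_boot all_order all_algebra.
From mathcomp Require Import ring lra.
From mathcomp Require Import all_classical all_reals all_analysis measurable_realfun.

Set Implicit Arguments.
Unset Strict Implicit.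
Unset Printing Implicit Defensive.

Import Order.TTheory GRing.Theory Num.Theory.
Import numFieldNormedType.Exports.

Local Open Scope classical_set_scope.
Local Open Scope ring_scope.

(** * Integration on R^n *)

(** A prior-weighted sum or an average over [T] preserves concavity but in general not
    log-concavity. This dictates the split into two methods. Cases (i) and (iii) prove concavity of
    each [H], carry it through the priors and the expectation, and pass to log-concavity only at the
    end. Case (ii) has one [H] standing for all symbols and no averaging, so the weaker information
    supplied by Prekopa-Leindler is enough. The threshold [z0] comes from the factor [z^(n/2 - 1)],
    which increases when [n > 2]. For a fading law whose tail decays at rate [r], the profile
    behaves like [(z/2 + r)^(-n/2)] times a decreasing function. Such a power catches up with the
    increasing factor only once [z] exceeds a multiple of [r]; the multiple [n] is sufficient. AWGN
    is the case [T = 1], so (i) and (iii) need a single argument, valid for any [T] that is almost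
    surely positive. *)

Section measure_basics.
Context {R : realType}.
Local Notation leb := (@lebesgue_measure R).
Local Notation LR := (lebesgue_Rn R).

Lemma measurable_natr_bool d (T : measurableType d) (b : T -> bool) :
  measurable_fun setT b -> measurable_fun setT (fun x => (b x)%:R : R).
Proof.
move=> mb; rewrite (_ : (fun _ => _) = fun x => if b x then 1 else 0); last first.
  by apply/funext => x; case: (b x).
by apply: measurable_fun_if => //; exact: measurable_cst.
Qed.

Lemma measurable_set_ltr d (T : measurableType d) (f g : T -> R) :
  measurable_fun setT f -> measurable_fun setT g ->
  measurable [set x | f x < g x].
Proof.
move=> mf mg; have := measurable_fun_ltr mf mg.
by move/(_ measurableT [set true] I); rewrite setTI.
Qed.

Lemma measurable_set_ler d (T : measurableType d) (f g : T -> R) :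
  measurable_fun setT f -> measurable_fun setT g ->
  measurable [set x | f x <= g x].
Proof.
move=> mf mg; have := measurable_fun_ler mf mg.
by move/(_ measurableT [set true] I); rewrite setTI.
Qed.

Lemma measurable_tnthR n (k : 'I_n) :
  measurable_fun setT (fun x : Rn R n => tnth x k : R).
Proof. exact: measurable_tnth. Qed.

Lemma measurable_dotRn n (a : Rn R n) : measurable_fun setT (dotRn a).
Proof.
apply: measurable_sum => k; apply: measurable_funM; first exact: measurable_cst.
exact: measurable_tnthR.
Qed.

Lemma measurable_sqnormRn n : measurable_fun setT (@sqnormRn R n).
Proof.
by apply: measurable_sum => k; apply: measurable_funM; exact: measurable_tnthR.
Qed.

Lemma sqnormRn_ge0 n (x : Rn R n) : 0 <= sqnormRn x.
Proof. by apply: sumr_ge0 => k _; rewrite -expr2 sqr_ge0. Qed.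

Lemma ge0_integral_lebesgue_RnS n (F : Rn R n.+1 -> \bar R) :
  measurable_fun setT F -> (forall x, 0 <= F x)%E ->
  (\int[LR n.+1]_x F x = \int[leb]_x \int[LR n]_t F (consRn (x, t)))%E.
Proof.
move=> mF F0.
rewrite [LHS](@ge0_integral_pushforward _ _ _ _ _ _
  (@measurable_consRn R n) (leb \x LR n)%E setT F)//.
rewrite preimage_setT fubini_tonelli1//; last by move=> x; exact: F0.
by apply: measurableT_comp => //; exact: measurable_consRn.
Qed.

Lemma measurable_integral_consRn n (F : Rn R n.+1 -> \bar R) :
  measurable_fun setT F -> (forall x, 0 <= F x)%E ->
  measurable_fun setT (fun x : R => \int[LR n]_t F (consRn (x, t)))%E.
Proof.
move=> mF F0.
have := @measurable_fun_fubini_tonelli_F _ _ _ _ R (LR n)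
  (F \o @consRn R n).
apply=> [|x]; last exact: F0.
by apply: measurableT_comp => //; exact: measurable_consRn.
Qed.

Lemma measurable_consRnr n (x : R) :
  measurable_fun setT (fun t : Rn R n => consRn (x, t)).
Proof.
apply: measurable_cons; [exact: measurable_cst|exact: measurable_id].
Qed.

(** The pushforward of Lebesgue measure by the affine map, multiplied by [|c|], gives every []a, b]]
    its length. Uniqueness of Lebesgue measure then identifies the two. For negative [c] the
    preimage is closed on the other side, with the same length. *)
Lemma ge0_integral_affine (c e : R) (F : R -> \bar R) : c != 0 ->
  measurable_fun setT F -> (forall x, 0 <= F x)%E ->
  (\int[leb]_x F x = `|c|%:E * \int[leb]_x F (c * x + e)%R)%E.
Proof.
move=> c0 mF F0.
have maff : measurable_fun setT
    ((fun x => c * x + e) : measurableTypeR R -> measurableTypeR R).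
  apply: measurable_funD => //; apply: measurable_funM => //.
have nc : 0 <= `|c| by [].
pose mu := mscale (NngNum nc) 
  (measure_function_pushforward__canonical__measure_function_Measure leb maff).
transitivity (\int[mu]_x F x)%E.
  apply: eq_measure_integral => A mA _.
  have := @lebesgue_measure_unique R mu; apply=> // _ [[a b]] _ <-.
  suff : leb `]a, b] = (`|c|%:E * leb ((fun x => (c * x + e)%R) @^-1` `]a, b]))%E.
    by [].
  have [cpos|cneg] := ltP 0 c.
    have -> : (fun x => c * x + e) @^-1` `]a, b] = `](a - e) / c, (b - e) / c]%classic.
      apply/seteqP; split=> x /=; rewrite !in_itv/= ltr_pdivrMr// ler_pdivlMr//;
      by rewrite ltrBlDr lerBrDr mulrC.
    rewrite !lebesgue_measure_itv/= !lte_fin ltr_pM2r ?invr_gt0//.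
    rewrite ltrD2r; case: ifP => _; last by rewrite mule0.
    rewrite -EFinM gtr0_norm//; congr EFin; by field.
  have {}cneg : c < 0 by rewrite lt_neqAle c0.
  have -> : (fun x => c * x + e) @^-1` `]a, b] = `[(b - e) / c, (a - e) / c[%classic.
    apply/seteqP; split=> x /=; rewrite !in_itv/= ltr_ndivlMr// ler_ndivrMr//;
    by rewrite ltrBlDr lerBrDr mulrC andbC.
  rewrite !lebesgue_measure_itv/= !lte_fin ltr_nM2r ?invr_lt0//.
  rewrite ltrD2r; case: ifP => _; last by rewrite mule0.
  by rewrite -EFinM ltr0_norm//; congr EFin; field.
rewrite ge0_integral_mscale//; congr (_ * _)%E.
by rewrite ge0_integral_pushforward.
Qed.

Lemma ge0_integral_scale (c : R) (F : R -> \bar R) : 0 < c ->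
  measurable_fun setT F -> (forall x, 0 <= F x)%E ->
  (\int[leb]_x F x = c%:E * \int[leb]_x F (c * x)%R)%E.
Proof.
move=> c0 mF F0; rewrite (ge0_integral_affine 0 (lt0r_neq0 c0))//.
by rewrite gtr0_norm//; congr (_ * _)%E; apply: eq_integral => x _; rewrite addr0.
Qed.

Definition scaleRn n (c : R) (x : Rn R n) : Rn R n :=
  [tuple c * tnth x k | k < n].

Lemma measurable_scaleRn n c : measurable_fun setT (@scaleRn n c).
Proof.
apply/measurable_fun_tnthP => k.
rewrite (_ : _ \o _ = fun x => c * (tnth x k : R)); last first.
  by apply/funext => x /=; rewrite tnth_mktuple.
by apply: measurable_funM => //; exact: measurable_tnthR.
Qed.

Lemma scaleRn_cons n c x (t : Rn R n) :
  scaleRn c (consRn (x, t)) = consRn (c * x, scaleRn c t).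
Proof.
apply: eq_from_tnth => k; rewrite tnth_mktuple.
case: (fintype.unliftP ord0 k) => [j ->|->]; last first.
  by rewrite !(tnth_nth 0)/=.
by rewrite !tnthS tnth_mktuple.
Qed.

(** One affine change of variable per coordinate. Negative [c] is allowed because the Rice law uses
    the reflection [c = -1]. *)
Lemma ge0_integral_scaleRn_neq0 n (c : R) (F : Rn R n -> \bar R) : c != 0 ->
  measurable_fun setT F -> (forall x, 0 <= F x)%E ->
  (\int[LR n]_x F x = (`|c| ^+ n)%:E * \int[LR n]_x F (scaleRn c x))%E.
Proof.
move=> c0; elim: n F => [|n IH] F mF F0.
  rewrite expr0 mul1e; apply: eq_integral => x _; congr F.
  by rewrite (tuple0 x) (tuple0 (scaleRn c _)).
have mFc : measurable_fun setT (fun x => F (scaleRn c x)).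
  by apply: measurableT_comp => //; exact: measurable_scaleRn.
rewrite !ge0_integral_lebesgue_RnS//.
rewrite (ge0_integral_affine 0 c0)//; last 2 first.
- exact: measurable_integral_consRn.
- by move=> x; exact: integral_ge0.
rewrite exprS EFinM -muleA; congr (_ * _)%E.
rewrite -ge0_integralZl//; last 2 first.
- exact: (measurable_integral_consRn mFc).
- by move=> x _; exact: integral_ge0.
apply: eq_integral => x _; rewrite IH//; last first.
  by apply: measurableT_comp => //; exact: measurable_consRnr.
by congr (_ * _)%E; apply: eq_integral => t _; rewrite scaleRn_cons addr0.
Qed.

Lemma ge0_integral_scaleRn n (c : R) (F : Rn R n -> \bar R) : 0 < c ->
  measurable_fun setT F -> (forall x, 0 <= F x)%E ->
  (\int[LR n]_x F x = (c ^+ n)%:E * \int[LR n]_x F (scaleRn c x))%E.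
Proof.
by move=> c0 mF F0; rewrite (ge0_integral_scaleRn_neq0 (lt0r_neq0 c0))// gtr0_norm.
Qed.

Lemma dotRn_cons n (x y : R) (t u : Rn R n) :
  dotRn (consRn (x, t)) (consRn (y, u)) = x * y + dotRn t u.
Proof.
rewrite /dotRn big_ord_recl !(tnth_nth 0)/=; congr (_ + _).
by apply: eq_bigr => k _; rewrite !tnthS.
Qed.

Lemma dotRnZr n (c : R) (x y : Rn R n) : dotRn x (scaleRn c y) = c * dotRn x y.
Proof.
rewrite /dotRn mulr_sumr; apply: eq_bigr => k _.
by rewrite tnth_mktuple mulrCA.
Qed.

Lemma sqnormRnZ n (c : R) (x : Rn R n) : sqnormRn (scaleRn c x) = c ^+ 2 * sqnormRn x.
Proof.
rewrite /sqnormRn /dotRn mulr_sumr; apply: eq_bigr => k _.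
by rewrite tnth_mktuple; ring.
Qed.

Lemma integral_gauss1 :
  (\int[leb]_x (expR (- (x ^+ 2 / 2)))%:E = (Num.sqrt (2 * pi))%:E)%E.
Proof.
have := @integral_normal_pdf R 0 1.
have s0 : 0 < Num.sqrt (2 * pi) :> R by rewrite sqrtr_gt0 mulr_gt0// pi_gt0.
have nE : normal_pdf 0 1 = fun x : R => (Num.sqrt (2 * pi))^-1 * expR (- (x ^+ 2 / 2)).
  rewrite normal_pdfE ?oner_neq0//; apply/funext => x.
  rewrite /normal_peak /normal_fun; congr (_^-1 * expR _).
    by congr (Num.sqrt _); ring.
  by rewrite subr0 expr1n mulNr.
rewrite nE => H.
rewrite -[RHS]mule1 -{}H -ge0_integralZl_EFin//.
- apply: eq_integral => x _; rewrite -EFinM mulrA divff ?mul1r//.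
  by rewrite gt_eqF.
- have /measurable_EFinP := @measurable_normal_pdf R 0 1; rewrite nE; exact.
Qed.

Lemma measurable_gaussRn n (c : R) :
  measurable_fun setT (fun x : Rn R n => (expR (- (c * sqnormRn x)))%:E).
Proof.
apply/measurable_EFinP; apply: measurableT_comp => //.
apply: measurableT_comp => //; apply: measurable_funM => //.
exact: measurable_sqnormRn.
Qed.

Lemma integral_gaussRn n :
  (\int[LR n]_x (expR (- (2^-1 * sqnormRn x)))%:E = (Num.sqrt (2 * pi) ^+ n)%:E)%E.
Proof.
elim: n => [|n IH].
  rewrite expr0 integral_dirac//; last exact: measurable_gaussRn.
  rewrite diracT mul1e /sqnormRn /dotRn big_ord0.
  by rewrite mulr0 oppr0 expR0.
rewrite ge0_integral_lebesgue_RnS//; last exact: measurable_gaussRn.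
under eq_integral => x _.
  under eq_integral => t _.
    rewrite /sqnormRn dotRn_cons mulrDr opprD expRD EFinM; over.
  rewrite ge0_integralZl_EFin//; last 1 first.
  - exact: measurable_gaussRn.
  rewrite IH muleC; over.
rewrite ge0_integralZl_EFin ?exprn_ge0 ?sqrtr_ge0//; last first.
  apply/measurable_EFinP; apply: measurableT_comp => //.
  apply: measurableT_comp => //; apply: measurable_funM => //.
  exact: measurable_funM.
rewrite exprSr EFinM; congr (_ * _)%E; rewrite -integral_gauss1.
by apply: eq_integral => x _; rewrite expr2 mulrC.
Qed.

End measure_basics.

(** * The Prekopa-Leindler inequality *)

Section prekopa_leindler.
Context {R : realType}.
Local Notation leb := (@lebesgue_measure R).
Local Notation LR := (lebesgue_Rn R).

Lemma lebesgue_measure_affine_preimage (c e : R) (A : set R) : c != 0 ->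
  measurable A -> leb A = (`|c|%:E * leb ((fun x => (c * x + e)%R) @^-1` A))%E.
Proof.
move=> c0 mA.
have mB : measurable ((fun x => c * x + e) @^-1` A : set R).
  rewrite -[X in measurable X]setTI; exact: measurable_funD.
rewrite -[A in LHS]setIT -integral_indic// (ge0_integral_affine e c0)//; last exact/measurable_EFinP.
by congr (_ * _)%E; rewrite -[X in leb X]setIT -integral_indic.
Qed.

Lemma compact_max (K : set R) : compact K -> K !=set0 ->
  exists2 a, K a & forall x, K x -> x <= a.
Proof.
move=> cK K0; have [a /set_mem Ka amax] := @compact_EVT_max _ R id K K0 cK
  (continuous_subspaceT (fun x => cvg_id)).
by exists a => // x /mem_set; exact: amax.
Qed.

Lemma compact_min (K : set R) : compact K -> K !=set0 ->
  exists2 a, K a & forall x, K x -> a <= x.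
Proof.
move=> cK K0; have [a /set_mem Ka amax] := @compact_EVT_min _ R id K K0 cK
  (continuous_subspaceT (fun x => cvg_id)).
by exists a => // x /mem_set; exact: amax.
Qed.

(** With [a] the maximum of [K] and [b] the minimum of [L], the sets [(K + b)/2] and [(a + L)/2]
    both lie in [C] and meet only at [c = (a + b)/2]. Cutting [C] at [c] therefore gives each of
    them its own piece. A measurable [C] containing the midpoints replaces the Minkowski sum, whose
    measurability would be a separate question. *)
Lemma midpoint_brunn_minkowski_compact (K L C : set R) :
  compact K -> compact L -> measurable C -> K !=set0 -> L !=set0 ->
  (forall x y, K x -> L y -> C (2^-1 * (x + y))) ->
  (leb K + leb L <= 2%:E * leb C)%E.
Proof.
move=> cK cL mC K0 L0 KLC.
have [a Ka amax] := compact_max cK K0.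
have [b Lb bmin] := compact_min cL L0.
pose c := 2^-1 * (a + b).
have mC1 : measurable (C `&` `]-oo, c]) by exact: measurableI.
have mC2 : measurable (C `&` `]c, +oo[) by exact: measurableI.
have CE : leb C = (leb (C `&` `]-oo, c]) + leb (C `&` `]c, +oo[))%E.
  rewrite -measureU//; last first.
    apply/seteqP; split=> x //= -[[_ +] [_ +]].
    by rewrite !in_itv/= andbT leNgt => /negP.
  congr (leb _); rewrite -setIUr; apply/seteqP; split=> [x Cx|x []//].
  by split=> //=; rewrite !in_itv/= andbT; case: (leP x c); [left|right].
have half0 : 2^-1 != 0 :> R by [].
have pre (e : R) (S : set R) : measurable S ->
    measurable ((fun x => 2^-1 * x + e) @^-1` S : set R).
  move=> mS; rewrite -[X in measurable X]setTI; exact: measurable_funD.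
have n2 (x : \bar R) : (2%:E * (`|2^-1|%:E * x) = x)%E.
  by rewrite muleA -EFinM gtr0_norm// divff// mul1e.
rewrite CE muleDr//; last by rewrite ge0_adde_def// inE.
apply: leeD.
  rewrite (lebesgue_measure_affine_preimage (2^-1 * b) half0 mC1) n2.
  apply: le_measure; rewrite ?inE; [exact: compact_measurable|exact: pre|].
  move=> x Kx /=; rewrite -mulrDr; split; first exact: KLC.
  by rewrite in_itv/= /c ler_pM2l// lerD2r amax.
rewrite (lebesgue_measure_affine_preimage (2^-1 * a) half0 mC2) n2.
(* The midpoint of [a] and [b] is [c] itself, which belongs to the left piece; adding the null set
   [[set b]] absorbs it. *)
rewrite -[leRHS]add0e -(lebesgue_measure_set1 b).
apply: le_trans (measureU2 _ _ _) => //; last exact: pre.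
apply: le_measure; rewrite ?inE; [exact: compact_measurable| |].
  by apply: measurableU => //; exact: pre.
move=> y Ly; have [->|yb] := eqVneq y b; [by left|right] => /=.
rewrite -mulrDr addrC; split; first exact: KLC.
by rewrite in_itv/= andbT /c ltr_pM2l// ltrD2l lt_neqAle eq_sym yb bmin.
Qed.

(** Inner regularity reduces to compact subsets: the supremum over [K] inside [A] is taken first,
    then the one over [L] inside [B]. Once [C] has finite measure, so do [A] and [B], and the terms
    can be moved across the inequality. *)
Lemma midpoint_brunn_minkowski (A B C : set R) :
  measurable A -> measurable B -> measurable C -> A !=set0 -> B !=set0 ->
  (forall x y, A x -> B y -> C (2^-1 * (x + y))) ->
  (leb A + leb B <= 2%:E * leb C)%E.
Proof.
move=> mA mB mC [a Aa] [b Bb] ABC.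
have [->|Cfin] := eqVneq (leb C) +oo%E; first by rewrite gt0_muley// leey.
have c1 (x : R) : compact [set x] by exact: compact_set1.
have key K L : compact K -> K `<=` A -> compact L -> L `<=` B ->
    (leb K + leb L <= 2%:E * leb C)%E.
  (* An empty compact set has no maximum or minimum; it is replaced by a singleton of [A] or [B],
     which has the same measure. *)
  have aux X : compact X -> X !=set0 \/ leb X = 0%E.
    by move=> _; have [->|/set0P] := eqVneq X set0; [right; rewrite measure0|left].
  move=> cK KA cL LB; have [K0|K0] := aux _ cK; have [L0|L0] := aux _ cL.
  - apply: midpoint_brunn_minkowski_compact => // x y Kx Ly.
    by apply: ABC; [exact: KA|exact: LB].
  - rewrite L0 -(lebesgue_measure_set1 b).
    apply: midpoint_brunn_minkowski_compact => //; first by exists b.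
    by move=> x y Kx ->; apply: ABC => //; exact: KA.
  - rewrite K0 -(lebesgue_measure_set1 a).
    apply: midpoint_brunn_minkowski_compact => //; first by exists a.
    by move=> x y -> Ly; apply: ABC => //; exact: LB.
  - by rewrite K0 L0 adde0 mule_ge0.
have C2fin : (2%:E * leb C)%E \is a fin_num.
  rewrite fin_numM// ge0_fin_numE// ltey//.
have lefin X : (0 <= leb X)%E -> (leb X <= 2%:E * leb C)%E -> leb X \is a fin_num.
  by move=> X0 XC; rewrite ge0_fin_numE// (le_lt_trans XC)// ltey_eq C2fin.
have keyA L : compact L -> L `<=` B -> (leb A + leb L <= 2%:E * leb C)%E.
  move=> cL LB.
  have Lf : leb L \is a fin_num.
    apply: lefin => //; apply: le_trans (key set0 L _ _ _ _) => //.
    - by rewrite measure0 add0e.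
    - exact: compact0.
  rewrite -leeBrDr// lebesgue_regularity_inner_sup//.
  apply: ge_ereal_sup => _ [K [cK KA]] <-.
  by rewrite leeBrDr//; exact: key.
have Af : leb A \is a fin_num.
  apply: lefin => //; apply: le_trans (keyA set0 _ _) => //.
  - by rewrite measure0 adde0.
  - exact: compact0.
rewrite addeC -leeBrDr// lebesgue_regularity_inner_sup//.
apply: ge_ereal_sup => _ [L [cL LB]] <-.
by rewrite leeBrDr// addeC; exact: keyA.
Qed.

(** Levels are confined to [[0, 1[] so that, for a function of supremum 1, every strict superlevel
    set that occurs is nonempty, as Brunn-Minkowski demands. *)
Lemma integral_layer_cake01 (f : R -> R) : measurable_fun setT f ->
  (forall x, 0 <= f x <= 1) ->
  (\int[leb]_x (f x)%:E =
   \int[leb]_t \int[leb]_x ([&& 0 <= t, t < 1 & t < f x]%:R)%:E)%E.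
Proof.
move=> mf f01.
rewrite -(fubini_tonelli (m1 := leb) (m2 := leb)
  (fun z => ([&& (0 <= z.2)%R, z.2 < 1 & z.2 < f z.1]%:R)%:E))//; last first.
  apply/measurable_EFinP; apply: measurable_natr_bool.
  apply: measurable_and; first exact: measurable_fun_ler.
  apply: measurable_and; apply: measurable_fun_ltr => //.
  exact: measurableT_comp.
apply: eq_integral => x _ /=; have /andP[f0 f1] := f01 x.
transitivity (\int[leb]_t (\1_(`[0%R, f x[%classic : set R) t)%:E)%E; last first.
  apply: eq_integral => t _; rewrite indicE; congr (_%:R)%:E; congr nat_of_bool.
  apply/idP/idP; rewrite inE/= in_itv/=; last by case/and3P => -> _ ->.
  by case/andP => -> tf; rewrite tf (lt_le_trans tf f1).
rewrite integral_indic// setIT [RHS]lebesgue_measure_itv/= lte_fin.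
by case: ifPn => [_|]; [rewrite sube0|rewrite -leNgt => fx; congr EFin; apply/le_anti/andP].
Qed.

Lemma measurable_layer (f : R -> R) : measurable_fun setT f ->
  measurable_fun setT
    (fun t : R => \int[leb]_x ([&& (0 <= t)%R, t < 1 & t < f x]%:R)%:E)%E.
Proof.
move=> mf.
apply: (measurable_fun_fubini_tonelli_F (m2 := leb)
  (fun z : R * R => ([&& (0 <= z.1)%R, z.1 < 1 & z.1 < f z.2]%:R)%:E)); last first.
- by move=> z; rewrite lee_fin.
- apply/measurable_EFinP; apply: measurable_natr_bool.
  apply: measurable_and; first exact: measurable_fun_ler.
  apply: measurable_and; apply: measurable_fun_ltr => //.
  exact: measurableT_comp.
Qed.

(** If [t < f x] and [t < g y], then [t^2 < h^2] at the midpoint, so Brunn-Minkowski applies to the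
    superlevel sets at each common level [t]. Equal suprema are what make the same levels available
    on both sides, and they yield an arithmetic mean where the general inequality has a geometric
    one. *)
Lemma prekopa_leindler_sup1 (f g h : R -> R) :
  measurable_fun setT f -> measurable_fun setT g -> measurable_fun setT h ->
  (forall x, 0 <= f x <= 1) -> (forall x, 0 <= g x <= 1) ->
  (forall x, 0 <= h x <= 1) ->
  (forall t, 0 <= t < 1 -> exists x, t < f x) ->
  (forall t, 0 <= t < 1 -> exists x, t < g x) ->
  (forall x y, f x * g y <= h (2^-1 * (x + y)) ^+ 2) ->
  (\int[leb]_x (f x)%:E + \int[leb]_x (g x)%:E <= 2%:E * \int[leb]_x (h x)%:E)%E.
Proof.
move=> mf mg mh f01 g01 h01 fsup gsup fgh.
rewrite !integral_layer_cake01//.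
have layer0 (u : R -> R) t : (0 <= \int[leb]_x ([&& (0 <= t)%R, t < 1 & t < u x]%:R)%:E)%E.
  by apply: integral_ge0 => x _; rewrite lee_fin.
rewrite -ge0_integralD//; try exact: measurable_layer.
rewrite -ge0_integralZl_EFin//; try exact: measurable_layer.
apply: ge0_le_integral => //.
- by move=> t _; rewrite adde_ge0.
- by apply: emeasurable_funD; exact: measurable_layer.
- by apply: measurable_funeM; exact: measurable_layer.
move=> t _.
have [t01|t01] := boolP (0 <= t < 1); last first.
  have E (u : R -> R) : (\int[leb]_x ([&& (0 <= t)%R, t < 1 & t < u x]%:R)%:E = 0)%E.
    by rewrite integral0_eq// => x _; rewrite andbA (negbTE t01).
  by rewrite !E mule0 adde0.
have mlev (u : R -> R) : measurable_fun setT u -> measurable [set x | t < u x].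
  by move=> mu; exact: measurable_set_ltr.
have E (u : R -> R) : measurable_fun setT u ->
    (\int[leb]_x ([&& (0 <= t)%R, t < 1 & t < u x]%:R)%:E = leb [set x | (t < u x)%R])%E.
  move=> mu; rewrite -[X in leb X]setIT -integral_indic//; last exact: mlev.
  apply: eq_integral => x _; rewrite andbA t01/= indicE; congr (_%:R)%:E.
  by congr nat_of_bool; apply/idP/idP; rewrite inE.
rewrite !E//; apply: midpoint_brunn_minkowski; try exact: mlev.
- exact: fsup.
- exact: gsup.
move=> x y /= tf tg; have /andP[t0 _] := t01.
rewrite -(@ltr_pXn2r _ 2) ?nnegrE//; last by have /andP[] := h01 (2^-1 * (x + y)).
apply: lt_le_trans (fgh x y).
by rewrite expr2 ltr_pM.
Qed.

Lemma ereal_AMGM (x y z : \bar R) : (0 <= x -> 0 <= y -> x + y <= 2%:E * z ->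
  x * y <= z * z)%E.
Proof.
case: z => [z| |] x0 y0; last 2 first.
- by rewrite mulyy leey.
- by rewrite gt0_muleNy// leeNy_eq gt_eqF// (lt_le_trans _ (adde_ge0 x0 y0)) ?ltNy0.
rewrite -EFinM => xyz.
have xf : x \is a fin_num.
  by rewrite ge0_fin_numE// (le_lt_trans _ (ltry (2 * z)))// (le_trans _ xyz)// leeDl.
have yf : y \is a fin_num.
  by rewrite ge0_fin_numE// (le_lt_trans _ (ltry (2 * z)))// (le_trans _ xyz)// leeDr.
move: x0 y0 xyz; rewrite -(fineK xf) -(fineK yf) -EFinD -!EFinM !lee_fin.
move: (fine x) (fine y) => {x xf} x {y yf} y x0 y0 xyz.
have := sqr_ge0 (x - y); have : 0 <= z by lra.
nra.
Qed.

(** Dividing [f] and [g] by their suprema [a] and [b], and [h] by [sqrt (a b)], reduces to suprema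
    1; the arithmetic-geometric inequality then turns the sum of integrals into a product. *)
Lemma prekopa_leindler_bounded (K : R) (f g h : R -> \bar R) :
  measurable_fun setT f -> measurable_fun setT g -> measurable_fun setT h ->
  (forall x, 0 <= f x <= K%:E)%E -> (forall x, 0 <= g x <= K%:E)%E ->
  (forall x, 0 <= h x)%E ->
  (forall x y, f x * g y <= h (2^-1 * (x + y))%R * h (2^-1 * (x + y))%R)%E ->
  (\int[leb]_x f x * \int[leb]_x g x <= \int[leb]_x h x * \int[leb]_x h x)%E.
Proof.
move=> mf mg mh f0K g0K h0 fgh.
have hh0 : (0 <= \int[leb]_x h x * \int[leb]_x h x)%E.
  by rewrite mule_ge0// integral_ge0.
have norm (u : R -> \bar R) : measurable_fun setT u ->
    (forall x, 0 <= u x <= K%:E)%E -> (\int[leb]_x u x = 0)%E \/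
    exists2 a : R, 0 < a & exists v : R -> R,
      [/\ measurable_fun setT v, forall x, u x = (a * v x)%:E,
       forall x, 0 <= v x <= 1 & forall t, 0 <= t < 1 -> exists x, t < v x].
  move=> mu u0K.
  have uf x : u x = (fine (u x))%:E.
    have /andP[u0 uK] := u0K x.
    by rewrite fineK// ge0_fin_numE// (le_lt_trans uK) ?ltry.
  have fu0 x : 0 <= fine (u x) by rewrite -lee_fin -uf; case/andP: (u0K x).
  pose S := range (fine \o u); pose a := sup S.
  have supS : has_sup S.
    split; first by exists (fine (u 0)); exists 0.
    by exists K => _ [x _ <-]/=; rewrite -lee_fin -uf; case/andP: (u0K x).
  have ua x : fine (u x) <= a by apply: sup_upper_bound => //; exists x.
  have [a0|a0] := leP a 0.
    left; apply: integral0_eq => x _; rewrite uf; congr EFin.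
    by apply/le_anti; rewrite fu0 (le_trans (ua x)).
  right; exists a => //; exists (fun x => fine (u x) / a); split.
  - by apply: measurable_funM => //; exact: measurableT_comp.
  - by move=> x; rewrite [LHS]uf mulrC divfK ?gt_eqF.
  - by move=> x; rewrite divr_ge0 ?(ltW a0)//= ler_pdivrMr// mul1r.
  - move=> t /andP[t0 t1].
    have /(sup_gt (proj1 supS))[_ [x _ <-] tx] : t * a < sup S.
      by rewrite -/a gtr_pMl.
    by exists x; rewrite ltr_pdivlMr.
have [->|[a a0 [f' [mf' fE f01 fsup]]]] := norm _ mf f0K; first by rewrite mul0e.
have [->|[b b0 [g' [mg' gE g01 gsup]]]] := norm _ mg g0K; first by rewrite mule0.
have ab0 : 0 < a * b by rewrite mulr_gt0.
pose s := Num.sqrt (a * b).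
have s0 : 0 < s by rewrite sqrtr_gt0.
have ss : s * s = a * b by rewrite -expr2 sqr_sqrtr// ltW.
(* The reduced statement wants a function bounded by 1, so [h] is cut at [s]. The hypothesis
   survives the cut because the normalized [f] and [g] have product at most 1. *)
pose m x := mine (h x) s%:E.
have m_fin x : m x = (fine (m x))%:E.
  rewrite fineK// ge0_fin_numE; first by rewrite /m gt_min ltry orbT.
  by rewrite le_min h0/= lee_fin ltW.
have m_ge0 x : 0 <= fine (m x) by rewrite fine_ge0// le_min h0/= lee_fin ltW.
have mles x : fine (m x) <= s by rewrite -lee_fin -m_fin ge_min lexx orbT.
pose h' x := fine (m x) / s.
have mmeas : measurable_fun setT m by exact: measurable_mine.
have mh' : measurable_fun setT h'.
  by apply: measurable_funM => //; exact: measurableT_comp.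
have h01 x : 0 <= h' x <= 1.
  by rewrite divr_ge0 ?(ltW s0)//= ler_pdivrMr// mul1r.
have fgh' x y : f' x * g' y <= h' (2^-1 * (x + y)) ^+ 2.
  set z := 2^-1 * _.
  have [hs|hs] := leP s%:E (h z).
    rewrite /h' /m min_r// /= divff ?gt_eqF// expr1n.
    have := f01 x; have := g01 y; nra.
  rewrite /h' expr2 mulrACA -invfM ss ler_pdivlMr// -lee_fin [leRHS]EFinM -m_fin.
  rewrite /m min_l; last exact: ltW.
  apply: le_trans (fgh x y); rewrite fE gE -EFinM lee_fin.
  by rewrite le_eqVlt; apply/orP; left; apply/eqP; ring.
have := prekopa_leindler_sup1 mf' mg' mh' f01 g01 h01 fsup gsup fgh'.
have int0 (v : R -> R) : (forall x, 0 <= v x <= 1) -> (0 <= \int[leb]_x (v x)%:E)%E.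
  by move=> v01; apply: integral_ge0 => x _; rewrite lee_fin; case/andP: (v01 x).
move/ereal_AMGM => /(_ (int0 _ f01) (int0 _ g01)) key.
have pull (c : R) (v : R -> R) : 0 < c -> measurable_fun setT v ->
    (forall x, 0 <= v x <= 1) ->
    (\int[leb]_x (c * v x)%:E = c%:E * \int[leb]_x (v x)%:E)%E.
  move=> c0 mv v01; rewrite -ge0_integralZl_EFin//.
  - by move=> x _; rewrite lee_fin; case/andP: (v01 x).
  - exact/measurable_EFinP.
  - exact: ltW.
under eq_integral do rewrite fE.
under [in X in (_ * X)%E]eq_integral do rewrite gE.
rewrite !pull// muleACA -EFinM -ss EFinM.
have hle : (s%:E * \int[leb]_x (h' x)%:E <= \int[leb]_x h x)%E.
  rewrite -pull//; apply: ge0_le_integral => //.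
  - by move=> x _; rewrite lee_fin mulr_ge0 ?(ltW s0)//; case/andP: (h01 x).
  - by apply/measurable_EFinP; exact: measurable_funM.
  - move=> x _; rewrite mulrC divfK ?gt_eqF// -m_fin.
    by rewrite ge_min lexx.
apply: (@le_trans _ _ ((s%:E * \int[leb]_x (h' x)%:E) * (s%:E * \int[leb]_x (h' x)%:E)))%E.
  rewrite [leRHS]muleACA; apply: lee_wpmul2l => //.
  by rewrite -EFinM lee_fin mulr_ge0 ?(ltW s0).
by apply: lee_pmul => //; rewrite mule_ge0 ?int0// lee_fin ltW.
Qed.

(** Truncating [f] and [g] at integer levels preserves the hypothesis with the same [h], so the
    bound [H] is fixed while monotone convergence removes the two truncations one after the
    other. *)
Lemma prekopa_leindler1 (f g h : R -> \bar R) :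
  measurable_fun setT f -> measurable_fun setT g -> measurable_fun setT h ->
  (forall x, 0 <= f x)%E -> (forall x, 0 <= g x)%E -> (forall x, 0 <= h x)%E ->
  (forall x y, f x * g y <= h (2^-1 * (x + y))%R * h (2^-1 * (x + y))%R)%E ->
  (\int[leb]_x f x * \int[leb]_x g x <= \int[leb]_x h x * \int[leb]_x h x)%E.
Proof.
move=> mf mg mh f0 g0 h0 fgh.
set H := (\int[leb]_x h x * \int[leb]_x h x)%E.
have H0 : (0 <= H)%E by rewrite mule_ge0// integral_ge0.
pose tr (u : R -> \bar R) (k : nat) x := mine (u x) k%:R%:E.
have mtr u k : measurable_fun setT u -> measurable_fun setT (tr u k).
  by move=> mu; exact: measurable_mine.
have tr0 u k x : (0 <= u x)%E -> (0 <= tr u k x)%E.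
  by move=> u0; rewrite le_min u0/= lee_fin.
have trlim u x : limn (fun k => tr u k x) = u x.
  have -> : limn (fun k => tr u k x) = ereal_sup (range (fun k => tr u k x)).
    apply/cvg_lim => //; apply: ereal_nondecreasing_cvgn => k l kl.
    by rewrite le_min ge_min lexx/= ge_min lee_fin ler_nat kl orbT.
  apply/le_anti/andP; split.
    by apply: ge_ereal_sup => _ [k _ <-]; rewrite ge_min lexx.
  case uE : (u x) => [r| |].
  - apply: ereal_sup_ubound; exists (Num.bound `|r|) => //.
    rewrite /tr uE min_l// lee_fin.
    exact: le_trans (ler_norm _) (ltW (archi_boundP (normr_ge0 _))).
  - rewrite leye_eq; apply/eqP/eq_infty => t.
    apply: (@le_trans _ _ (tr u (Num.bound `|t|) x)).
      rewrite /tr uE min_r ?leey// lee_fin.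
      exact: le_trans (ler_norm _) (ltW (archi_boundP (normr_ge0 _))).
    by apply: ereal_sup_ubound; exists (Num.bound `|t|).
  - by rewrite leNye.
have trmono u x : {homo (fun k => tr u k x) : k l / (k <= l)%N >-> (k <= l)%E}.
  move=> k l kl; by rewrite le_min ge_min lexx/= ge_min lee_fin ler_nat kl orbT.
have sup_step (u : R -> \bar R) (c : \bar R) : measurable_fun setT u ->
    (forall x, 0 <= u x)%E -> (0 <= c)%E ->
    (forall k, c * \int[leb]_x tr u k x <= H)%E -> (c * \int[leb]_x u x <= H)%E.
  move=> mu u0 c0 ck.
  have int_tr0 k : (0 <= \int[leb]_x tr u k x)%E.
    by apply: integral_ge0 => x _; exact: tr0.
  have uE : (\int[leb]_x u x = ereal_sup (range (fun k => \int[leb]_x tr u k x)))%E.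
    have cv1 := @cvg_monotone_convergence _ _ R leb setT measurableT (tr u)
      (fun k => mtr u k mu) (fun k x _ => tr0 u k x (u0 x)) (fun x _ => trmono u x).
    have cv2 : ((\int[leb]_x tr u k x) @[k --> \oo] -->
        ereal_sup (range (fun k => \int[leb]_x tr u k x)))%E.
      apply: ereal_nondecreasing_cvgn => k l kl.
      apply: ge0_le_integral => //; try exact: mtr.
      - by move=> x _; exact: tr0.
      - by move=> x _; exact: trmono.
    rewrite -(cvg_unique _ cv1 cv2)//.
    by apply: eq_integral => x _; rewrite trlim.
  have [->|cn0] := eqVneq c 0%E; first by rewrite mul0e.
  have {cn0}c0' : (0 < c)%E by rewrite lt0e cn0.
  case: c c0 ck c0' => [c| |]//= _ ck c0.
    rewrite -lee_pdivlMl// uE; apply: ge_ereal_sup => _ [k _ <-].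
    by rewrite lee_pdivlMl.
  (* Here [c] is infinite. If the integral of [u] is nonzero, some truncation already has a positive
     integral, and the assumption at that level forces [H] to be infinite. *)
  have [->|un0] := eqVneq (\int[leb]_x u x)%E 0%E; first by rewrite mule0.
  have : (0 < \int[leb]_x u x)%E by rewrite lt0e un0 integral_ge0.
  rewrite {1}uE => /ereal_sup_gt[_ [k _ <-]] k0.
  by apply: le_trans (ck k); rewrite (gt0_mulye k0) leey.
have int0 u : (forall x, 0 <= u x)%E -> (0 <= \int[leb]_x u x)%E.
  by move=> u0; exact: integral_ge0.
apply: (sup_step) => // [|k]; first exact: int0.
rewrite muleC; apply: (sup_step) => // [|l].
  by apply: int0 => x; exact: tr0.
rewrite muleC.
apply: (@prekopa_leindler_bounded (maxn k l)%:R) => //; try exact: mtr.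
- by move=> x; rewrite tr0//= ge_min lee_fin ler_nat leq_maxr orbT.
- by move=> x; rewrite tr0//= ge_min lee_fin ler_nat leq_maxl orbT.
- move=> x y; apply: le_trans (fgh x y).
  by apply: lee_pmul; rewrite ?tr0// ge_min lexx.
Qed.

Definition midRn n (x y : Rn R n) : Rn R n :=
  [tuple 2^-1 * ((tnth x k : R) + tnth y k) | k < n].

Lemma midRn_cons n (x y : R) (t u : Rn R n) :
  midRn (consRn (x, t)) (consRn (y, u)) = consRn (2^-1 * (x + y), midRn t u).
Proof.
apply: eq_from_tnth => k; rewrite tnth_mktuple.
case: (fintype.unliftP ord0 k) => [j ->|->]; last by rewrite !(tnth_nth 0)/=.
by rewrite !tnthS tnth_mktuple.
Qed.

(** Induction on the dimension: for fixed first coordinates [x], [y] and their midpoint, the slices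
    satisfy the hypothesis, and the induction hypothesis is exactly the one-dimensional hypothesis
    for the slice integrals. *)
Lemma prekopa_leindler n (f g h : Rn R n -> \bar R) :
  measurable_fun setT f -> measurable_fun setT g -> measurable_fun setT h ->
  (forall x, 0 <= f x)%E -> (forall x, 0 <= g x)%E -> (forall x, 0 <= h x)%E ->
  (forall x y, f x * g y <= h (midRn x y) * h (midRn x y))%E ->
  (\int[LR n]_x f x * \int[LR n]_x g x <= \int[LR n]_x h x * \int[LR n]_x h x)%E.
Proof.
elim: n f g h => [|n IH] f g h mf mg mh f0 g0 h0 fgh.
  rewrite !integral_dirac// !diracT !mul1e.
  by have := fgh [tuple] [tuple]; rewrite [midRn _ _]tuple0.
rewrite !ge0_integral_lebesgue_RnS//.
apply: prekopa_leindler1; try exact: measurable_integral_consRn;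
  try by move=> x; apply: integral_ge0.
move=> x y; apply: IH => //;
  try (by apply: measurableT_comp => //; exact: measurable_consRnr).
by move=> t u; rewrite -midRn_cons.
Qed.

End prekopa_leindler.

(** * Strict monotonicity of the integral *)

Section strict_integral.
Context d (T : measurableType d) {R : realType} (mu : {measure set T -> \bar R}).

(** [A] is the union of the sets [B k] on which the gap is at least [1/(k+1)]. One of them has
    positive measure, and there the gap contributes a definite amount. *)
Lemma lt_integral (u v : T -> \bar R) (A : set T) :
  measurable_fun setT u -> measurable_fun setT v -> measurable A ->
  (forall x, 0 <= u x)%E -> (forall x, u x <= v x)%E ->
  (forall x, A x -> u x < v x)%E -> (0 < mu A)%E ->
  (\int[mu]_x u x < +oo)%E ->
  (\int[mu]_x u x < \int[mu]_x v x)%E.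
Proof.
move=> mu_ mv mA u0 uv Auv muA ufin.
pose B k := A `&` [set x | (u x + k.+1%:R^-1%:E <= v x)%E].
have mB k : measurable (B k).
  apply: emeasurable_fun_le => //.
  - by apply: emeasurable_funD => //; exact: measurable_funS mu_.
  - exact: measurable_funS mv.
have AB : A `<=` \bigcup_k B k.
  move=> x Ax; have := Auv _ Ax; have := u0 x.
  rewrite /B/=; case uE : (u x) => [r| |]//; last by move=> _; rewrite ltNge leey.
  case vE : (v x) => [t| |]//; last first.
    by move=> _ _; exists 0%N => //; split => //=; rewrite uE vE leey.
  rewrite lte_fin => _ rt.
  exists (Num.bound (t - r)^-1) => //; split => //=.
  rewrite uE vE -EFinD lee_fin -lerBrDl -[leRHS]invrK lef_pV2 ?posrE//; last first.
    by rewrite invr_gt0 subr_gt0.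
  apply: le_trans (ltW (archi_boundP _)) _; last by rewrite ler_nat.
  by rewrite invr_ge0 subr_ge0 ltW.
have [k Bk] : exists k, (0 < mu (B k))%E.
  apply: contrapT => /forallNP nB; move: muA; apply/negP; rewrite -leNgt.
  apply: (@le_trans _ _ (mu (\bigcup_k B k))).
    by apply: le_measure => //; rewrite inE//; apply: bigcup_measurable => k _; exact: mB.
  have /negligibleP : mu.-negligible (\bigcup_k B k).
    apply: negligible_bigcup => k; apply/negligibleP => //.
    by apply/le_anti; rewrite measure_ge0 andbT leNgt; apply/negP/nB.
  by move=> ->//; apply: bigcup_measurable => k _; exact: mB.
have c0 : 0 < k.+1%:R^-1 :> R by [].
apply: (@lt_le_trans _ _ (\int[mu]_x (u x + (k.+1%:R^-1 * \1_(B k) x)%:E))%E).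
  rewrite ge0_integralD//; last first.
    by apply/measurable_EFinP; exact: measurable_funM.
  rewrite lteDl ?ge0_fin_numE ?integral_ge0//.
  under eq_integral do rewrite EFinM.
  rewrite ge0_integralZl_EFin//; last by apply/measurable_EFinP.
  by rewrite integral_indic// setIT mule_gt0.
apply: ge0_le_integral => //.
- by move=> x _; rewrite adde_ge0// lee_fin mulr_ge0.
- apply: emeasurable_funD => //; apply/measurable_EFinP; exact: measurable_funM.
move=> x _; rewrite indicE; have [xB|xB] := boolP (x \in B k).
  by rewrite mulr1; move: xB; rewrite inE => -[].
by rewrite mulr0 adde0.
Qed.

End strict_integral.

Section measurable_real.
Context {R : realType}.

Lemma measurable_invr : measurable_fun setT (@GRing.inv R).
Proof.
(* Measurability of [powR] is available; the factor [x] restores the sign and makes both sides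
   vanish at 0. *)
have -> : @GRing.inv R = fun x => x * ((`|x| `^ (-1)) * (`|x| `^ (-1))).
  apply/funext => x; rewrite powR_inv1// -expr2 exprVn.
  rewrite real_normK ?num_real//; have [->|x0] := eqVneq x 0.
    by rewrite invr0 mul0r.
  by rewrite expr2 invfM mulrA divff// mul1r.
have mp : measurable_fun setT (fun x : R => `|x| `^ (-1)).
  exact: (measurableT_comp (measurable_powR (-1)) (@normr_measurable R setT)).
by apply: measurable_funM => //; exact: measurable_funM.
Qed.

Lemma lebesgue_measure_itvoc (a b : R) : a < b ->
  lebesgue_measure (`]a, b]%classic : set R) = (b - a)%:E.
Proof. by move=> ab; rewrite lebesgue_measure_itv/= lte_fin ab EFinB. Qed.

Lemma measurable_sqrtr : measurable_fun setT (@Num.sqrt R).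
Proof. by apply: continuous_measurable_fun; exact: sqrt_continuous. Qed.

End measurable_real.

(** * Integrals over gauge shells *)

Section radial.
Context {R : realType} (n : nat).
Local Notation leb := (@lebesgue_measure R).
Local Notation LR := (lebesgue_Rn R n).
Implicit Types (x : Rn R n) (s q : R).

Lemma integral_exponential_density (r : R) : 0 < r ->
  (\int[leb]_s ((0 < s)%R%:R * (r * expR (- (r * s))))%:E = 1)%E.
Proof.
move=> r0; rewrite -(integral_exponential_pdf r0).
rewrite [LHS](_ : _ = \int[leb]_(s in `]0%R, +oo[) (r * expR (- (r * s)))%:E)%E; last first.
  rewrite [RHS]integral_mkcond; apply: eq_integral => s _; rewrite patchE.
  rewrite mem_setE in_itv/= andbT.
  by case: (0 < s); rewrite ?mul1r ?mul0r.
rewrite [RHS](_ : _ = \int[leb]_(s in `[0%R, +oo[) (r * expR (- (r * s)))%:E)%E; last first.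
  rewrite [RHS]integral_mkcond; apply: eq_integral => s _.
  rewrite /exponential_pdf !patchE.
  by case: ifPn => // _; rewrite mulNr.
apply: integral_itv_obnd_cbnd; apply: measurable_funTS.
apply/measurable_EFinP; apply: measurable_funM => //.
by apply: measurableT_comp => //; apply: measurableT_comp => //; exact: measurable_funM.
Qed.

(* A substitute for polar coordinates: inserting the density of an exponential variable [s]
   with rate [1 / |x|^2] and rescaling [x] by [sqrt s] turns an integral over R^n into an
   average of integrals along the rays [s |-> sqrt s * x]. *)
Definition radial_weight x : R := (sqnormRn x)^-1 * expR (- (sqnormRn x)^-1).

Lemma measurable_radial_weight : measurable_fun setT radial_weight.
Proof.
have mq : measurable_fun setT (fun x : Rn R n => (sqnormRn x)^-1).
  by apply: (measurableT_comp measurable_invr); exact: measurable_sqnormRn.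
apply: measurable_funM => //; apply: measurableT_comp => //.
exact: measurableT_comp.
Qed.

Lemma radial_weight_ge0 x : 0 <= radial_weight x.
Proof. by rewrite mulr_ge0 ?expR_ge0// invr_ge0 sqnormRn_ge0. Qed.

Lemma measurable_scaleRn2 :
  measurable_fun setT (fun z : Rn R n * R => scaleRn (Num.sqrt z.2) z.1).
Proof.
apply/measurable_fun_tnthP => k.
rewrite (_ : _ \o _ = fun z : Rn R n * R => Num.sqrt z.2 * (tnth z.1 k : R)); last first.
  by apply/funext => x /=; rewrite tnth_mktuple.
apply: measurable_funM.
- by apply: measurableT_comp => //; exact: measurable_sqrtr.
- exact: (measurableT_comp (measurable_tnthR k) measurable_fst).
Qed.

(** [sqrt s ^ n] is the Jacobian of the rescaling of [x], and [1 / s] is what the rate [1 / |x|^2]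
    yields when [x] is replaced by [sqrt s * x]. The exponent loses its dependence on [s] and goes
    into [radial_weight]. *)
Definition radial_integral (W : Rn R n -> \bar R) x : \bar R :=
  (\int[leb]_s (((0 < s)%R%:R * (Num.sqrt s ^+ n / s))%:E * W (scaleRn (Num.sqrt s) x)))%E.

Let integrand (W : Rn R n -> \bar R) (z : Rn R n * R) : \bar R :=
  (((0 < z.2)%R%:R * (Num.sqrt z.2 ^+ n / z.2))%:E * W (scaleRn (Num.sqrt z.2) z.1))%E.

Let integrand_ge0 W z : (forall x, 0 <= W x)%E -> (0 <= integrand W z)%E.
Proof.
move=> W0; rewrite mule_ge0// lee_fin.
by case: (ltP 0 z.2) => z0; rewrite ?mul0r// mul1r divr_ge0 ?exprn_ge0// ltW.
Qed.

Let measurable_integrand W : measurable_fun setT W ->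
  measurable_fun setT (integrand W).
Proof.
move=> mW; apply: emeasurable_funM; last first.
  by apply: measurableT_comp => //; exact: measurable_scaleRn2.
apply/measurable_EFinP; apply: measurable_funM.
  by apply: measurable_natr_bool; exact: measurable_fun_ltr.
apply: measurable_funM; last exact: (measurableT_comp measurable_invr).
apply: measurable_funX; apply: measurableT_comp => //; exact: measurable_sqrtr.
Qed.

Lemma radial_integral_ge0 W x : (forall x, 0 <= W x)%E -> (0 <= radial_integral W x)%E.
Proof. by move=> W0; apply: integral_ge0 => s _; exact: (@integrand_ge0 W (x, s)). Qed.

Lemma measurable_radial_integral W : measurable_fun setT W ->
  (forall x, 0 <= W x)%E -> measurable_fun setT (radial_integral W).
Proof.
move=> mW W0.
apply: (measurable_fun_fubini_tonelli_F (m2 := leb) (integrand W)).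
- exact: measurable_integrand.
- by move=> z; exact: integrand_ge0.
Qed.

(** Tonelli exchanges [x] and [s], the rescaling is made at fixed [s], and Tonelli restores the
    order. Where [sqnormRn x = 0] the inverse is 0 by convention and the inserted density has
    integral 0 instead of 1, hence the condition that [W] vanishes there. *)
Lemma integral_radialE (W : Rn R n -> \bar R) : measurable_fun setT W ->
  (forall x, 0 <= W x)%E -> (forall x, sqnormRn x = 0 -> W x = 0%E) ->
  (\int[LR]_x W x = \int[LR]_x ((radial_weight x)%:E * radial_integral W x))%E.
Proof.
move=> mW W0 Wz.
pose k (z : Rn R n * R) : R :=
  (0 < z.2)%R%:R * ((sqnormRn z.1)^-1 * expR (- ((sqnormRn z.1)^-1 * z.2))).
have k0 z : 0 <= k z.
  by rewrite mulr_ge0// mulr_ge0 ?expR_ge0// invr_ge0 sqnormRn_ge0.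
have mk : measurable_fun setT k.
  apply: measurable_funM.
    by apply: measurable_natr_bool; exact: measurable_fun_ltr.
  have mq : measurable_fun setT (fun z : Rn R n * R => (sqnormRn z.1)^-1).
    apply: (measurableT_comp measurable_invr); apply: measurableT_comp => //.
    exact: measurable_sqnormRn.
  apply: measurable_funM => //; apply: measurableT_comp => //.
  by apply: measurableT_comp => //; exact: measurable_funM.
transitivity (\int[LR]_x \int[leb]_s (W x * (k (x, s))%:E))%E.
  apply: eq_integral => x _; have [qx|qx] := eqVneq (sqnormRn x) 0.
    by rewrite integral0_eq// => [|s _]; rewrite Wz// mul0e.
  have q0 : 0 < (sqnormRn x)^-1 by rewrite invr_gt0 lt0r qx sqnormRn_ge0.
  rewrite ge0_integralZl//.
  - by rewrite (integral_exponential_density q0) mule1.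
  - by apply/measurable_EFinP; exact: measurableT_comp.
  - by move=> s _; rewrite lee_fin.
rewrite (fubini_tonelli (m1 := LR) (m2 := leb) (fun z => W z.1 * (k z)%:E)%E); last 2 first.
- apply: emeasurable_funM; first exact: measurableT_comp.
  exact/measurable_EFinP.
- by move=> z; rewrite mule_ge0 ?lee_fin.
transitivity (\int[leb]_s \int[LR]_x ((radial_weight x)%:E * integrand W (x, s)))%E; last first.
  rewrite -(fubini_tonelli (m1 := LR) (m2 := leb)
    (fun z => (radial_weight z.1)%:E * integrand W z)%E); last 2 first.
  - apply: emeasurable_funM; last exact: measurable_integrand.
    apply/measurable_EFinP; apply: measurableT_comp => //.
    exact: measurable_radial_weight.
  - by move=> z; rewrite mule_ge0 ?lee_fin ?radial_weight_ge0//; exact: integrand_ge0.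
  apply: eq_integral => x _ /=; rewrite ge0_integralZl//.
  - apply: measurableT_comp; first exact: measurable_integrand.
    exact: measurable_pair1.
  - by move=> s _; exact: integrand_ge0.
  - by rewrite lee_fin radial_weight_ge0.
apply: eq_integral => s _ /=; have [s0|s0] := ltP 0 s; last first.
  rewrite !integral0_eq// => x _.
    by rewrite /integrand ltNge s0 mul0r mul0e mule0.
  by rewrite /k ltNge s0 mul0r mule0.
have ss0 : 0 < Num.sqrt s by rewrite sqrtr_gt0.
rewrite (ge0_integral_scaleRn ss0); last 2 first.
- apply: emeasurable_funM => //; apply/measurable_EFinP.
  apply: measurableT_comp => //; exact: measurable_pair2.
- by move=> x; rewrite mule_ge0 ?lee_fin.
rewrite -ge0_integralZl//; last 2 first.
- apply: emeasurable_funM.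
    by apply: measurableT_comp => //; exact: measurable_scaleRn.
  apply/measurable_EFinP.
  apply: (measurableT_comp (f := fun x => k (x, s))); last exact: measurable_scaleRn.
  by apply: measurableT_comp => //; exact: measurable_pair2.
- by move=> x _; rewrite mule_ge0 ?lee_fin.
apply: eq_integral => x _; rewrite /integrand /k /= s0 !mul1r.
rewrite sqnormRnZ sqr_sqrtr ?(ltW s0)// /radial_weight invfM.
have -> : s^-1 * (sqnormRn x)^-1 * s = (sqnormRn x)^-1.
  by rewrite mulrAC mulVf ?mul1r// gt_eqF.
rewrite muleCA [RHS]muleA [RHS]muleC -!EFinM; congr (_ * _%:E)%E.
by ring.
Qed.

End radial.

Section shells.
Context {R : realType} (n : nat).
Local Notation leb := (@lebesgue_measure R).
Local Notation LR := (lebesgue_Rn R n).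
Variables (Q : Rn R n -> R) (B : R) (Phi : R -> R).
Hypothesis mQ : measurable_fun setT Q.
Hypothesis Q_ge0 : forall x, 0 <= Q x.
Hypothesis QZ : forall c x, 0 < c -> Q (scaleRn c x) = c ^+ 2 * Q x.
Hypothesis QB : forall x, Q x <= B * sqnormRn x.
Hypothesis Qpos : (0 < LR [set x | (0 < Q x)%R])%E.
Hypothesis mPhi : measurable_fun setT Phi.
Hypothesis Phi_ge0 : forall q, 0 <= Phi q.
Hypothesis Phi_gt0 : forall q, 0 < q -> 0 < Phi q.

Definition shell_fun (g1 g2 : R) x : R := (g1 < Q x <= g2)%R%:R * Phi (sqnormRn x).

Definition shell (g1 g2 : R) : \bar R := (\int[LR]_x (shell_fun g1 g2 x)%:E)%E.

Lemma measurable_shell_fun g1 g2 : measurable_fun setT (shell_fun g1 g2).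
Proof.
apply: measurable_funM.
  apply: measurable_natr_bool; apply: measurable_and.
    exact: measurable_fun_ltr.
  exact: measurable_fun_ler.
by apply: measurableT_comp => //; exact: measurable_sqnormRn.
Qed.

Lemma shell_fun_ge0 g1 g2 x : 0 <= shell_fun g1 g2 x.
Proof. by rewrite mulr_ge0. Qed.

Let W g1 g2 x := (shell_fun g1 g2 x)%:E.

Let mW g1 g2 : measurable_fun setT (W g1 g2).
Proof. by apply/measurable_EFinP; exact: measurable_shell_fun. Qed.

Let W_ge0 g1 g2 x : (0 <= W g1 g2 x)%E.
Proof. by rewrite lee_fin shell_fun_ge0. Qed.

Let sqnorm_gt0 x : 0 < Q x -> 0 < sqnormRn x.
Proof.
move=> Qx; rewrite lt0r sqnormRn_ge0 andbT; apply/eqP => q0.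
by have := QB x; rewrite q0 mulr0 leNgt Qx.
Qed.

Lemma shell_radialE g1 g2 : 0 <= g1 ->
  shell g1 g2 =
  (\int[LR]_x ((radial_weight x)%:E * radial_integral (W g1 g2) x))%E.
Proof.
move=> g10; apply: integral_radialE; [exact: mW|exact: W_ge0|move=> x qx].
rewrite /W /shell_fun.
have Q0 : Q x = 0.
  by apply/le_anti; rewrite Q_ge0 andbT; have := QB x; rewrite qx mulr0.
by rewrite Q0 ltNge g10 mul0r.
Qed.

Let kappa q s : R := Num.sqrt s ^+ n / s * Phi (s * q).

(** Homogeneity gives [Q (sqrt s * x) = s * Q x], so the shell cuts the ray in an interval of values
    of [s], and [kappa] is the density left on it. *)
Let radialE g1 g2 x : 0 <= g1 -> 0 < Q x ->
  radial_integral (W g1 g2) x =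
  (\int[leb]_(s in `](g1 / Q x)%R, (g2 / Q x)%R]) (kappa (sqnormRn x) s)%:E)%E.
Proof.
move=> g10 Qx; rewrite [RHS]integral_mkcond; apply: eq_integral => s _.
rewrite patchE mem_setE in_itv/= /W /shell_fun.
have [s0|s0] := ltP 0 s; last first.
  rewrite mul0r mul0e ifF//; apply/negbTE; rewrite negb_and -leNgt.
  by rewrite (le_trans s0)// divr_ge0.
have ss0 : 0 < Num.sqrt s by rewrite sqrtr_gt0.
rewrite QZ// sqnormRnZ sqr_sqrtr ?(ltW s0)//.
rewrite ltr_pdivrMr// ler_pdivlMr//.
by case: ifP => _; rewrite ?mul0r ?mule0// mul1r mul1r.
Qed.

Let radial0 g1 g2 x : 0 <= g1 -> Q x = 0 -> radial_integral (W g1 g2) x = 0%E.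
Proof.
move=> g10 Qx; apply: integral0_eq => s _; rewrite /W /shell_fun.
have [s0|s0] := ltP 0 s; last by rewrite mul0r mul0e.
by rewrite QZ ?sqrtr_gt0// Qx mulr0 ltNge g10 mul0r mule0.
Qed.

Let mkappa q : measurable_fun setT (kappa q).
Proof.
apply: measurable_funM; last first.
  by apply: measurableT_comp => //; exact: measurable_funM.
apply: measurable_funM; last exact: measurable_invr.
by apply: measurable_funX; exact: measurable_sqrtr.
Qed.

Let kappa_ge0 q s : 0 < s -> 0 <= kappa q s.
Proof. by move=> s0; rewrite mulr_ge0// divr_ge0 ?exprn_ge0// ltW. Qed.

Let kappa_gt0 q s : 0 < s -> 0 < q -> 0 < kappa q s.
Proof.
move=> s0 q0; rewrite mulr_gt0// ?divr_gt0 ?exprn_gt0 ?sqrtr_gt0//.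
by rewrite Phi_gt0// mulr_gt0.
Qed.

Let mset : measurable [set x | 0 < Q x].
Proof.
exact: measurable_set_ltr.
Qed.

Let weight_gt0 x : 0 < Q x -> 0 < radial_weight x.
Proof. by move=> /sqnorm_gt0 q0; rewrite mulr_gt0 ?expR_gt0// invr_gt0. Qed.

Let mwr g1 g2 :
  measurable_fun setT (fun x => ((radial_weight x)%:E * radial_integral (W g1 g2) x))%E.
Proof.
apply: emeasurable_funM; last exact: measurable_radial_integral.
by apply/measurable_EFinP; exact: measurable_radial_weight.
Qed.

Lemma shell_gt0 g1 g2 : 0 <= g1 -> g1 < g2 -> (0 < shell g1 g2)%E.
Proof.
move=> g10 g12; rewrite shell_radialE// -[X in (X < _)%E](integral0 LR setT).
apply: (lt_integral (A := [set x | 0 < Q x])) => //.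
- move=> x; rewrite [X in (X <= _)%E]/cst mule_ge0 ?lee_fin ?radial_weight_ge0//.
  exact: radial_integral_ge0.
- move=> x Qx /=; rewrite mule_gt0 ?lte_fin ?weight_gt0// radialE//.
  have q0 := sqnorm_gt0 Qx.
  have sub : `]g1 / Q x, g2 / Q x] `<=` [set s | 0 < s].
    move=> s /=; rewrite in_itv/= => /andP[+ _]; apply: le_lt_trans.
    by rewrite divr_ge0.
  rewrite integral_mkcond -[X in (X < _)%E](integral0 leb setT).
  apply: (@lt_integral _ _ _ leb _ _ (`]g1 / Q x, g2 / Q x]%classic : set R)) => //.
  + apply/(measurable_restrictT _ _).1 => //.
    by apply: measurable_funTS; apply/measurable_EFinP; exact: mkappa.
  + move=> s; rewrite patchE; case: ifPn => //; rewrite inE => /sub s0.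
    by rewrite lee_fin kappa_ge0.
  + move=> s sI; rewrite patchE mem_set// lte_fin kappa_gt0//; exact: sub.
  + have lt12 : g1 / Q x < g2 / Q x by rewrite ltr_pM2r ?invr_gt0.
    suff : (0 < (g2 / Q x - g1 / Q x)%:E)%E by rewrite -(lebesgue_measure_itvoc lt12).
    by rewrite lte_fin subr_gt0.
  + by rewrite integral0 ltry.
- by rewrite integral0 ltry.
Qed.

(* In the variable [s] both shells cut the ray through [x] in intervals of the same length
   [d / Q x], on which the integrand decreases as soon as [z0 < s * |x|^2]. *)
Lemma shell_lt (z0 g1 d : R) : 0 <= z0 ->
  (forall z z', z0 < z -> z < z' ->
    Num.sqrt z' ^+ n / z' * Phi z' < Num.sqrt z ^+ n / z * Phi z) ->
  z0 * B <= g1 -> 0 <= g1 -> 0 < d -> (shell (g1 + d) (g1 + d + d) < +oo)%E ->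
  (shell (g1 + d) (g1 + d + d) < shell g1 (g1 + d))%E.
Proof.
move=> z00 decr z0B g10 d0.
have g1d : 0 <= g1 + d by rewrite addr_ge0// ltW.
rewrite !shell_radialE//.
have key x : 0 < Q x -> (radial_integral (W (g1 + d) (g1 + d + d)) x
                         < radial_integral (W g1 (g1 + d)) x)%E.
  move=> Qx; have q0 := sqnorm_gt0 Qx; set q := sqnormRn x in q0.
  have kdecr s s' : g1 / Q x < s -> s < s' -> kappa q s' < kappa q s.
    move=> gs ss'; have s0 : 0 < s by rewrite (le_lt_trans _ gs)// divr_ge0.
    have s'0 := lt_trans s0 ss'.
    (* This is where [z0 * B <= g1] enters: [z0 * Q x <= z0 * B * q <= g1 * q], and [g1 < s * Q x]
       on the part of the ray considered. *)
    have z0s : z0 < s * q.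
      have : z0 * Q x < s * q * Q x; last by rewrite ltr_pM2r.
      apply: (@le_lt_trans _ _ (g1 * q)).
        apply: (@le_trans _ _ (z0 * (B * q))); first by rewrite ler_wpM2l// QB.
        by rewrite mulrA ler_wpM2r// ltW.
      by rewrite mulrAC ltr_pM2r// -ltr_pdivrMr.
    have := decr _ _ z0s (_ : s * q < s' * q).
    rewrite ltr_pM2r// => /(_ ss'); rewrite !sqrtrM ?(ltW s0) ?(ltW s'0)//.
    have E t : 0 < t -> (Num.sqrt t * Num.sqrt q) ^+ n / (t * q) * Phi (t * q) =
        Num.sqrt q ^+ n / q * kappa q t.
      by move=> t0; rewrite /kappa exprMn; field; rewrite !gt_eqF.
    by rewrite !E// ltr_pM2l// divr_gt0// exprn_gt0 ?sqrtr_gt0.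
  rewrite !radialE// -/q.
  set a := g1 / Q x; set b := (g1 + d) / Q x; set c := (g1 + d + d) / Q x.
  (* [e] is the middle of the far interval. There [kappa] is at most its value at [b] up to [e] and
     its value at [e] beyond, while on the near interval it is at least its value at [b]; the half
     []e, c]] provides the strict gap. *)
  set e := (g1 + d + d / 2) / Q x.
  have iQ : 0 < (Q x)^-1 by rewrite invr_gt0.
  have ab : a < b by rewrite ltr_pM2r// ltrDl.
  have be : b < e by rewrite ltr_pM2r// ltrDl divr_gt0.
  have ec : e < c by rewrite ltr_pM2r// ltrD2l ltr_pdivrMr// mulr_natr mulr2n ltrDl.
  have b0 : 0 < b by rewrite (le_lt_trans _ ab)// divr_ge0.
  have kb0 : 0 <= kappa q b by rewrite kappa_ge0.
  have ke0 : 0 <= kappa q e by rewrite kappa_ge0// (lt_trans b0).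
  have kb : kappa q e < kappa q b by exact: kdecr.
  have cstI (k u v : R) : 0 <= k -> u < v ->
      (\int[leb]_(s in `]u, v]) k%:E = (k * (v - u))%:E)%E.
    by move=> k0 uv; rewrite integral_cst//= lebesgue_measure_itv/= lte_fin uv -EFinB EFinM.
  apply: (@lt_le_trans _ _ (\int[leb]_(s in `]a, b]) (kappa q b)%:E)%E); last first.
    apply: ge0_le_integral => //.
    - by apply: measurable_funTS; apply/measurable_EFinP; exact: mkappa.
    - move=> s /=; rewrite in_itv/= => /andP[as_ sb]; rewrite lee_fin.
      move: sb; rewrite le_eqVlt => /predU1P[->//|sb].
      by apply/ltW/kdecr.
  rewrite cstI//.
  apply: (@le_lt_trans _ _ (\int[leb]_(s in `]b, e]) (kappa q b)%:E +
      \int[leb]_(s in `]e, c]) (kappa q e)%:E)%E); last first.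
    rewrite !cstI// -EFinD lte_fin /a /b /c /e -!mulrBl.
    rewrite -subr_gt0.
    rewrite [X in 0 < X](_ : _ = (kappa q b - kappa q e) * (d / 2) / Q x); last by field; rewrite gt_eqF.
    by rewrite divr_gt0// mulr_gt0 ?divr_gt0// subr_gt0.
  rewrite (_ : `]b, c]%classic = `]b, e] `|` `]e, c]); last first.
    apply/seteqP; split=> s /=; rewrite !in_itv/=.
      by move=> /andP[-> ->]; case: (leP s e); [left|right].
    by move=> [/andP[-> /le_trans->//]|/andP[/(lt_trans be)-> ->]//]; exact: ltW.
  have mk A : measurable_fun A (fun s => (kappa q s)%:E).
    by apply: measurable_funTS; apply/measurable_EFinP; exact: mkappa.
  have pos s : b < s -> 0 < s by exact: lt_trans.
  rewrite ge0_integral_setU//; last 3 first.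
  - exact: mk.
  - move=> s /= [|]; rewrite in_itv/= lee_fin => /andP[bs _]; apply: kappa_ge0.
      exact: pos.
    exact/pos/(lt_trans be).
  - apply/disj_set2P; apply/seteqP; split => s //=; rewrite !in_itv/=.
    by move=> [/andP[_ se] /andP[]]; rewrite ltNge se.
  have bI u v s : b <= u -> `]u, v]%classic s -> [/\ 0 < s, a < s & u < s].
    move=> bu; rewrite /= in_itv/= => /andP[us _].
    have bs := le_lt_trans bu us.
    by split => //; [exact: lt_trans bs|exact: lt_trans bs].
  apply: leeD; (apply: ge0_le_integral; [by []| |exact: mk|exact: measurable_cst|]).
  - by move=> s /(bI _ _ _ (lexx b))[s0 _ _]; rewrite lee_fin kappa_ge0.
  - by move=> s /(bI _ _ _ (lexx b))[_ as_ bs]; rewrite lee_fin ltW// kdecr.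
  - by move=> s /(bI _ _ _ (ltW be))[s0 _ _]; rewrite lee_fin kappa_ge0.
  - move=> s /(bI _ _ _ (ltW be))[_ as_ es]; rewrite lee_fin ltW// kdecr//.
    exact: lt_trans be.
move=> fin; apply: (lt_integral (A := [set x | 0 < Q x])) => //.
- by move=> x; rewrite mule_ge0 ?lee_fin ?radial_weight_ge0// radial_integral_ge0.
- move=> x; apply: lee_wpmul2l; first by rewrite lee_fin radial_weight_ge0.
  have [Qx|Qx] := ltP 0 (Q x); first exact/ltW/key.
  by rewrite !radial0//; apply/le_anti; rewrite Q_ge0 Qx.
- by move=> x Qx; rewrite lte_pmul2l ?key// lte_fin weight_gt0.
Qed.

End shells.

(** * Decision regions *)

Section halfspace.
Context {R : realType}.
Local Notation leb := (@lebesgue_measure R).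
Local Notation LR := (lebesgue_Rn R).

(** A product set, so that its positive measure can be checked coordinate by coordinate; for nonzero
    [b] it is contained in the half-space [dotRn b x > 0]. Coordinates where [b] vanishes are left
    free. *)
Definition orthant n (b : Rn R n) : set (Rn R n) :=
  [set x | forall k, (tnth b k : R) = 0 \/ 0 < (tnth b k : R) * tnth x k].

Lemma measurable_orthant n (b : Rn R n) : measurable (orthant b).
Proof.
have -> : orthant b = \bigcap_(k in [set: 'I_n])
    [set x | (tnth b k : R) = 0 \/ 0 < (tnth b k : R) * tnth x k].
  by apply/seteqP; split=> [x ox k _|x ox k]; exact: ox.
apply: fin_bigcap_measurable => // k _.
have [b0|b0] := eqVneq (tnth b k : R) 0.
  by rewrite (_ : mkset _ = setT)//; apply/seteqP; split => // x _; left.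
rewrite (_ : mkset _ = [set x | 0 < (tnth b k : R) * tnth x k]); last first.
  by apply/seteqP; split => x /=; [case=> // /eqP; rewrite (negbTE b0)|right].
apply: measurable_set_ltr => //; apply: measurable_funM => //.
exact: measurable_tnthR.
Qed.

Lemma lebesgue_orthant_gt0 n (b : Rn R n) : (0 < LR n (orthant b))%E.
Proof.
elim: n b => [|n IH] b.
  rewrite /= diracE mem_set ?lte_fin//.
  by move=> [].
case/tupleP: b => b0 b; pose I := [set y : R | b0 = 0 \/ 0 < b0 * y].
have IE : I = if b0 == 0 then setT else [set y | 0 < b0 * y].
  apply/seteqP; split => y; rewrite /I/=; case: eqVneq => //= b00; rewrite ?b00.
  - by case=> // b0'; move: b00; rewrite b0' eqxx.
  - by left.
  - by right.
have mI : measurable I.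
  by rewrite IE; case: ifP => _ //; apply: measurable_set_ltr => //; exact: measurable_funM.
rewrite /= /pushforward.
have -> : (@consRn R n) @^-1` orthant [tuple of b0 :: b] = I `*` orthant b.
  apply/seteqP; split => -[y x] /=.
    move=> o; split; first by have := o ord0; rewrite !(tnth_nth 0).
    by move=> k; have := o (lift ord0 k); rewrite !tnthS.
  move=> [Iy ox] k; case: (fintype.unliftP ord0 k) => [j ->|->].
    by rewrite !tnthS; exact: ox.
  by rewrite !(tnth_nth 0).
rewrite product_measure1E//; last exact: measurable_orthant.
rewrite mule_gt0//; last exact: IH.
have sub : `]0%R, 1%R] `<=` I \/ `](-2), (-1)] `<=` I.
  have [b00|b00|b00] := ltgtP b0 0.
  - right => y /=; rewrite in_itv/= => /andP[_ y1]; right.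
    by rewrite nmulr_rgt0// (le_lt_trans y1)// ltrN10.
  - by left => y /=; rewrite in_itv/= => /andP[y0 _]; right; rewrite mulr_gt0.
  - by left => y _; left.
case: sub => sub.
  apply: (@lt_le_trans _ _ (leb (`]0%R, 1%R]%classic : set R))).
    by rewrite lebesgue_measure_itvoc// subr0 lte_fin.
  by apply: le_measure; rewrite ?inE.
apply: (@lt_le_trans _ _ (leb (`](-2)%R, (-1)%R]%classic : set R))).
  by rewrite lebesgue_measure_itvoc ?lte_fin; lra.
by apply: le_measure; rewrite ?inE.
Qed.

Lemma lebesgue_halfspace_gt0 n (b : Rn R n) : 0 < sqnormRn b ->
  (0 < LR n [set x | (0 < dotRn b x)%R])%E.
Proof.
move=> b0; apply: lt_le_trans (lebesgue_orthant_gt0 b) _.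
apply: le_measure; rewrite ?inE.
- exact: measurable_orthant.
- by apply: measurable_set_ltr => //; exact: measurable_dotRn.
move=> x ox /=; have [k bk] : exists k, (tnth b k : R) != 0.
  apply: contrapT => /forallNP nb; move: b0; rewrite /sqnormRn /dotRn big1 ?ltxx//.
  by move=> k _; have /negP := nb k; rewrite negbK => /eqP ->; rewrite mul0r.
rewrite /dotRn (bigD1 k)//= ltr_pwDl//.
  by case: (ox k) => // /eqP; rewrite (negbTE bk).
by apply: sumr_ge0 => j _; case: (ox j) => [->|/ltW//]; rewrite mul0r.
Qed.

Lemma cauchy_schwarz_dotRn n (a x : Rn R n) :
  dotRn a x ^+ 2 <= sqnormRn a * sqnormRn x.
Proof.
have [a0|a0] := eqVneq (sqnormRn a) 0.
  have az k : (tnth a k : R) = 0.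
    have := a0; rewrite /sqnormRn /dotRn => /eqP.
    rewrite psumr_eq0 => [|j _]; last by rewrite -expr2 sqr_ge0.
    by move=> /allP/(_ k); rewrite mem_index_enum mulf_eq0 orbb => /(_ isT)/eqP.
  by rewrite a0 mul0r /dotRn big1 ?expr0n// => k _; rewrite az mul0r.
have {}a0 : 0 < sqnormRn a by rewrite lt0r a0 sqnormRn_ge0.
rewrite -subr_ge0 -(pmulr_rge0 _ a0).
(* The right-hand side is the squared norm of [|a|^2 x - (a . x) a], a multiple of the component of
   [x] orthogonal to [a]. *)
have -> : sqnormRn a * (sqnormRn a * sqnormRn x - dotRn a x ^+ 2) =
    \sum_(k < n) (sqnormRn a * tnth x k - dotRn a x * tnth a k) ^+ 2.
  under eq_bigr => k _.
    rewrite (_ : _ ^+ 2 = sqnormRn a ^+ 2 * ((tnth x k : R) * tnth x k)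
      - (2 * sqnormRn a * dotRn a x) * ((tnth a k : R) * tnth x k)
      + dotRn a x ^+ 2 * ((tnth a k : R) * tnth a k)); last by ring.
    over.
  rewrite big_split/= sumrB -!mulr_sumr -/(dotRn x x) -/(dotRn a x) -/(dotRn a a).
  rewrite -/(sqnormRn x) -/(sqnormRn a).
  by ring.
by apply: sumr_ge0 => k _; exact: sqr_ge0.
Qed.

End halfspace.

Section gauge.
Context {R : realType} (n M : nat) (s : 'I_M -> Rn R n) (i : 'I_M).
Local Notation LR := (lebesgue_Rn R n).
Hypothesis M2 : (2 <= M)%N.
Hypothesis s_inj : injective s.
Implicit Types x : Rn R n.

Let a j := subRn (s j) (s i).

Let a_gt0 j : j != i -> 0 < sqnormRn (a j).
Proof.
move=> ji; rewrite lt0r sqnormRn_ge0 andbT; apply: contraNneq ji => a0.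
apply/eqP/s_inj/eq_from_tnth => k.
have : (tnth (a j) k : R) = 0.
  have := a0; rewrite /sqnormRn /dotRn => /eqP.
  rewrite psumr_eq0 => [|l _]; last by rewrite -expr2 sqr_ge0.
  by move=> /allP/(_ k); rewrite mem_index_enum mulf_eq0 orbb => /(_ isT)/eqP.
by rewrite tnth_mktuple => /eqP; rewrite subr_eq0 => /eqP.
Qed.

(* The Minkowski functional of the decision region. *)
Definition region_gauge x : R :=
  \big[Num.max/0]_(j < M | j != i) (2 * dotRn (a j) x / sqnormRn (a j)).

Lemma region_gauge_ge0 x : 0 <= region_gauge x.
Proof. exact: bigmax_ge_id. Qed.

Lemma region_gauge_le u x : 0 <= u -> reflect
  (forall j, j != i -> dotRn (a j) x <= u * (2^-1 * sqnormRn (a j)))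
  (region_gauge x <= u).
Proof.
move=> u0; apply: (iffP (bigmax_leP _ _ _ _)) => [[_ h] j ji|h].
  have := h j ji; rewrite ler_pdivrMr ?a_gt0// => h'.
  by have -> : u * (2^-1 * sqnormRn (a j)) = 2^-1 * (u * sqnormRn (a j)); [ring|lra].
split => // j ji; rewrite ler_pdivrMr ?a_gt0//; have := h j ji.
by have -> : u * (2^-1 * sqnormRn (a j)) = 2^-1 * (u * sqnormRn (a j)); [ring|lra].
Qed.

Lemma region_gaugeZ c x : 0 < c -> region_gauge (scaleRn c x) = c * region_gauge x.
Proof.
move=> c0; rewrite /region_gauge.
rewrite (big_morph (fun u => c * u) (op1 := Num.max) (id1 := 0)); last 2 first.
- by move=> u v; rewrite maxr_pMr// ltW.
- by rewrite mulr0.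
by apply: eq_bigr => j _; rewrite dotRnZr; ring.
Qed.

Lemma measurable_region_gauge : measurable_fun setT region_gauge.
Proof.
rewrite /region_gauge; elim: (index_enum _) => [|j l IH].
  by under eq_fun do rewrite big_nil; exact: measurable_cst.
under eq_fun do rewrite big_cons.
case: (j != i) => //; apply: measurable_maxr => //.
apply: measurable_funM => //; apply: measurable_funM => //.
exact: measurable_dotRn.
Qed.

(** Squared in order to be homogeneous of degree 2, like [|x|^2]: scaling the noise by [sqrt g] then
    multiplies it by the SNR [g]. *)
Definition region_sqgauge x : R := region_gauge x ^+ 2.
Local Notation Q := region_sqgauge.

Lemma measurable_region_sqgauge : measurable_fun setT Q.
Proof. by apply: measurable_funX; exact: measurable_region_gauge. Qed.

Lemma region_sqgauge_ge0 x : 0 <= Q x. Proof. exact: sqr_ge0. Qed.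

Lemma region_sqgaugeZ c x : 0 < c -> Q (scaleRn c x) = c ^+ 2 * Q x.
Proof. by move=> c0; rewrite /Q region_gaugeZ// exprMn. Qed.

Lemma region_sqgauge_le g x : 0 <= g -> (Q x <= g) = (region_gauge x <= Num.sqrt g).
Proof.
by move=> g0; rewrite -{1}(sqr_sqrtr g0) ler_pXn2r ?nnegrE ?sqrtr_ge0// region_gauge_ge0.
Qed.

(** By Cauchy-Schwarz the square of [2 (a . x) / |a|^2] is at most [4 |x|^2 / |a|^2]; the sum
    dominates the largest of these constants. *)
Definition region_bound : R := \sum_(j < M | j != i) 4 / sqnormRn (a j).

Lemma region_bound_ge0 : 0 <= region_bound.
Proof. by apply: sumr_ge0 => j _; rewrite divr_ge0// sqnormRn_ge0. Qed.

Lemma region_sqgauge_bound x : Q x <= region_bound * sqnormRn x.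
Proof.
have B0 := region_bound_ge0.
rewrite region_sqgauge_le ?mulr_ge0 ?sqnormRn_ge0//.
apply/bigmax_leP; split => [|j ji]; first exact: sqrtr_ge0.
apply: le_trans (ler_norm _) _; rewrite -sqrtr_sqr ler_wsqrtr//.
apply: (@le_trans _ _ (4 / sqnormRn (a j) * sqnormRn x)).
  rewrite (_ : (2 * _ / _) ^+ 2 = (4 / sqnormRn (a j)) * (dotRn (a j) x ^+ 2 / sqnormRn (a j))); last first.
    by field; rewrite gt_eqF ?a_gt0.
  rewrite ler_wpM2l ?divr_ge0 ?sqnormRn_ge0//.
  by rewrite ler_pdivrMr ?a_gt0// mulrC cauchy_schwarz_dotRn.
rewrite ler_wpM2r ?sqnormRn_ge0// /region_bound (bigD1 j)//= lerDl.
by apply: sumr_ge0 => l /andP[li _]; rewrite divr_ge0// sqnormRn_ge0.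
Qed.

(** Since [M >= 2] there is a competing point, and the gauge is positive on the open half-space
    facing it. *)
Lemma region_sqgauge_pos : (0 < LR [set x | (0 < Q x)%R])%E.
Proof.
have [j ji] : exists j : 'I_M, j != i.
  have [i0|i0] := eqVneq (i : nat) 0%N.
    by exists (Ordinal M2); apply/eqP => ji; move: i0; rewrite -ji.
  by exists (Ordinal (ltnW M2)); apply/eqP => ji; move: i0; rewrite -ji.
apply: lt_le_trans (lebesgue_halfspace_gt0 (a_gt0 ji)) _.
apply: le_measure; rewrite ?inE.
- by apply: measurable_set_ltr => //; exact: measurable_dotRn.
- by apply: measurable_set_ltr => //; exact: measurable_region_sqgauge.
move=> x /= ax; rewrite exprn_gt0// (lt_le_trans (_ : 0 < 2 * dotRn (a j) x / sqnormRn (a j)))//.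
  by rewrite divr_gt0 ?a_gt0// mulr_gt0.
exact: le_bigmax_cond.
Qed.

Lemma decision_regionE x : decision_region s i x <-> Q x <= 1.
Proof.
rewrite region_sqgauge_le// sqrtr1; split.
  by move=> d; apply/region_gauge_le => // j ji; rewrite mul1r; exact: d.
by move=> /(region_gauge_le _ ler01) h j ji; have := h j ji; rewrite mul1r.
Qed.

End gauge.

Lemma integral_limn_le d (T : measurableType d) {R : realType}
    (mu : {measure set T -> \bar R}) (u : nat -> T -> \bar R) (c : \bar R) :
  (forall k, measurable_fun setT (u k)) -> (forall k x, 0 <= u k x)%E ->
  (forall x, {homo u ^~ x : k l / (k <= l)%N >-> (k <= l)%E}) ->
  (forall k, \int[mu]_x u k x <= c)%E ->
  (\int[mu]_x limn (u ^~ x) <= c)%E.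
Proof.
move=> mu_ u0 umono uc.
have cv := @cvg_monotone_convergence _ _ R mu setT measurableT u mu_
  (fun k x _ => u0 k x) (fun x _ => umono x).
rewrite -(cvg_lim _ cv)//; apply: lime_le; first by apply/cvg_ex; eexists; exact: cv.
by near=> k; exact: uc.
Unshelve. all: by end_near.
Qed.

(** * Probability of correct detection at a fixed SNR *)

Section correct_prob.
Context {R : realType} (n M : nat) (s : 'I_M -> Rn R n) (i : 'I_M).
Local Notation LR := (lebesgue_Rn R n).
Hypothesis M2 : (2 <= M)%N.
Hypothesis s_inj : injective s.
Implicit Types (x : Rn R n) (g : R).
Local Notation Q := (region_sqgauge s i).

Definition gauss_mass_fun g x : R := (Q x <= g)%R%:R * expR (- (2^-1 * sqnormRn x)).

Definition gauss_mass g : \bar R := (\int[LR]_x (gauss_mass_fun g x)%:E)%E.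

Definition gauss_peak : R := (Num.sqrt (2 * pi) ^+ n)^-1.

(* Scaling the noise by [sqrt g] turns [1 - Pei s i g] into the standard Gaussian mass of
   the set where the squared gauge is at most [g]. *)
Definition correct_prob g : R := gauss_peak * fine (gauss_mass g).

Lemma gauss_peak_gt0 : 0 < gauss_peak.
Proof. by rewrite invr_gt0 exprn_gt0// sqrtr_gt0 mulr_gt0// pi_gt0. Qed.

Lemma gauss_mass_fun_ge0 g x : 0 <= gauss_mass_fun g x.
Proof. by rewrite mulr_ge0// expR_ge0. Qed.

Lemma measurable_gauss_mass_fun g : measurable_fun setT (fun x => (gauss_mass_fun g x)%:E).
Proof.
apply/measurable_EFinP; apply: measurable_funM.
  apply: measurable_natr_bool; apply: measurable_fun_ler => //.
  exact: measurable_region_sqgauge.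
by have /measurable_EFinP := @measurable_gaussRn R n 2^-1.
Qed.

Lemma gauss_mass_ge0 g : (0 <= gauss_mass g)%E.
Proof. by apply: integral_ge0 => x _; rewrite lee_fin gauss_mass_fun_ge0. Qed.

Lemma gauss_mass_le g : (gauss_mass g <= (gauss_peak^-1)%:E)%E.
Proof.
rewrite /gauss_peak invrK -integral_gaussRn; apply: ge0_le_integral => //.
- by move=> x _; rewrite lee_fin gauss_mass_fun_ge0.
- exact: measurable_gauss_mass_fun.
- exact: measurable_gaussRn.
- move=> x _; rewrite lee_fin /gauss_mass_fun.
  by case: (Q x <= g); rewrite ?mul1r// mul0r expR_ge0.
Qed.

Lemma gauss_massE g : gauss_mass g = (fine (gauss_mass g))%:E.
Proof.
by rewrite fineK// ge0_fin_numE ?gauss_mass_ge0// (le_lt_trans (gauss_mass_le g)) ?ltry.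
Qed.

Lemma correct_probE g : (correct_prob g)%:E = (gauss_peak%:E * gauss_mass g)%E.
Proof. by rewrite [in RHS]gauss_massE -EFinM. Qed.

Lemma correct_prob_ge0 g : 0 <= correct_prob g.
Proof. by rewrite mulr_ge0 ?(ltW gauss_peak_gt0)// fine_ge0// gauss_mass_ge0. Qed.

Lemma correct_prob_le1 g : correct_prob g <= 1.
Proof.
have p0 := gauss_peak_gt0.
by rewrite /correct_prob mulrC -ler_pdivlMr// div1r -lee_fin -gauss_massE gauss_mass_le.
Qed.

Lemma correct_prob_nondecreasing : {homo correct_prob : g h / g <= h}.
Proof.
move=> g h gh; rewrite ler_wpM2l ?(ltW gauss_peak_gt0)// -lee_fin -!gauss_massE.
apply: ge0_le_integral => //.
- by move=> x _; rewrite lee_fin gauss_mass_fun_ge0.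
- exact: measurable_gauss_mass_fun.
- exact: measurable_gauss_mass_fun.
- move=> x _; rewrite lee_fin ler_wpM2r ?expR_ge0//.
  by case: (leP (Q x) g) => // /le_trans -> //.
Qed.

(** The sets [Q <= k] exhaust the space because [Q] is finite everywhere; were their masses bounded
    away from the total, monotone convergence would contradict the value of the Gaussian
    integral. *)
Lemma correct_prob_to1 e : 0 < e -> exists g, 1 - e < correct_prob g.
Proof.
move=> e0; apply: contrapT => /forallNP ne.
have ek k : (gauss_mass k%:R <= ((1 - e) / gauss_peak)%:E)%E.
  rewrite gauss_massE lee_fin ler_pdivlMr ?gauss_peak_gt0// mulrC.
  by rewrite leNgt; apply/negP/ne.
have : (\int[LR]_x limn (fun k => (gauss_mass_fun k%:R x)%:E) <= ((1 - e) / gauss_peak)%:E)%E.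
  apply: integral_limn_le ek => [k|k x|x k l kl].
  - exact: measurable_gauss_mass_fun.
  - by rewrite lee_fin gauss_mass_fun_ge0.
  - rewrite lee_fin ler_wpM2r ?expR_ge0//.
    case: (leP (Q x) k%:R) => // /le_trans -> //.
    by rewrite ler_nat.
rewrite (eq_integral (fun x => (expR (- (2^-1 * sqnormRn x)))%:E)); last first.
  move=> x _; apply/cvg_lim => //; apply: cvg_near_cst.
  near=> k; rewrite /gauss_mass_fun.
  rewrite (_ : (Q x <= k%:R) = true) ?mul1r//.
  by near: k; exact: nbhs_infty_ger.
rewrite integral_gaussRn -[(_ ^+ n)%:E]/((Num.sqrt (2 * pi) ^+ n)%:E) -[_ ^+ n]invrK -/gauss_peak.
rewrite lee_fin ler_pdivlMr ?gauss_peak_gt0// mulVf ?gt_eqF ?gauss_peak_gt0//.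
by rewrite leNgt gtrBl e0.
Unshelve. all: by end_near.
Qed.

Lemma measurable_decision_region : measurable (decision_region s i).
Proof.
have -> : decision_region s i = [set x | Q x <= 1].
  by apply/seteqP; split => x /(decision_regionE i s_inj).
by apply: measurable_set_ler => //; exact: measurable_region_sqgauge.
Qed.

Lemma gauss_mass_scale g : 0 < g ->
  gauss_mass g = ((Num.sqrt g ^+ n)%:E *
    \int[LR]_(x in decision_region s i) (expR (- (g * sqnormRn x / 2)))%:E)%E.
Proof.
move=> g0; have sg0 : 0 < Num.sqrt g by rewrite sqrtr_gt0.
rewrite /gauss_mass (ge0_integral_scaleRn sg0)//; last 2 first.
- exact: measurable_gauss_mass_fun.
- by move=> x; rewrite lee_fin gauss_mass_fun_ge0.
congr (_ * _)%E; rewrite [RHS]integral_mkcond; apply: eq_integral => x _.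
rewrite patchE /gauss_mass_fun region_sqgaugeZ// sqnormRnZ sqr_sqrtr ?(ltW g0)//.
rewrite -[leRHS]mulr1 ler_pM2l//.
have [Dx|nDx] := boolP (x \in decision_region s i).
  move: Dx; rewrite inE => /(decision_regionE i s_inj) ->; rewrite mul1r.
  by congr (expR _)%:E; ring.
rewrite (_ : (Q x <= 1) = false) ?mul0r//; apply/negbTE; apply: contra nDx.
by rewrite inE => /(decision_regionE i s_inj).
Qed.

Lemma measurable_gauss_var D g :
  measurable_fun D (fun x => (expR (- (g * sqnormRn x / 2)))%:E).
Proof.
apply: measurable_funTS; apply/measurable_EFinP; apply: measurableT_comp => //.
apply: measurableT_comp => //; apply: measurable_funM => //.
by apply: measurable_funM => //; exact: measurable_sqnormRn.
Qed.

Lemma PeiE g : 0 < g -> Pei s i g = 1 - correct_prob g.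
Proof.
move=> g0; rewrite /Pei /correct_prob gauss_mass_scale//; congr (1 - _).
have c0 : 0 < (g / (2 * pi)) `^ (n%:R / 2) :> R.
  by rewrite powR_gt0// divr_gt0// mulr_gt0// pi_gt0.
rewrite /Rintegral.
under eq_integral do rewrite EFinM.
rewrite ge0_integralZl_EFin//; last 3 first.
- exact: measurable_decision_region.
- exact: measurable_gauss_var.
- exact: ltW.
set I := (\int[_]_(x in _) _)%E.
have If : I \is a fin_num.
  have : (gauss_mass g) \is a fin_num by rewrite gauss_massE.
  rewrite gauss_mass_scale// -/I; apply: contraLR => Inf.
  have I0 : (0 <= I)%E by apply: integral_ge0 => x _; rewrite lee_fin expR_ge0.
  move: Inf; rewrite ge0_fin_numE// -leNgt leye_eq => /eqP ->.
  by rewrite gt0_muley// lte_fin exprn_gt0// sqrtr_gt0.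
rewrite !fineM//= mulrA; congr (_ * _).
have twopi : 0 < 2 * pi :> R by rewrite mulr_gt0// pi_gt0.
rewrite [n%:R / 2]mulrC powRrM powR_mulrn ?powR_ge0// powR12_sqrt ?divr_ge0 ?(ltW g0) ?(ltW twopi)//.
rewrite sqrtrM ?(ltW g0)// sqrtrV ?(ltW twopi)// exprMn exprVn.
by rewrite /gauss_peak mulrC.
Qed.

(** After unscaling, the domain is the fixed decision region and [g] occurs only in the exponent and
    in a prefactor. Near [g], the Gaussian with parameter [g / 2] dominates. *)
Lemma correct_prob_continuous g : 0 < g -> {for g, continuous correct_prob}.
Proof.
move=> g0.
have gI : g \in `]g / 2, 2 * g[ by rewrite in_itv/=; lra.
have int_lty h : 0 < h -> (\int[LR]_x (expR (- (h * sqnormRn x / 2)))%:E < +oo)%E.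
  move=> h0; have sh0 : 0 < Num.sqrt h by rewrite sqrtr_gt0.
  have := @integral_gaussRn R n; rewrite (ge0_integral_scaleRn sh0)//; last first.
    exact: measurable_gaussRn.
  under eq_integral => x _.
    rewrite sqnormRnZ sqr_sqrtr ?(ltW h0)// (_ : 2^-1 * _ = h * sqnormRn x / 2); last by ring.
    over.
  case: (\int[_]_x _)%E => [r _| |]; first exact: ltry.
    by rewrite gt0_muley// lte_fin exprn_gt0.
  by [].
have integ D h : measurable D -> 0 < h ->
    LR.-integrable D (EFin \o (fun x => expR (- (h * sqnormRn x / 2)))).
  move=> mD h0; apply: (@integrableS _ _ _ _ setT) => //.
  apply/integrableP; split; first exact: measurable_gauss_var.
  under eq_integral do rewrite /= ger0_norm ?expR_ge0//.
  exact: int_lty.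
pose J h := (\int[LR]_(x in decision_region s i) expR (- (h * sqnormRn x / 2)))%R.
have cJ : {for g, continuous J}.
  have mD := measurable_decision_region.
  apply: (@continuity_under_integral R _ _ LR _ _ mD (g / 2) (2 * g) _ _
    (fun x => expR (- (g / 2 * sqnormRn x / 2)))) => /=.
  - move=> h /=; rewrite in_itv/= => /andP[gh _]; apply: integ => //.
    by rewrite (lt_trans _ gh)// divr_gt0.
  - apply: aeW => x _ h _.
    apply: continuous_comp; last exact: continuous_expR.
    apply: continuousN; apply: cvgM; last exact: cvg_cst.
    by apply: cvgM; [exact: cvg_id|exact: cvg_cst].
  - by apply: integ => //; rewrite divr_gt0.
  - move=> h /=; rewrite in_itv/= => /andP[gh _]; apply: aeW => x _.
    rewrite ger0_norm ?expR_ge0// ler_expR lerN2 ler_wpM2r// ler_wpM2r ?sqnormRn_ge0//.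
    exact: ltW.
  - by rewrite inE.
have E h : 0 < h -> correct_prob h = gauss_peak * (Num.sqrt h ^+ n * J h).
  move=> h0; rewrite /correct_prob gauss_mass_scale// fineM//.
  have := integ _ _ measurable_decision_region h0.
  by move=> /integrable_fin_num; apply; exact: measurable_decision_region.
have : (gauss_peak * (Num.sqrt h ^+ n * J h)) @[h --> g] --> correct_prob g.
  rewrite E//; apply: cvgM; first exact: cvg_cst.
  apply: cvgM; last exact: cJ.
  apply: (@continuous_comp _ _ _ (@Num.sqrt R) (fun y => y ^+ n)).
    exact: sqrt_continuous.
  exact: exprn_continuous.
apply: cvg_trans; apply: near_eq_cvg; near=> h.
by rewrite E//; near: h; exact: lt_nbhsr.
Unshelve. all: by end_near.
Qed.

(** With SNR [u^2] the integration domain is the sublevel set of the gauge at [u]. The gauge is a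
    maximum of linear functions and 0, so midpoints of points at levels [u] and [v] have level at
    most [(u + v)/2]; the convexity of [|x|^2] handles the Gaussian factor. *)
Lemma correct_prob_log_concave u v : 0 <= u -> 0 <= v ->
  correct_prob (u ^+ 2) * correct_prob (v ^+ 2) <=
  correct_prob ((2^-1 * (u + v)) ^+ 2) ^+ 2.
Proof.
move=> u0 v0; set w := 2^-1 * (u + v).
have w0 : 0 <= w by rewrite mulr_ge0// addr_ge0.
have p0 := gauss_peak_gt0.
suff : (gauss_mass (u ^+ 2) * gauss_mass (v ^+ 2) <= gauss_mass (w ^+ 2) * gauss_mass (w ^+ 2))%E.
  rewrite (gauss_massE (u ^+ 2)) (gauss_massE (v ^+ 2)) (gauss_massE (w ^+ 2)).
  rewrite -!EFinM lee_fin => h.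
  by rewrite expr2 /correct_prob mulrACA [leRHS]mulrACA ler_pM2l ?mulr_gt0.
apply: prekopa_leindler; try exact: measurable_gauss_mass_fun;
  try by move=> x; rewrite lee_fin gauss_mass_fun_ge0.
have gl t x : 0 <= t -> (Q x <= t ^+ 2) = (region_gauge s i x <= t).
  by move=> t0; rewrite region_sqgauge_le ?sqr_ge0// sqrtr_sqr ger0_norm.
move=> x y; rewrite -!EFinM lee_fin /gauss_mass_fun !gl//.
have [gx|gx] := leP (region_gauge s i x) u; last first.
  by rewrite !mul0r mulr_ge0// mulr_ge0 ?expR_ge0.
have [gy|gy] := leP (region_gauge s i y) v; last first.
  by rewrite mul0r mulr0 mulr_ge0// mulr_ge0 ?expR_ge0.
rewrite (_ : (region_gauge s i (midRn x y) <= w) = true); last first.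
  apply/(region_gauge_le i s_inj _ w0) => j ji.
  have -> : dotRn (subRn (s j) (s i)) (midRn x y) =
      2^-1 * (dotRn (subRn (s j) (s i)) x + dotRn (subRn (s j) (s i)) y).
    rewrite /dotRn -big_split/= mulr_sumr; apply: eq_bigr => k _.
    by rewrite [tnth (midRn x y) k]tnth_mktuple; ring.
  have := (region_gauge_le i s_inj x u0 gx) j ji.
  have := (region_gauge_le i s_inj y v0 gy) j ji.
  rewrite /w; set B := 2^-1 * sqnormRn _; nra.
rewrite !mul1r -!expRD ler_expR.
have : sqnormRn (midRn x y) <= 2^-1 * (sqnormRn x + sqnormRn y).
  rewrite /sqnormRn /dotRn -big_split/= mulr_sumr; apply: ler_sum => k _.
  rewrite tnth_mktuple; have := sqr_ge0 ((tnth x k : R) - tnth y k); lra.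
lra.
Qed.

End correct_prob.

Lemma integral_probability_cst d (T : measurableType d) {R : realType}
    (P : probability T R) (r : R) : (\int[P]_w r%:E = r%:E)%E.
Proof. by rewrite integral_cst// -[RHS]mule1 -(probability_setT P). Qed.

Lemma sqrtr_expn_expR_bounded {R : realType} (n : nat) (q : R) : 0 < q ->
  exists2 C : R, 0 <= C &
    forall t, 0 <= t -> Num.sqrt t ^+ n * expR (- (2^-1 * (t * q))) <= C.
Proof.
(* The bound [sqrt t <= (1 + 1/c) exp (c t)] raised to the power [n] costs [n c t], which this [c]
   keeps below [t q / 2]. The successor avoids a division by zero when [n = 0]. *)
move=> q0; pose c := q / (2 * n.+1%:R).
have n0 : 0 < n.+1%:R :> R by rewrite ltr0n.
have c0 : 0 < c by rewrite divr_gt0// mulr_gt0.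
have C0 : 0 <= 1 + c^-1 by rewrite addr_ge0// invr_ge0 ltW.
exists ((1 + c^-1) ^+ n); first by rewrite exprn_ge0.
move=> t t0; have y0 := sqrtr_ge0 t; have yt : Num.sqrt t ^+ 2 = t by rewrite sqr_sqrtr.
have h1 : Num.sqrt t <= (1 + c^-1) * expR (c * t).
  apply: (@le_trans _ _ ((1 + c^-1) * (1 + c * t))); last first.
    by rewrite ler_wpM2l// expR_ge1Dx.
  have -> : (1 + c^-1) * (1 + c * t) = 1 + c^-1 + c * t + t.
    by field; rewrite gt_eqF.
  have : 0 <= c * t by rewrite mulr_ge0// ltW.
  have : 0 < c^-1 by rewrite invr_gt0.
  nra.
have : Num.sqrt t ^+ n <= (1 + c^-1) ^+ n * expR (n%:R * (c * t)).
  rewrite expRM_natl -exprMn; apply: lerXn2r => //.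
  by rewrite nnegrE mulr_ge0 ?expR_ge0.
move=> h2; apply: (@le_trans _ _ ((1 + c^-1) ^+ n * expR (n%:R * (c * t)) * expR (- (2^-1 * (t * q))))).
  by rewrite ler_wpM2r ?expR_ge0.
rewrite -mulrA -expRD -[leRHS]mulr1 ler_wpM2l ?exprn_ge0//.
rewrite -[leRHS]expR0 ler_expR subr_le0.
have -> : n%:R * (c * t) = 2^-1 * (t * q) * (n%:R / n.+1%:R).
  by rewrite /c; field; rewrite gt_eqF.
rewrite -[leRHS]mulr1 ler_wpM2l ?mulr_ge0 ?(ltW q0)//.
by rewrite ler_pdivrMr// mul1r ler_nat.
Qed.

(** * Averaging over the random SNR *)

Section averaging.
Context {R : realType} (n M : nat) (s : 'I_M -> Rn R n) (i : 'I_M).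
Local Notation LR := (lebesgue_Rn R n).
Hypothesis M2 : (2 <= M)%N.
Hypothesis s_inj : injective s.
Implicit Types (x : Rn R n) (g : R).
Local Notation Q := (region_sqgauge s i).
Context d (Om : measurableType d) (P : probability Om R) (T : {RV P >-> R}).
Hypothesis T_ge0 : forall w, 0 <= T w.
Hypothesis T_gt0 : {ae P, forall w, 0 < T w}.

Let mT : measurable_fun setT T.
Proof. exact: measurable_funP. Qed.

Definition snr_kernel q w : R := Num.sqrt (T w) ^+ n * expR (- (2^-1 * (T w * q))).

(* Up to constants, the density [E[T^(n/2) exp (- T q / 2)]] of the noise at [|x|^2 = q],
   once normalized by the random SNR. *)
Definition snr_profile (q : R) : R := fine (\int[P]_w (snr_kernel q w)%:E)%E.

Lemma snr_kernel_ge0 q w : 0 <= snr_kernel q w.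
Proof. by rewrite mulr_ge0 ?expR_ge0// exprn_ge0// sqrtr_ge0. Qed.

Lemma measurable_snr_kernel2 d' (X : measurableType d') (a : X -> R) :
  measurable_fun setT a ->
  measurable_fun setT (fun z : X * Om => (snr_kernel (a z.1) z.2)%:E).
Proof.
move=> ma; apply/measurable_EFinP.
have mT2 : measurable_fun setT (fun z : X * Om => T z.2) by exact: measurableT_comp.
have ma1 : measurable_fun setT (fun z : X * Om => a z.1) by exact: measurableT_comp.
apply: measurable_funM.
  by apply: measurable_funX; apply: measurableT_comp => //; exact: measurable_sqrtr.
apply: measurableT_comp => //; apply: measurableT_comp => //.
by apply: measurable_funM => //; exact: measurable_funM.
Qed.

Lemma measurable_snr_kernel q : measurable_fun setT (fun w => (snr_kernel q w)%:E).
Proof.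
have := measurable_snr_kernel2 (@measurable_id _ R setT).
by move=> m2; exact: (measurableT_comp m2 (measurable_pair1 q)).
Qed.

Lemma snr_profileE q : 0 < q ->
  (\int[P]_w (snr_kernel q w)%:E = (snr_profile q)%:E)%E.
Proof.
move=> q0; rewrite fineK// ge0_fin_numE; last first.
  by apply: integral_ge0 => w _; rewrite lee_fin snr_kernel_ge0.
have [C C0 hC] := sqrtr_expn_expR_bounded n q0.
apply: (@le_lt_trans _ _ (\int[P]_w C%:E)%E); last first.
  by rewrite integral_probability_cst ltry.
apply: ge0_le_integral => //.
- by move=> w _; rewrite lee_fin snr_kernel_ge0.
- exact: measurable_snr_kernel.
- by move=> w _; rewrite lee_fin hC.
Qed.

Lemma snr_profile_ge0 q : 0 <= snr_profile q.
Proof. by rewrite fine_ge0// integral_ge0// => w _; rewrite lee_fin snr_kernel_ge0. Qed.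

Lemma measurable_snr_profile : measurable_fun setT snr_profile.
Proof.
apply: measurableT_comp => //.
apply: (measurable_fun_fubini_tonelli_F (m2 := P)
  (fun z : R * Om => (snr_kernel z.1 z.2)%:E)).
  by have := measurable_snr_kernel2 (@measurable_id _ R setT).
by move=> z; rewrite lee_fin snr_kernel_ge0.
Qed.

Lemma P_T_gt0 : P [set w | 0 < T w] = 1%E.
Proof.
have mA : measurable [set w | 0 < T w] by exact: measurable_set_ltr.
have := probability_setC P mA.
rewrite (_ : P (~` _) = 0%E); last first.
  by apply: measure_negligible; [exact: measurableC|exact: T_gt0].
move=> /esym/eqP; rewrite sube_eq ?fin_num_measure// ?add0e; first by move/eqP.
Qed.

Lemma snr_profile_gt0 q : 0 < q -> 0 < snr_profile q.
Proof.
move=> q0; rewrite -lte_fin -snr_profileE// -[X in (X < _)%E](integral0 P setT).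
apply: (@lt_integral _ _ _ P _ _ [set w | 0 < T w]) => //.
- exact: measurable_snr_kernel.
- exact: measurable_set_ltr.
- by move=> w; rewrite lee_fin snr_kernel_ge0.
- by move=> w Tw; rewrite lte_fin mulr_gt0 ?expR_gt0// exprn_gt0// sqrtr_gt0.
- suff : (0 < P [set w | (0 < T w)%R])%E by [].
  by rewrite P_T_gt0.
- by rewrite integral0 ltry.
Qed.

Definition avg_correct_prob g : R :=
  fine (\int[P]_w (correct_prob s i (g * T w))%:E)%E.

Lemma measurable_correct_prob : measurable_fun setT (correct_prob s i).
Proof.
by apply: nondecreasing_measurable => // g h gh; exact: correct_prob_nondecreasing.
Qed.

Let m_avg g : measurable_fun setT (fun w => (correct_prob s i (g * T w))%:E).
Proof.
apply/measurable_EFinP; apply: measurableT_comp; first exact: measurable_correct_prob.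
exact: measurable_funM.
Qed.

Lemma avg_correct_probE g :
  (\int[P]_w (correct_prob s i (g * T w))%:E = (avg_correct_prob g)%:E)%E.
Proof.
rewrite fineK// ge0_fin_numE; last first.
  by apply: integral_ge0 => w _; rewrite lee_fin correct_prob_ge0.
apply: (@le_lt_trans _ _ (\int[P]_w 1%:E)%E); last first.
  by rewrite integral_probability_cst ltry.
apply: ge0_le_integral => //.
- by move=> w _; rewrite lee_fin correct_prob_ge0.
- by move=> w _; rewrite lee_fin correct_prob_le1.
Qed.

(** Scaling [x] by [sqrt t] frees the shell from [t]. Averaging over [t = T w] then acts on the
    kernel alone, which becomes [snr_profile]. *)
Lemma correct_prob_increment g1 g2 t : 0 < t -> g1 <= g2 ->
  ((correct_prob s i (g2 * t))%:E = (correct_prob s i (g1 * t))%:E +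
   (gauss_peak n)%:E * \int[LR]_x ((g1 < Q x <= g2)%R%:R *
      (Num.sqrt t ^+ n * expR (- (2^-1 * (t * sqnormRn x)))))%:E)%E.
Proof.
move=> t0 g12; have st0 : 0 < Num.sqrt t by rewrite sqrtr_gt0.
rewrite !correct_probE -ge0_muleDr; last 2 first.
- exact: gauss_mass_ge0.
- apply: integral_ge0 => x _; rewrite lee_fin mulr_ge0// mulr_ge0 ?expR_ge0//.
congr (_ * _)%E.
have mind g3 g4 : measurable_fun setT (fun x => (g3 < Q x <= g4)%R%:R : R).
  apply: measurable_natr_bool; apply: measurable_and.
    by apply: measurable_fun_ltr => //; exact: measurable_region_sqgauge.
  by apply: measurable_fun_ler => //; exact: measurable_region_sqgauge.
have me c : measurable_fun setT (fun x => expR (- (2^-1 * (c * sqnormRn x))) : R).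
  apply: measurableT_comp => //; apply: measurableT_comp => //.
  by apply: measurable_funM => //; apply: measurable_funM => //; exact: measurable_sqnormRn.
pose G x : \bar R := ((g1 * t < Q x <= g2 * t)%R%:R * expR (- (2^-1 * sqnormRn x)))%:E.
have mG : measurable_fun setT G.
  apply/measurable_EFinP; apply: measurable_funM; first exact: mind.
  by have := me 1; under eq_fun do rewrite mul1r.
have G0 x : (0 <= G x)%E by rewrite lee_fin mulr_ge0 ?expR_ge0.
transitivity (gauss_mass s i (g1 * t) + \int[LR]_x G x)%E.
  rewrite /gauss_mass -ge0_integralD//; last 2 first.
  - by move=> x _; rewrite lee_fin gauss_mass_fun_ge0.
  - exact: measurable_gauss_mass_fun.
  apply: eq_integral => x _; rewrite /G /gauss_mass_fun -EFinD -mulrDl.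
  congr (_ * _)%:E; rewrite -natrD; congr _%:R.
  have gt12 : g1 * t <= g2 * t by rewrite ler_pM2r.
  case: (leP (Q x) (g1 * t)) => [h|_]; last by rewrite add0n.
  by rewrite (le_trans h gt12).
congr (_ + _)%E; rewrite (ge0_integral_scaleRn st0)// -ge0_integralZl_EFin//; last first.
  by apply: measurableT_comp => //; exact: measurable_scaleRn.
apply: eq_integral => x _; rewrite /G -EFinM region_sqgaugeZ// sqnormRnZ sqr_sqrtr ?(ltW t0)//.
rewrite [t * Q x]mulrC ltr_pM2r// ler_pM2r//; congr EFin; ring.
Qed.

Let B := region_bound s i.

(** Written as a sum of extended reals, so that it can be proved before the shell integral is known
    to be finite; finiteness is then read off from it in [shell_fin]. *)
Lemma avg_increment g1 g2 : 0 <= g1 -> g1 <= g2 ->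
  ((avg_correct_prob g2)%:E = (avg_correct_prob g1)%:E +
   (gauss_peak n)%:E * shell Q snr_profile g1 g2)%E.
Proof.
move=> g10 g12; rewrite -!avg_correct_probE.
pose k x w : \bar R := ((g1 < Q x <= g2)%R%:R * snr_kernel (sqnormRn x) w)%:E.
have k0 x w : (0 <= k x w)%E by rewrite lee_fin mulr_ge0// snr_kernel_ge0.
have mk : measurable_fun setT (fun z : Rn R n * Om => k z.1 z.2).
  rewrite /k; under eq_fun do rewrite EFinM.
  apply: emeasurable_funM.
    apply/measurable_EFinP; apply: measurable_natr_bool.
    have mQ1 : measurable_fun setT (fun z : Rn R n * Om => Q z.1).
      by apply: measurableT_comp => //; exact: measurable_region_sqgauge.
    by apply: measurable_and; [exact: measurable_fun_ltr|exact: measurable_fun_ler].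
  by have := measurable_snr_kernel2 (@measurable_sqnormRn R n).
have mk' : measurable_fun setT (fun z : Om * Rn R n => k z.2 z.1).
  exact: (measurableT_comp mk (@measurable_swap _ _ Om (Rn R n))).
have -> : shell Q snr_profile g1 g2 = (\int[P]_w \int[LR]_x k x w)%E.
  rewrite -(fubini_tonelli (m1 := LR) (m2 := P) (fun z => k z.1 z.2))//.
  apply: eq_integral => x _; rewrite /= /k /shell_fun.
  have [/andP[Q1 Q2]|_] := boolP (g1 < Q x <= g2); last first.
    by rewrite mul0r; under eq_integral do rewrite mul0r; rewrite integral0.
  rewrite mul1r; under eq_integral do rewrite mul1r.
  (* At [q = 0] the expectation may be infinite and [fine] would return a default. Inside the shell
     [Q x > g1 >= 0], which excludes [|x|^2 = 0]. *)
  rewrite snr_profileE// lt0r sqnormRn_ge0 andbT; apply/eqP => q0.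
  have := region_sqgauge_bound i s_inj x; rewrite q0 mulr0 leNgt.
  by rewrite (le_lt_trans g10 Q1).
have mI : measurable_fun setT (fun w => \int[LR]_x k x w)%E.
  apply: (measurable_fun_fubini_tonelli_F (m2 := LR) (fun z : Om * Rn R n => k z.2 z.1)) => //.
have I0 w : (0 <= \int[LR]_x k x w)%E by exact: integral_ge0.
have p0 := @gauss_peak_gt0 R n.
rewrite -ge0_integralZl_EFin//; last exact: ltW.
rewrite -ge0_integralD//; last 3 first.
- by move=> w _; rewrite lee_fin correct_prob_ge0.
- by move=> w _; rewrite mule_ge0// lee_fin ltW.
- exact: measurable_funeM.
apply: ge0_ae_eq_integral => //.
- by apply: emeasurable_funD => //; exact: measurable_funeM.
- by move=> w _; rewrite lee_fin correct_prob_ge0.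
- by move=> w _; rewrite adde_ge0 ?lee_fin ?correct_prob_ge0// mule_ge0// lee_fin ltW.
apply: filterS T_gt0 => w Tw _.
exact: correct_prob_increment.
Qed.

Let shell_fin g1 g2 : 0 <= g1 -> g1 <= g2 -> (shell Q snr_profile g1 g2 < +oo)%E.
Proof.
move=> g10 g12; have := avg_increment g10 g12.
case: (shell _ _ _ _) => [r _| |]//; first exact: ltry.
by rewrite gt0_muley ?lte_fin ?gauss_peak_gt0.
Qed.

Let shellE g1 g2 : 0 <= g1 -> g1 <= g2 ->
  avg_correct_prob g2 = avg_correct_prob g1 +
    gauss_peak n * fine (shell Q snr_profile g1 g2).
Proof.
move=> g10 g12; apply: EFin_inj; rewrite EFinD EFinM [X in (_ * X)%E]fineK.
  exact: avg_increment.
rewrite ge0_fin_numE ?shell_fin//.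
by apply: integral_ge0 => x _; rewrite lee_fin shell_fun_ge0// => q; exact: snr_profile_ge0.
Qed.

Lemma avg_correct_prob_increasing g1 g2 : 0 <= g1 -> g1 < g2 ->
  avg_correct_prob g1 < avg_correct_prob g2.
Proof.
move=> g10 g12; rewrite (shellE g10 (ltW g12)) ltrDl mulr_gt0 ?gauss_peak_gt0//.
rewrite fine_gt0// shell_fin ?(ltW g12)// andbT.
apply: (@shell_gt0 _ _ _ B) => //.
- exact: measurable_region_sqgauge.
- exact: region_sqgauge_ge0.
- exact: region_sqgaugeZ.
- exact: region_sqgauge_bound.
- exact: region_sqgauge_pos.
- exact: measurable_snr_profile.
- exact: snr_profile_ge0.
- exact: snr_profile_gt0.
Qed.

Definition profile_decreasing (z0 : R) := forall z z', z0 < z -> z < z' ->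
  Num.sqrt z' ^+ n / z' * snr_profile z' < Num.sqrt z ^+ n / z * snr_profile z.

Lemma avg_correct_prob_concave z0 g1 d1 : 0 <= z0 -> profile_decreasing z0 ->
  z0 * B <= g1 -> 0 <= g1 -> 0 < d1 ->
  avg_correct_prob g1 + avg_correct_prob (g1 + d1 + d1) < 2 * avg_correct_prob (g1 + d1).
Proof.
move=> z00 decr z0g g10 d10.
have g1d : 0 <= g1 + d1 by rewrite addr_ge0// ltW.
have le1 : g1 <= g1 + d1 by rewrite lerDl ltW.
have le2 : g1 + d1 <= g1 + d1 + d1 by rewrite lerDl ltW.
have : (shell Q snr_profile (g1 + d1) (g1 + d1 + d1) < shell Q snr_profile g1 (g1 + d1))%E.
  apply: (@shell_lt _ _ _ B _ _ _ _ _ _ _ _ z0) => //.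
  - exact: measurable_region_sqgauge.
  - exact: region_sqgauge_ge0.
  - exact: region_sqgaugeZ.
  - exact: region_sqgauge_bound.
  - exact: region_sqgauge_pos.
  - exact: measurable_snr_profile.
  - exact: snr_profile_ge0.
  - exact: shell_fin.
have shfin g h : 0 <= g -> g <= h -> shell Q snr_profile g h \is a fin_num.
  move=> g0 gh; rewrite ge0_fin_numE ?shell_fin//.
  by apply: integral_ge0 => x _; rewrite lee_fin shell_fun_ge0// => q; exact: snr_profile_ge0.
rewrite -(fineK (shfin _ _ g10 le1)) -(fineK (shfin _ _ g1d le2)) lte_fin => lt12.
rewrite (shellE g1d le2) (shellE g10 le1).
have := @gauss_peak_gt0 R n.
move: (gauss_peak n) lt12 => p; nra.
Qed.

End averaging.

Import HBNNSimple.

(** Simple functions first, then monotone convergence on both sides. It converts a law known through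
    its values on sets into integrals against the density. *)
Lemma ge0_integral_density d (X : measurableType d) {R : realType}
    (mu nu : {measure set X -> \bar R}) (p : X -> R) (G : X -> \bar R) :
  measurable_fun setT p -> (forall x, 0 <= p x) ->
  (forall A, measurable A -> nu A = \int[mu]_(x in A) (p x)%:E)%E ->
  measurable_fun setT G -> (forall x, 0 <= G x)%E ->
  (\int[nu]_x G x = \int[mu]_x (G x * (p x)%:E))%E.
Proof.
move=> mp p0 nuE mG G0.
pose f_ := nnsfun_approx measurableT mG.
have fG x : (fun k => (f_ k x)%:E) @ \oo --> G x by exact: cvg_nnsfun_approx.
have mfp k : measurable_fun setT (fun x => (f_ k x)%:E * (p x)%:E)%E.
  by apply: emeasurable_funM; apply/measurable_EFinP.
have fp0 k x : (0 <= (f_ k x)%:E * (p x)%:E)%E by rewrite mule_ge0 ?lee_fin.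
have fmono x : {homo (fun k => (f_ k x)%:E) : k l / (k <= l)%N >-> (k <= l)%E}.
  by move=> k l kl; rewrite lee_fin; exact/lefP/nd_nnsfun_approx.
transitivity (limn (fun k => \int[nu]_x (f_ k x)%:E))%E.
  rewrite -monotone_convergence//.
  - by apply: eq_integral => x _; apply/esym/cvg_lim => //; exact: fG.
  - by move=> k; exact/measurable_EFinP.
  - by move=> k x _; rewrite lee_fin.
transitivity (limn (fun k => \int[mu]_x ((f_ k x)%:E * (p x)%:E)))%E; last first.
  rewrite -monotone_convergence//; last first.
    by move=> x _ k l kl; apply: lee_wpmul2r; [rewrite lee_fin|exact: fmono].
  apply: eq_integral => x _; apply/cvg_lim => //.
  by apply: cvgeZr => //; exact: fG.
congr (limn _); apply/funext => k.
have mfk r : measurable (f_ k @^-1` [set r]) by exact: measurable_sfunP.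
transitivity (\sum_(r \in range (f_ k)) \int[nu]_x (r * \1_(f_ k @^-1` [set r]) x)%:E)%E.
  rewrite -ge0_integral_fsum//.
  - by apply: eq_integral => x _; rewrite fsumEFin// -fimfunE.
  - by move=> r; exact/measurable_EFinP/measurable_funM.
  - by move=> r x _; rewrite nnfun_muleindic_ge0.
transitivity (\sum_(r \in range (f_ k)) \int[mu]_x ((r * \1_(f_ k @^-1` [set r]) x)%:E * (p x)%:E))%E; last first.
  rewrite -ge0_integral_fsum//.
  - apply: eq_integral => x _; rewrite -ge0_mule_fsuml ?fsumEFin -?fimfunE//.
    by move=> r; rewrite nnfun_muleindic_ge0.
  - move=> r; apply: emeasurable_funM; apply/measurable_EFinP => //.
    exact: measurable_funM.
  - by move=> r x _; rewrite mule_ge0 ?nnfun_muleindic_ge0 ?lee_fin.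
apply: eq_fsbigr => r _.
rewrite integralZl_indic_nnsfun// integral_indic// setIT nuE//.
have [r0|r0] := ltP r 0.
  by rewrite preimage_nnfun0// integral_set0 mule0 integral0_eq// => x _; rewrite indic0 mulr0 mul0e.
rewrite -ge0_integralZl//; last 2 first.
- by apply: measurable_funTS; apply/measurable_EFinP.
- by move=> x _; rewrite lee_fin.
rewrite integral_mkcond; apply: eq_integral => x _; rewrite patchE indicE.
by case: ifP => _; rewrite ?mulr1// mulr0 mul0e.
Qed.

(** * SNR profiles of the fading laws *)

Section profile_laws.
Context {R : realType}.

(* The logarithmic derivative in [z] is [(n r / (z / 2 + r) - 2) / (2 z)]. *)
Lemma sqrtr_ratio_nonincreasing n (r z z' : R) :
  0 < r -> n%:R * r <= z -> 0 < z -> z < z' ->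
  Num.sqrt (z' / (z' / 2 + r)) ^+ n / z' <= Num.sqrt (z / (z / 2 + r)) ^+ n / z.
Proof.
move=> r0 nrz z0 zz'; have z'0 := lt_trans z0 zz'.
have x0 : 0 < z / 2 + r by rewrite addr_gt0// divr_gt0.
have x'0 : 0 < z' / 2 + r by rewrite addr_gt0// divr_gt0.
pose w := z / (z / 2 + r); pose w' := z' / (z' / 2 + r); rewrite -/w -/w'.
have w0 : 0 < w by rewrite divr_gt0.
have w'0 : 0 < w' by rewrite divr_gt0.
rewrite ler_pdivrMr// mulrAC ler_pdivlMr//.
suff : (Num.sqrt w' ^+ n * z) ^+ 2 <= (Num.sqrt w ^+ n * z') ^+ 2.
  rewrite ler_pXn2r ?nnegrE// mulr_ge0 ?exprn_ge0 ?sqrtr_ge0//; exact: ltW.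
rewrite !exprMn -!exprM mulnC !exprM !sqr_sqrtr ?(ltW w0) ?(ltW w'0)//.
(* The goal amounts to [(w'/w)^n <= (z'/z)^2]. It follows from [(1 + dlt)^n <= exp (n dlt)],
   [ln (z'/z) >= 1 - z/z'], and the comparison of [n dlt] with [2 (1 - z/z')], where [n r <= z] is
   used. *)
pose dlt := w' / w - 1.
have wE : w' = w * (1 + dlt).
  by rewrite /dlt addrC subrK mulrC divfK// gt_eqF.
have dE : dlt = (z' - z) * r / (z * (z' / 2 + r)).
  by rewrite /dlt /w /w'; field; rewrite !gt_eqF//=; lra.
have : (1 + dlt) ^+ n <= (z' / z) ^+ 2.
  have d0 : 0 <= dlt by rewrite dE divr_ge0 ?mulr_ge0 ?(ltW z0) ?(ltW x'0) ?(ltW r0)// subr_ge0 ltW.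
  apply: (@le_trans _ _ (expR dlt ^+ n)).
    apply: lerXn2r; [by rewrite nnegrE addr_ge0|by rewrite nnegrE expR_ge0|].
    exact: expR_ge1Dx.
  rewrite -expRM_natl.
  have q0 : 0 < z' / z by rewrite divr_gt0.
  rewrite -{1}(lnK (q0 : z' / z \in Num.pos)) -expRM_natl ler_expR.
  have lnq : 1 - z / z' <= ln (z' / z).
    have : ln (z / z') <= z / z' - 1.
      have y0 : 0 < z / z' by rewrite divr_gt0.
      have := @le_ln1Dx R (z / z' - 1); rewrite [1 + _]addrC subrK; apply; lra.
    have -> : z / z' = (z' / z)^-1 by rewrite invf_div.
    by rewrite lnV//; lra.
  apply: (@le_trans _ _ (2 * (1 - z / z'))); last by rewrite ler_wpM2l.
  have -> : n%:R * dlt = (n%:R * r) * ((z' - z) / (z * (z' / 2 + r))).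
    by rewrite dE; field; rewrite !gt_eqF//=; lra.
  apply: (@le_trans _ _ (z * ((z' - z) / (z * (z' / 2 + r))))).
    by rewrite ler_wpM2r// divr_ge0 ?mulr_ge0 ?(ltW z0) ?(ltW x'0)// subr_ge0 ltW.
  have -> : z * ((z' - z) / (z * (z' / 2 + r))) = (z' - z) / (z' / 2 + r).
    by field; rewrite !gt_eqF//=; lra.
  have -> : 2 * (1 - z / z') = (z' - z) / (z' / 2) by field; rewrite gt_eqF.
  rewrite ler_wpM2l ?subr_ge0 ?(ltW zz')// lef_pV2 ?posrE ?divr_gt0// lerDl ltW//.
move=> h; rewrite wE exprMn -mulrA ler_wpM2l ?exprn_ge0 ?(ltW w0)//.
by rewrite -ler_pdivlMr ?exprn_gt0// -expr_div_n.
Qed.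

Context d (Om : measurableType d) (P : probability Om R) (T : {RV P >-> R}).
Hypothesis T_ge0 : forall w, 0 <= T w.
Hypothesis T_gt0 : {ae P, forall w, 0 < T w}.
Variable n : nat.

Lemma snr_profile_decreasing z z' : 0 < z -> z < z' ->
  snr_profile n T z' < snr_profile n T z.
Proof.
move=> z0 zz'; have z'0 := lt_trans z0 zz'.
rewrite -lte_fin -!snr_profileE//.
apply: (@lt_integral _ _ _ P _ _ [set w | 0 < T w]) => //.
- exact: measurable_snr_kernel.
- exact: measurable_snr_kernel.
- exact: measurable_set_ltr.
- by move=> w; rewrite lee_fin snr_kernel_ge0.
- move=> w; rewrite lee_fin ler_wpM2l ?exprn_ge0// ler_expR lerN2 ler_wpM2l//.
  by rewrite ler_wpM2l// ltW.
- move=> w /= Tw; rewrite lte_fin ltr_pM2l ?exprn_gt0 ?sqrtr_gt0// ltr_expR ltrN2.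
  by rewrite ltr_pM2l// ltr_pM2l.
- suff : (0 < P [set w | (0 < T w)%R])%E by [].
  by rewrite P_T_gt0.
- by rewrite snr_profileE// ltry.
Qed.

(** For these dimensions [z^(n/2 - 1)] is itself nonincreasing, so the strict decrease of the
    profile is enough. *)
Lemma profile_decreasing12 : n = 1%N \/ n = 2%N -> profile_decreasing n T 0.
Proof.
move=> n12 z z' z0 zz'; have z'0 := lt_trans z0 zz'.
have c0 : 0 < Num.sqrt z ^+ n / z by rewrite divr_gt0// exprn_gt0// sqrtr_gt0.
apply: (@le_lt_trans _ _ (Num.sqrt z ^+ n / z * snr_profile n T z')); last first.
  by rewrite ltr_pM2l// snr_profile_decreasing.
rewrite ler_wpM2r ?snr_profile_ge0//.
case: n12 => -> ; last by rewrite !sqr_sqrtr ?(ltW z0) ?(ltW z'0)// !divff ?gt_eqF.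
have E (y : R) : 0 < y -> Num.sqrt y ^+ 1 / y = (Num.sqrt y)^-1.
  move=> y0; rewrite expr1 -{2}(sqr_sqrtr (ltW y0)) expr2 invfM mulrA divff ?mul1r//.
  by rewrite gt_eqF// sqrtr_gt0.
by rewrite !E// lef_pV2 ?posrE ?sqrtr_gt0// ler_wsqrtr// ltW.
Qed.

(** The shape shared by the gamma and Rice profiles. The factor [(z/2 + r)^(-n/2)] offsets
    [z^(n/2 - 1)] from [n r] on, and [D] contributes the strictness. *)
Lemma profile_decreasing_of_form (r : R) (D : R -> R) : 0 < r ->
  (forall z, 0 < z -> 0 < D z) ->
  (forall z z', 0 < z -> z < z' -> D z' < D z) ->
  (forall z, 0 < z -> snr_profile n T z = D z / Num.sqrt (z / 2 + r) ^+ n) ->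
  profile_decreasing n T (n%:R * r).
Proof.
move=> r0 D0 Ddecr TE z z' nrz zz'.
have z0 : 0 < z by rewrite (le_lt_trans _ nrz)// mulr_ge0// ltW.
have z'0 := lt_trans z0 zz'.
have E y : 0 < y -> Num.sqrt y ^+ n / y * snr_profile n T y =
    Num.sqrt (y / (y / 2 + r)) ^+ n / y * D y.
  move=> y0; have s0 : 0 < y / 2 + r by rewrite addr_gt0// divr_gt0.
  rewrite TE// sqrtrM ?(ltW y0)// sqrtrV ?(ltW s0)// exprMn exprVn.
  by ring.
rewrite !E//; apply: (@le_lt_trans _ _ (Num.sqrt (z / (z / 2 + r)) ^+ n / z * D z')).
  by rewrite ler_wpM2r ?(ltW (D0 _ _))// sqrtr_ratio_nonincreasing// ltW.
rewrite ltr_pM2l ?Ddecr// divr_gt0// exprn_gt0// sqrtr_gt0 divr_gt0//.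
by rewrite addr_gt0// divr_gt0.
Qed.

Let G (z t : R) : \bar R := (Num.sqrt t ^+ n * expR (- (2^-1 * (t * z))))%:E.

Let mG z : measurable_fun setT (G z).
Proof.
apply/measurable_EFinP; apply: measurable_funM.
  by apply: measurable_funX; exact: measurable_sqrtr.
apply: measurableT_comp => //; apply: measurableT_comp => //.
by apply: measurable_funM => //; exact: measurable_funM.
Qed.

Let G_ge0 z t : (0 <= G z t)%E.
Proof. by rewrite lee_fin mulr_ge0 ?expR_ge0// exprn_ge0// sqrtr_ge0. Qed.

Let mT : measurable_fun setT T.
Proof. exact: measurable_funP. Qed.

Let mT' : measurable_fun setT (T : Om -> measurableTypeR R).
Proof. exact: mT. Qed.

Lemma ge0_expectation_density (p : R -> R) (F : R -> \bar R) :
  measurable_fun setT p -> (forall t, 0 <= p t) ->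
  (forall A : set (measurableTypeR R), measurable A ->
    distribution P T A = \int[lebesgue_measure]_(t in A) (p t)%:E)%E ->
  measurable_fun setT F -> (forall t, 0 <= F t)%E ->
  (\int[P]_w F (T w) = \int[lebesgue_measure]_t (F t * (p t)%:E))%E.
Proof.
move=> mp p0 Tlaw mF F0.
rewrite -(@ge0_integral_density _ _ R lebesgue_measure
  (measure_function_pushforward__canonical__measure_function_Measure P mT') p F)//.
have := @ge0_integral_pushforward _ _ Om (measurableTypeR R) R T mT' P setT F
  measurableT mF (fun y _ => F0 y).
by rewrite preimage_setT => ->.
Qed.

Lemma ge0_expectation_law (law : {measure set (measurableTypeR R) -> \bar R}) (F : R -> \bar R) :
  (forall A : set (measurableTypeR R), measurable A -> distribution P T A = law A) ->
  measurable_fun setT F -> (forall t, 0 <= F t)%E ->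
  (\int[P]_w F (T w) = \int[law]_t F t)%E.
Proof.
move=> Tlaw mF F0.
transitivity (\int[measure_function_pushforward__canonical__measure_function_Measure P mT']_t F t)%E.
  have := @ge0_integral_pushforward _ _ Om (measurableTypeR R) R T mT' P setT F
    measurableT mF (fun y _ => F0 y).
  by rewrite preimage_setT => ->.
by apply: eq_measure_integral => A mA _; exact: Tlaw.
Qed.

Section gamma.
Variables (k r c : R).
Hypotheses (k0 : 0 < k) (r0 : 0 < r) (c0 : 0 <= c).
(** The constant [c] is kept free so that the exponential law, with [k = 1] and [c] its rate, and
    the gamma law share one argument. *)
Let p (t : R) : R := (0 < t)%R%:R * (c * t `^ (k - 1) * expR (- (r * t))).
Hypothesis Tlaw : forall A : set (measurableTypeR R), measurable A ->
  distribution P T A = (\int[lebesgue_measure]_(t in A) (p t)%:E)%E.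

Let p0 t : 0 <= p t.
Proof. by rewrite mulr_ge0// mulr_ge0 ?expR_ge0// mulr_ge0// powR_ge0. Qed.

Let mp : measurable_fun setT p.
Proof.
apply: measurable_funM; first by apply: measurable_natr_bool; exact: measurable_fun_ltr.
apply: measurable_funM.
  by apply: measurable_funM => //; exact: measurable_powR.
by apply: measurableT_comp => //; apply: measurableT_comp => //; exact: measurable_funM.
Qed.

(** Substituting [u = (z/2 + r) t] merges the two exponentials into [exp (- u)]. The powers of
    [z/2 + r] come out with exponents [-n/2] and [-k], in front of an integral [I] independent of
    [z]. *)
Lemma gamma_profile_decreasing : profile_decreasing n T (n%:R * r).
Proof.
pose a (u : R) : \bar R := ((0 < u)%R%:R * (Num.sqrt u ^+ n * expR (- u) * (c * u `^ (k - 1))))%:E.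
have a0 u : (0 <= a u)%E.
  by rewrite lee_fin mulr_ge0// mulr_ge0// ?mulr_ge0 ?expR_ge0 ?powR_ge0.
have ma : measurable_fun setT a.
  apply/measurable_EFinP; apply: measurable_funM.
    by apply: measurable_natr_bool; exact: measurable_fun_ltr.
  apply: measurable_funM; last first.
    by apply: measurable_funM => //; exact: measurable_powR.
  apply: measurable_funM.
    by apply: measurable_funX; exact: measurable_sqrtr.
  by apply: measurableT_comp => //; exact: measurableT_comp.
pose I := (\int[lebesgue_measure]_u a u)%E.
have key z : 0 < z -> ((snr_profile n T z)%:E =
    ((z / 2 + r) `^ (- k) / Num.sqrt (z / 2 + r) ^+ n)%:E * I)%E.
  move=> z0; have s0 : 0 < z / 2 + r by rewrite addr_gt0// divr_gt0.
  have si0 : 0 < (z / 2 + r)^-1 by rewrite invr_gt0.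
  rewrite -snr_profileE//.
  rewrite (ge0_expectation_density mp p0 Tlaw (mG z) (G_ge0 z)).
  rewrite (ge0_integral_scale si0)//; last 2 first.
  - by apply: emeasurable_funM; [exact: mG|exact/measurable_EFinP].
  - by move=> t; rewrite mule_ge0 ?lee_fin.
  have mGp : measurable_fun setT (fun t => G z t * (p t)%:E)%E.
    by apply: emeasurable_funM; [exact: mG|exact/measurable_EFinP].
  rewrite -ge0_integralZl_EFin//; last 3 first.
  - by move=> t _; rewrite mule_ge0 ?lee_fin.
  - by apply: (measurableT_comp mGp); exact: measurable_funM.
  - exact: ltW.
  rewrite /I -ge0_integralZl_EFin//; last first.
    by rewrite divr_ge0 ?powR_ge0// exprn_ge0// sqrtr_ge0.
  apply: eq_integral => u _; rewrite /G /p /a -!EFinM; congr EFin.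
  rewrite pmulr_rgt0//; have [u0|_] := ltP 0 u; last by rewrite !mul0r !mulr0.
  rewrite !mul1r sqrtrM ?(ltW si0)// sqrtrV ?(ltW s0)// exprMn exprVn.
  rewrite powRM ?(ltW si0) ?(ltW u0)//.
  have -> : ((z / 2 + r)^-1) `^ (k - 1) = (z / 2 + r) `^ (- k) * (z / 2 + r).
    move: (z / 2 + r) s0 => y y0.
    rewrite -powR_inv1 ?(ltW y0)// -powRrM mulN1r opprB [1 - k]addrC powRD.
      by rewrite powRr1 ?(ltW y0).
    by rewrite (gt_eqF y0) implybT.
  have -> : expR (- u) = expR (- (2^-1 * ((z / 2 + r)^-1 * u * z))) * expR (- (r * ((z / 2 + r)^-1 * u))).
    by rewrite -expRD; congr expR; field; lra.
  move: (expR (- (2^-1 * _))) (expR (- (r * _))) => e1 e2.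
  have : Num.sqrt (z / 2 + r) ^+ n != 0 by rewrite expf_neq0// gt_eqF// sqrtr_gt0.
  move: (Num.sqrt (z / 2 + r) ^+ n) => S S0.
  by move: (z / 2 + r) s0 => y y0; field; rewrite ?S0 ?gt_eqF.
have I0 : (0 <= I)%E by exact: integral_ge0.
(* That [I] is finite and positive is inferred from the profile at [z = 1], already known to be so,
   without estimating the integral. *)
have [J J0 IJ] : exists2 J, 0 < J & I = J%:E.
  have := key 1 ltr01; have := snr_profile_gt0 n T_ge0 T_gt0 (ltr01 : 0 < 1 :> R).
  set K := (_ / _); have K0 : 0 < K.
    have s0 : 0 < 1 / 2 + r by rewrite addr_gt0// divr_gt0.
    by rewrite divr_gt0 ?powR_gt0// exprn_gt0// sqrtr_gt0.
  case: (I) I0 => [J| |]// J0 P0; last by rewrite gt0_muley.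
  rewrite -EFinM => -[KJ]; exists J => //.
  by move: P0; rewrite KJ pmulr_rgt0.
apply: (profile_decreasing_of_form r0 (D := fun z => J * (z / 2 + r) `^ (- k))).
- move=> z z0; rewrite mulr_gt0// powR_gt0// addr_gt0// divr_gt0//.
- move=> z z' z0 zz'; rewrite ltr_pM2l// !powRN.
  have s0 : 0 < z / 2 + r by rewrite addr_gt0// divr_gt0.
  have s'0 : 0 < z' / 2 + r by rewrite addr_gt0// divr_gt0// (lt_trans z0).
  rewrite ltf_pV2 ?posrE ?powR_gt0// gt0_ltr_powR ?nnegrE ?(ltW s0) ?(ltW s'0)//.
  by rewrite ltrD2r ltr_pM2r.
- by move=> z z0; apply: EFin_inj; rewrite key// IJ -EFinM; congr EFin; ring.
Qed.

End gamma.

Section rice.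
Variables (a b sigma : R).
Hypothesis sigma0 : 0 < sigma.
Hypothesis Tlaw : has_law T (Rice_law a b sigma).

(** Expanding the squares in the product of the two normal densities: [r] carries the quadratic
    part, [c] the linear part and [C0] the constant. *)
Let r : R := (2 * sigma ^+ 2)^-1.
Let c : Rn R 2 := [tuple a / sigma ^+ 2; b / sigma ^+ 2].
Let C0 : R := normal_peak sigma ^+ 2 * expR (- (r * (a ^+ 2 + b ^+ 2))).
Let LR2 := lebesgue_Rn R 2.

Let r0 : 0 < r.
Proof. by rewrite invr_gt0 mulr_gt0// exprn_gt0. Qed.

Let C0_gt0 : 0 < C0.
Proof. by rewrite mulr_gt0 ?expR_gt0// exprn_gt0// normal_peak_gt0// gt_eqF. Qed.

Let dens (y : Rn R 2) : R := C0 * (expR (- (r * sqnormRn y)) * expR (dotRn c y)).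

Let msq : measurable_fun setT (fun z : measurableTypeR R * measurableTypeR R =>
  (z.1 : R) ^+ 2 + (z.2 : R) ^+ 2 : measurableTypeR R).
Proof. by apply: measurable_funD; apply: measurable_funX. Qed.

Let normal_pdfM (x y : R) : normal_pdf a sigma x * normal_pdf b sigma y =
  dens (consRn (x, consRn (y, [tuple] : Rn R 0))).
Proof.
rewrite !normal_pdfE ?gt_eqF// /dens /sqnormRn /c.
have -> : [tuple a / sigma ^+ 2; b / sigma ^+ 2] =
    consRn (a / sigma ^+ 2, consRn (b / sigma ^+ 2, [tuple] : Rn R 0)).
  by apply/val_inj.
rewrite !dotRn_cons /dotRn big_ord0 !addr0 /normal_fun /C0.
rewrite mulrACA -expr2 -[RHS]mulrA; congr (_ * _).
rewrite -!expRD; congr (expR _); rewrite /r.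
by field; rewrite gt_eqF.
Qed.

Let dens_ge0 y : 0 <= dens y.
Proof. by rewrite mulr_ge0 ?(ltW C0_gt0)// mulr_ge0 ?expR_ge0. Qed.

Let mdens : measurable_fun setT dens.
Proof.
apply: measurable_funM => //; apply: measurable_funM.
  by have /measurable_EFinP := @measurable_gaussRn R 2 r.
by apply: measurableT_comp => //; exact: measurable_dotRn.
Qed.

(** Integrating over the plane of the complex gain keeps the density elementary; the density of its
    squared modulus would involve a Bessel function. *)
Let ge0_expectation_rice (F : R -> \bar R) :
  measurable_fun setT F -> (forall t, 0 <= F t)%E ->
  (\int[P]_w F (T w) = \int[LR2]_y (F (sqnormRn y) * (dens y)%:E))%E.
Proof.
move=> mF F0.
rewrite (ge0_expectation_law (law := measure_function_pushforward__canonical__measure_function_Measure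
  (normal_prob a sigma \x normal_prob b sigma)%E msq))//.
have := @ge0_integral_pushforward _ _ _ (measurableTypeR R) R _ msq
  (normal_prob a sigma \x normal_prob b sigma)%E setT F measurableT mF (fun y _ => F0 y).
rewrite preimage_setT => ->.
have mFsq : measurable_fun setT (F \o (fun z : measurableTypeR R * measurableTypeR R =>
    (z.1 : R) ^+ 2 + (z.2 : R) ^+ 2 : measurableTypeR R)).
  exact: measurableT_comp.
rewrite fubini_tonelli1//; last by move=> z; exact: F0.
have mn m : measurable_fun setT (fun x => normal_pdf m sigma x).
  exact: measurable_normal_pdf.
rewrite (@ge0_integral_density _ _ R lebesgue_measure _ (normal_pdf a sigma))//; last 4 first.
- exact: mn.
- by move=> x; exact: normal_pdf_ge0.
- by apply: measurable_fun_fubini_tonelli_F => // z; exact: F0.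
- by move=> x; apply: integral_ge0 => y _; exact: F0.
have mG2 : measurable_fun setT (fun y => F (sqnormRn y) * (dens y)%:E)%E.
  apply: emeasurable_funM; last exact/measurable_EFinP.
  by apply: measurableT_comp => //; exact: measurable_sqnormRn.
rewrite /LR2 ge0_integral_lebesgue_RnS//; last by move=> y; rewrite mule_ge0 ?lee_fin.
apply: eq_integral => x _.
rewrite ge0_integral_lebesgue_RnS//; last 2 first.
- by apply: (measurableT_comp mG2); exact: measurable_consRnr.
- by move=> y; rewrite mule_ge0 ?lee_fin.
have mFx : measurable_fun setT (fun y : R => F (x ^+ 2 + y ^+ 2)).
  exact: (measurableT_comp mFsq (measurable_pair1 (x : measurableTypeR R))).
rewrite [fubini_F _ _ x](@ge0_integral_density _ _ R lebesgue_measure (normal_prob b sigma)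
  (normal_pdf b sigma) (fun y => F (x ^+ 2 + y ^+ 2)) (mn b) (normal_pdf_ge0 b sigma)
  (fun A mA => erefl) mFx (fun y => F0 _)).
rewrite -ge0_integralZr//; last 3 first.
- by apply: emeasurable_funM => //; apply/measurable_EFinP; exact: mn.
- by move=> y _; rewrite mule_ge0 ?lee_fin ?normal_pdf_ge0.
- by rewrite lee_fin normal_pdf_ge0.
apply: eq_integral => y _; rewrite integral_dirac//; last first.
  apply: (measurableT_comp (measurableT_comp mG2 (@measurable_consRnr R 1 x))).
  exact: measurable_consRnr.
rewrite diracT mul1e -normal_pdfM /= /sqnormRn !dotRn_cons /dotRn big_ord0 addr0.
by rewrite -muleA -EFinM -!expr2 [in RHS]mulrC.
Qed.

(** What remains of the profile after scaling the plane by [tau = (z/2 + r)^(-1/2)]: the Gaussian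
    part becomes [exp (- |y|^2)] and only the linear term still depends on [tau]. *)
Let K (tau : R) : \bar R := (\int[LR2]_y
  (Num.sqrt (sqnormRn y) ^+ n * expR (- sqnormRn y) * expR (tau * dotRn c y))%:E)%E.

Let mK tau : measurable_fun setT (fun y : Rn R 2 =>
  (Num.sqrt (sqnormRn y) ^+ n * expR (- sqnormRn y) * expR (tau * dotRn c y))%:E).
Proof.
apply/measurable_EFinP; apply: measurable_funM.
  apply: measurable_funM.
    apply: measurable_funX; apply: measurableT_comp; first exact: measurable_sqrtr.
    exact: measurable_sqnormRn.
  apply: measurableT_comp => //; apply: measurableT_comp => //.
  exact: measurable_sqnormRn.
apply: measurableT_comp => //; apply: measurable_funM => //.
exact: measurable_dotRn.
Qed.

Let K_ge0 tau : (0 <= K tau)%E.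
Proof.
by apply: integral_ge0 => y _; rewrite lee_fin mulr_ge0 ?expR_ge0// mulr_ge0 ?expR_ge0.
Qed.

Let cosh_mono (x y : R) : 0 <= x -> x <= y -> expR x + expR (- x) <= expR y + expR (- y).
Proof.
move=> x0 xy; rewrite -subr_ge0.
have -> : expR y + expR (- y) - (expR x + expR (- x)) =
    (expR y - expR x) * (1 - expR (- (x + y))).
  by rewrite !expRN expRD; field; rewrite !gt_eqF ?expR_gt0.
rewrite mulr_ge0 ?subr_ge0 ?ler_expR// -expR0 ler_expR oppr_le0 addr_ge0//.
exact: le_trans xy.
Qed.

(* Reflecting [y] replaces the exponential by a hyperbolic cosine, which is
   nondecreasing in [tau]. *)
Let K_nondecreasing tau tau' : 0 <= tau -> tau <= tau' -> (K tau <= K tau')%E.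
Proof.
move=> tau0 tt'.
pose h (y : Rn R 2) : R := Num.sqrt (sqnormRn y) ^+ n * expR (- sqnormRn y).
have h0 y : 0 <= h y by rewrite mulr_ge0 ?expR_ge0// exprn_ge0// sqrtr_ge0.
have sym t : (K t + K t = \int[LR2]_y (h y * (expR (t * dotRn c y) + expR (- (t * dotRn c y))))%:E)%E.
  have KN : K t = (\int[LR2]_y (h y * expR (- (t * dotRn c y)))%:E)%E.
    have N1 : (-1 : R) != 0 by rewrite oppr_eq0 oner_eq0.
    rewrite /K (ge0_integral_scaleRn_neq0 N1)//.
    rewrite normrN1 expr1n mul1e; apply: eq_integral => y _.
    by rewrite sqnormRnZ sqrrN expr1n mul1r dotRnZr mulN1r mulrN.
  rewrite {1}/K KN -ge0_integralD//.
  - by apply: eq_integral => y _; rewrite -EFinD -mulrDr.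
  - by move=> y _; rewrite lee_fin mulr_ge0 ?expR_ge0//; exact: h0.
  - by have := mK (- t); under eq_fun do rewrite mulNr.
have : (K tau + K tau <= K tau' + K tau')%E.
  rewrite !sym; apply: ge0_le_integral => //.
  - by move=> y _; rewrite lee_fin mulr_ge0// addr_ge0 ?expR_ge0.
  - have := emeasurable_funD (mK tau) (mK (- tau)).
    by under eq_fun do rewrite -EFinD -mulrDr mulNr.
  - have := emeasurable_funD (mK tau') (mK (- tau')).
    by under eq_fun do rewrite -EFinD -mulrDr mulNr.
  - move=> y _; rewrite lee_fin ler_wpM2l//.
    have [cy|cy] := leP 0 (dotRn c y).
      by apply: cosh_mono; [rewrite mulr_ge0|rewrite ler_wpM2r].
    have E (t : R) : expR (t * dotRn c y) + expR (- (t * dotRn c y)) =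
        expR (t * - dotRn c y) + expR (- (t * - dotRn c y)).
      by rewrite mulrN opprK addrC.
    have cy' : 0 <= - dotRn c y by rewrite oppr_ge0 ltW.
    rewrite (E tau) (E tau'); apply: cosh_mono; [exact: mulr_ge0|exact: ler_wpM2r].
have := K_ge0 tau; have := K_ge0 tau'.
case: (K tau) (K tau') => [x| |] [y| |]//; rewrite -?EFinD ?lee_fin ?leey//.
by move=> *; lra.
Qed.

(** The scaling yields [tau^2] from the Jacobian in the plane and [tau^n], which is the factor
    [(z/2 + r)^(-n/2)]. As [z] grows [tau] decreases, so [tau^2] decreases strictly and [K tau] does
    not increase. *)
Lemma rice_profile_decreasing : profile_decreasing n T (n%:R * r).
Proof.
pose tau z := (Num.sqrt (z / 2 + r))^-1.
have s0 z : 0 < z -> 0 < z / 2 + r by move=> z0; rewrite addr_gt0// divr_gt0.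
have tau0 z : 0 < z -> 0 < tau z by move=> z0; rewrite invr_gt0 sqrtr_gt0 s0.
have key z : 0 < z -> ((snr_profile n T z)%:E =
    (C0 * tau z ^+ 2 * tau z ^+ n)%:E * K (tau z))%E.
  move=> z0; rewrite -snr_profileE//.
  have := ge0_expectation_rice (mG z) (G_ge0 z); rewrite /G => ->.
  have mint : measurable_fun setT (fun y : Rn R 2 => G z (sqnormRn y) * (dens y)%:E)%E.
    apply: emeasurable_funM; last exact/measurable_EFinP.
    by apply: measurableT_comp; [exact: mG|exact: measurable_sqnormRn].
  rewrite (ge0_integral_scaleRn (tau0 z z0))//; last first.
    by move=> y; rewrite mule_ge0 ?lee_fin ?dens_ge0//; exact: G_ge0.
  rewrite -ge0_integralZl_EFin//; last 3 first.
  - by move=> y _; rewrite mule_ge0 ?lee_fin ?dens_ge0//; exact: G_ge0.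
  - by apply: (measurableT_comp mint); exact: measurable_scaleRn.
  - by rewrite exprn_ge0// ltW// tau0.
  rewrite /K -ge0_integralZl_EFin//; last first.
    rewrite mulr_ge0 ?exprn_ge0 ?(ltW (tau0 _ _))// mulr_ge0 ?(ltW C0_gt0)//.
    by rewrite exprn_ge0 ?(ltW (tau0 _ _)).
  apply: eq_integral => y _; rewrite /dens -!EFinM; congr EFin.
  rewrite sqnormRnZ dotRnZr sqrtrM ?sqr_ge0// sqrtr_sqr gtr0_norm ?tau0// exprMn.
  have -> : expR (- sqnormRn y) =
      expR (- (2^-1 * (tau z ^+ 2 * sqnormRn y * z))) * expR (- (r * (tau z ^+ 2 * sqnormRn y))).
    rewrite -expRD /tau exprVn sqr_sqrtr ?(ltW (s0 _ z0))//; congr expR.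
    by field; have := s0 _ z0; lra.
  by ring.
have K01 z : 0 < z -> exists2 J, 0 < J & K (tau z) = J%:E.
  move=> z0; have := key z z0; have := snr_profile_gt0 n T_ge0 T_gt0 z0.
  set A := C0 * _ * _; have A0 : 0 < A.
    by rewrite mulr_gt0 ?exprn_gt0 ?tau0// mulr_gt0 ?exprn_gt0 ?tau0.
  have := K_ge0 (tau z); case: (K (tau z)) => [J| |]// J0 P0; last by rewrite gt0_muley.
  rewrite -EFinM => -[KJ]; exists J => //.
  by move: P0; rewrite KJ pmulr_rgt0.
apply: (profile_decreasing_of_form r0
  (D := fun z => C0 * tau z ^+ 2 * fine (K (tau z)))).
- move=> z z0; have [J J0 ->] := K01 _ z0.
  by rewrite mulr_gt0// mulr_gt0// exprn_gt0// tau0.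
- move=> z z' z0 zz'; have z'0 := lt_trans z0 zz'.
  have tlt : tau z' < tau z.
    by rewrite ltf_pV2 ?posrE ?sqrtr_gt0 ?s0// ltr_sqrt ?s0// ltrD2r ltr_pM2r.
  have [J J0 JE] := K01 _ z0; have [J' J'0 J'E] := K01 _ z'0.
  have := K_nondecreasing (ltW (tau0 _ z'0)) (ltW tlt).
  rewrite JE J'E lee_fin /= => J'J.
  apply: (@le_lt_trans _ _ (C0 * tau z' ^+ 2 * J)).
    by rewrite ler_wpM2l// mulr_ge0 ?(ltW C0_gt0)// exprn_ge0// ltW// tau0.
  by rewrite ltr_pM2r// ltr_pM2l// ltr_pXn2r ?nnegrE ?(ltW (tau0 _ _)).
- move=> z z0; have [J J0 JE] := K01 _ z0.
  apply: EFin_inj; rewrite key// JE -EFinM /= /tau -exprVn; congr EFin.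
  by ring.
Qed.

End rice.

End profile_laws.

Section fading_laws.
Context {R : realType} d (Om : measurableType d) (P : probability Om R) (T : {RV P >-> R}).

Lemma ae_gt0_of_law : (forall w, 0 <= T w) -> distribution P T [set 0] = 0%E ->
  {ae P, forall w, 0 < T w}.
Proof.
move=> T0 Tz; exists (T @^-1` [set 0]); split => //.
move=> w /= /negP; rewrite -leNgt => Tw0.
  by apply/le_anti; rewrite Tw0 T0.
Qed.

Lemma has_law_at0 mu : has_law T mu -> mu [set 0] = 0%E -> distribution P T [set 0] = 0%E.
Proof. by move=> Tlaw <-; apply: Tlaw; exact: measurable_set1. Qed.

Lemma Rice_law_at0 (a b sigma : R) : 0 < sigma -> @Rice_law R a b sigma [set 0] = 0%E.
Proof.
move=> s0; rewrite /Rice_law /pushforward.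
have -> : (fun z : measurableTypeR R * measurableTypeR R =>
    (z.1 : R) ^+ 2 + (z.2 : R) ^+ 2 : measurableTypeR R) @^-1` [set 0] = [set 0] `*` [set 0].
  apply/seteqP; split => -[x y] /=.
    by move=> /eqP; rewrite paddr_eq0 ?sqr_ge0// !sqrf_eq0 => /andP[/eqP -> /eqP ->].
  by move=> [-> ->]; rewrite expr0n addr0.
rewrite product_measure1E; try exact: measurable_set1.
have Z : normal_prob a sigma [set (0 : R)] = 0%E by rewrite /normal_prob integral_set1.
by rewrite [X in (X * _)%E]Z mul0e.
Qed.

Lemma fading_gt0 : fading T -> {ae P, forall w, 0 < T w}.
Proof.
move=> [T0 _ laws]; apply: ae_gt0_of_law => //.
case: laws => [[rate rate0 law]|[a [b [sigma [sigma0 law]]]]|[k [rate [k0 rate0 law]]]].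
- by apply: (has_law_at0 law); rewrite /exponential_prob integral_set1.
- by apply: (has_law_at0 law); exact: Rice_law_at0.
- apply: (has_law_at0 law); rewrite /gamma_law (_ : _ `&` _ = set0) ?integral_set0//.
  by apply/seteqP; split => t //= -[->]; rewrite in_itv/= ltxx.
Qed.

Lemma fading_profile_decreasing n : fading T ->
  exists2 z0, 0 <= z0 & profile_decreasing n T z0.
Proof.
move=> fT; have Tpos := fading_gt0 fT; case: fT => [T0 _ laws].
have mexp (r : R) : measurable_fun setT (fun t : R => expR (- (r * t))).
  by apply: measurableT_comp => //; apply: measurableT_comp => //; exact: measurable_funM.
case: laws => [[rate rate0 law]|[a [b [sigma [sigma0 law]]]]|[k [rate [k0 rate0 law]]]].
- exists (n%:R * rate); first by rewrite mulr_ge0// ltW.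
  apply: (gamma_profile_decreasing T0 Tpos (k := 1) (c := rate)) => //; first exact: ltW.
  move=> A mA; rewrite law// /exponential_prob.
  apply: ge0_ae_eq_integral => //.
  + by apply: measurable_funTS; apply/measurable_EFinP; exact: measurable_exponential_pdf.
  + apply: measurable_funTS; apply/measurable_EFinP; apply: measurable_funM.
      by apply: measurable_natr_bool; exact: measurable_fun_ltr.
    by apply: measurable_funM; [apply: measurable_funM => //; exact: measurable_powR|exact: mexp].
  + by move=> t _; rewrite lee_fin; apply: exponential_pdf_ge0; exact: ltW.
  + by move=> t _; rewrite lee_fin mulr_ge0// mulr_ge0 ?expR_ge0// mulr_ge0 ?powR_ge0// ltW.
  (* The exponential density includes the endpoint 0, where the factor [(0 < t)] vanishes; the two
     densities agree off this null set. *)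
  exists [set 0]; split; [exact: measurable_set1|exact: lebesgue_measure_set1|].
  move=> t /= /not_implyP[_ ne]; apply: contrapT => t0; apply: ne; congr EFin.
  have [tpos|tneg] := ltP 0 t.
    by rewrite exponential_pdfE ?(ltW tpos)// subrr powRr0 mulr1 mul1r mulNr.
  by rewrite mul0r lt0_exponential_pdf// lt_neqAle tneg andbT; apply/eqP.
- exists (n%:R * (2 * sigma ^+ 2)^-1).
    by rewrite mulr_ge0// invr_ge0 mulr_ge0// sqr_ge0.
  exact: (rice_profile_decreasing T0 Tpos sigma0 law).
- exists (n%:R * rate); first by rewrite mulr_ge0// ltW.
  apply: (gamma_profile_decreasing T0 Tpos (k := k) (c := rate `^ k / Gamma_fun k)) => //.
    rewrite divr_ge0 ?powR_ge0// /Gamma_fun fine_ge0//; apply: integral_ge0 => t _.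
    by rewrite lee_fin mulr_ge0 ?powR_ge0 ?expR_ge0.
  move=> A mA; rewrite law// /gamma_law integral_mkcondr.
  apply: eq_integral => t _; rewrite patchE mem_setE in_itv/= andbT /gamma_pdf.
  by case: (0 < t); rewrite ?mul1r// mul0r.
Qed.

End fading_laws.

(** * Error rates *)

Section error_rate.
Context {R : realType} (n M : nat) (s : 'I_M -> Rn R n) (p : 'I_M -> R).
Hypothesis M2 : (2 <= M)%N.
Hypothesis s_inj : injective s.
Hypothesis p_prior : is_prior p.

Let p_ge0 i : 0 <= p i. Proof. by case: p_prior. Qed.
Let p_sum : \sum_(i < M) p i = 1. Proof. by case: p_prior. Qed.

Definition total_correct_prob (g : R) : R := \sum_(i < M) p i * correct_prob s i g.

Lemma Pe_posE g : 0 < g -> Pe_pos s p g = 1 - total_correct_prob g.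
Proof.
move=> g0; rewrite /Pe_pos /total_correct_prob -p_sum -sumrB; apply: eq_bigr => i _.
by rewrite PeiE//; ring.
Qed.

Lemma total_correct_prob_nondecreasing : {homo total_correct_prob : g h / g <= h}.
Proof.
move=> g h gh; apply: ler_sum => i _; apply: ler_wpM2l => //.
exact: correct_prob_nondecreasing.
Qed.

Lemma total_correct_prob_ge0 g : 0 <= total_correct_prob g.
Proof. by apply: sumr_ge0 => i _; rewrite mulr_ge0// correct_prob_ge0. Qed.

Lemma total_correct_prob_le1 g : total_correct_prob g <= 1.
Proof.
rewrite -p_sum; apply: ler_sum => i _; rewrite -[leRHS]mulr1 ler_wpM2l//.
exact: correct_prob_le1.
Qed.

Let Pe0 := lim (Pe_pos s p h @[h --> 0^'+]).

(** Monotonicity makes the right limit at 0 exist as an infimum, so the [lim] in the definition of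
    [Pe] is a genuine limit and not a default value. *)
Let cvg_total : total_correct_prob h @[h --> 0^'+] --> 1 - Pe0.
Proof.
have cv : total_correct_prob h @[h --> 0^'+] -->
    inf (total_correct_prob @` `]0%R, 1%R[%classic).
  apply: (@nondecreasing_at_right_cvgr _ _ 0 (BLeft 1)) => //.
  - by rewrite bnd_simp.
  - by move=> x y _ _; exact: total_correct_prob_nondecreasing.
  - by exists 0 => _ [x _ <-]; exact: total_correct_prob_ge0.
suff -> : Pe0 = 1 - inf (total_correct_prob @` `]0%R, 1%R[%classic).
  by rewrite opprB addrC subrK.
apply/cvg_lim => //.
have : (1 - total_correct_prob h) @[h --> 0^'+] -->
    1 - inf (total_correct_prob @` `]0%R, 1%R[%classic).
  by apply: cvgB => //; exact: cvg_cst.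
apply: cvg_trans; apply: near_eq_cvg; near=> h.
by rewrite Pe_posE.
Unshelve. all: by end_near.
Qed.

Lemma PeE g : 0 < g -> Pe s p g = 1 - total_correct_prob g.
Proof. by move=> g0; rewrite /Pe g0 Pe_posE. Qed.

Let Pe_le0 g : g <= 0 -> Pe s p g = Pe0.
Proof. by move=> g0; rewrite /Pe ltNge g0. Qed.

Let Pe0_bounds g : 0 < g -> 0 <= 1 - Pe0 <= total_correct_prob g.
Proof.
move=> g0; apply/andP; split.
  rewrite -(cvg_lim (@norm_hausdorff _ R) cvg_total); apply: limr_ge; first exact: cvgP cvg_total.
  by near=> h; exact: total_correct_prob_ge0.
rewrite -(cvg_lim (@norm_hausdorff _ R) cvg_total); apply: limr_le; first exact: cvgP cvg_total.
near=> h; apply: total_correct_prob_nondecreasing.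
by near: h; apply: nbhs_right_le.
Unshelve. all: by end_near.
Qed.

Lemma Pe_ge0 g : 0 <= Pe s p g.
Proof.
have [g0|g0] := ltP 0 g; first by rewrite PeE// subr_ge0 total_correct_prob_le1.
rewrite Pe_le0//; have /andP[_] := Pe0_bounds (ltr01 : 0 < 1).
by have := total_correct_prob_le1 1; lra.
Qed.

Lemma Pe_le1 g : Pe s p g <= 1.
Proof.
have [g0|g0] := ltP 0 g; first by rewrite PeE// gerBl total_correct_prob_ge0.
by rewrite Pe_le0//; have /andP[] := Pe0_bounds (ltr01 : 0 < 1); rewrite subr_ge0.
Qed.

Lemma Pe_nonincreasing : {homo Pe s p : g h /~ g <= h}.
Proof.
move=> h g gh; have [g0|g0] := ltP 0 g.
  have h0 := lt_le_trans g0 gh.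
  by rewrite !PeE// lerB// total_correct_prob_nondecreasing.
rewrite (Pe_le0 g0); have [h0|h0] := ltP 0 h; last by rewrite Pe_le0.
by rewrite PeE//; have /andP[_] := Pe0_bounds h0; rewrite lerBlDr -lerBlDl.
Qed.

Lemma total_correct_prob_continuous (g : R) : 0 < g -> {for g, continuous total_correct_prob}.
Proof.
move=> g0; suff : (\sum_(i < M) p i * correct_prob s i h) @[h --> g] -->
  \sum_(i < M) p i * correct_prob s i g by [].
elim: (index_enum _) => [|i r IH].
  by rewrite big_nil; under eq_cvg do rewrite big_nil; exact: cvg_cst.
rewrite big_cons; under eq_cvg do rewrite big_cons.
apply: cvgD => //; apply: cvgM; first exact: cvg_cst.
exact: correct_prob_continuous.
Qed.

(** Continuity at 0 matters because allocations may switch a stream off; to the left of 0 the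
    function is constant. *)
Lemma Pe_continuous : continuous (Pe s p).
Proof.
move=> g; have [g0|g0|g0] := ltgtP g 0.
- rewrite /continuous_at Pe_le0 ?(ltW g0)//; apply: cvg_near_cst; near=> h.
  by apply/Pe_le0/ltW; near: h; exact: lt_nbhsl.
- rewrite /continuous_at PeE//.
  have : (1 - total_correct_prob h) @[h --> g] --> 1 - total_correct_prob g.
    by apply: cvgB; [exact: cvg_cst|exact: total_correct_prob_continuous].
  apply: cvg_trans; apply: near_eq_cvg; near=> h.
  by rewrite PeE//; near: h; exact: lt_nbhsr.
- rewrite g0 /continuous_at Pe_le0//; apply/cvgrPdist_lt => e e0.
  have := cvg_total => /cvgrPdist_lt/(_ _ e0).
  rewrite /at_right near_withinE => H; near=> h.
  have [h0|h0] := ltP 0 h; last by rewrite Pe_le0// subrr normr0.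
  rewrite PeE// -normrN.
  rewrite (_ : - (Pe0 - (1 - total_correct_prob h)) = 1 - Pe0 - total_correct_prob h); last by ring.
  by move: h0; near: h; exact: H.
Unshelve. all: by end_near.
Qed.

End error_rate.

(** [4 F(x) F(y) <= (F(x) + F(y))^2], which is less than four times the square of [F] at the
    midpoint. *)
Lemma strict_midpoint_log_concave {R : realFieldType} (pe F : R -> R) x y :
  (forall t, 0 < t -> pe t = 1 - F t) -> (forall t, 0 <= F t) -> 0 < x -> x < y ->
  F x + F y < 2 * F (2^-1 * (x + y)) ->
  (1 - pe x) * (1 - pe y) < (1 - pe (2^-1 * (x + y))) ^+ 2.
Proof.
move=> peE F0 x0 xy; have y0 := lt_trans x0 xy.
rewrite !peE//; last by lra.
rewrite !subKr; move: (F0 x) (F0 y).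
move: (F x) (F y) (F (2^-1 * (x + y))) => a b c a0 b0 abc; have c0 : 0 < c by lra.
have h1 : 0 < (2 * c - (a + b)) * (2 * c + (a + b)) by apply: mulr_gt0; lra.
have h2 := sqr_ge0 (a - b).
have E1 : (2 * c - (a + b)) * (2 * c + (a + b)) = 4 * c ^+ 2 - 4 * (a * b) - (a - b) ^+ 2 by ring.
by rewrite E1 in h1; lra.
Qed.

Lemma ltr_sum_ex {R : realType} (I : finType) (F G : I -> R) i :
  (forall j, F j <= G j) -> F i < G i -> \sum_j F j < \sum_j G j.
Proof.
move=> FG FGi; rewrite (bigD1 i)//= [ltRHS](bigD1 i)//=; apply: ltr_leD => //.
exact: ler_sum.
Qed.

Lemma prior_pos {R : realType} M (p : 'I_M -> R) : is_prior p -> exists i, 0 < p i.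
Proof.
move=> [p0 p1]; apply: contrapT => /forallNP np.
move: p1; rewrite big1 => [/eqP|i _]; first by rewrite eq_sym oner_eq0.
by apply/le_anti; rewrite p0 andbT leNgt; apply/negP/np.
Qed.

(** * Error rate averaged over fading *)

Section average_error_rate.
Context {R : realType} (n M : nat) (s : 'I_M -> Rn R n) (p : 'I_M -> R).
Hypothesis M2 : (2 <= M)%N.
Hypothesis s_inj : injective s.
Hypothesis p_prior : is_prior p.
Context d (Om : measurableType d) (P : probability Om R) (T : {RV P >-> R}).
Hypothesis T_ge0 : forall w, 0 <= T w.
Hypothesis T_gt0 : {ae P, forall w, 0 < T w}.

Let p_ge0 i : 0 <= p i. Proof. by case: p_prior. Qed.
Let p_sum : \sum_(i < M) p i = 1. Proof. by case: p_prior. Qed.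

Definition avg_total_correct_prob (g : R) : R := \sum_(i < M) p i * avg_correct_prob s i T g.

Let mtotal : measurable_fun setT (total_correct_prob s p).
Proof.
apply: nondecreasing_measurable => // g h gh.
exact: total_correct_prob_nondecreasing.
Qed.

Let mgT g : measurable_fun setT (fun w => g * T w).
Proof. exact: measurable_funM. Qed.

Let mtotalT g : measurable_fun setT (fun w => (total_correct_prob s p (g * T w))%:E).
Proof. by apply/measurable_EFinP; apply: measurableT_comp. Qed.

Lemma avg_total_correct_probE g :
  (\int[P]_w (total_correct_prob s p (g * T w))%:E = (avg_total_correct_prob g)%:E)%E.
Proof.
rewrite /total_correct_prob /avg_total_correct_prob -sumEFin.
under eq_integral do rewrite -sumEFin.
rewrite ge0_integral_sum//; last 2 first.
- move=> i; apply/measurable_EFinP; apply: measurable_funM => //.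
  by apply: measurableT_comp => //; exact: measurable_correct_prob.
- by move=> i w _; rewrite lee_fin mulr_ge0// correct_prob_ge0.
apply: eq_bigr => i _; rewrite EFinM -avg_correct_probE.
under eq_integral do rewrite EFinM.
rewrite ge0_integralZl_EFin//.
- by move=> w _; rewrite lee_fin correct_prob_ge0.
- apply/measurable_EFinP.
  by apply: measurableT_comp => //; exact: measurable_correct_prob.
Qed.

Let mPe : measurable_fun setT (Pe s p).
Proof. by apply: continuous_measurable_fun => //; exact: Pe_continuous. Qed.

Let mPeT g : measurable_fun setT (fun w => (Pe s p (g * T w))%:E).
Proof. by apply/measurable_EFinP; apply: measurableT_comp. Qed.

Let Pe_ge0' g : 0 <= Pe s p g. Proof. exact: Pe_ge0. Qed.
Let Pe_le1' g : Pe s p g <= 1. Proof. exact: Pe_le1. Qed.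

Lemma expectation_PeE g : (\int[P]_w (Pe s p (g * T w))%:E = (avgPe s p T g)%:E)%E.
Proof.
rewrite /avgPe unlock fineK// ge0_fin_numE; last first.
  by apply: integral_ge0 => w _; rewrite lee_fin.
apply: (@le_lt_trans _ _ (\int[P]_w 1%:E)%E); last first.
  by rewrite integral_probability_cst ltry.
by apply: ge0_le_integral => // w _; rewrite lee_fin.
Qed.

Lemma avgPe_ge0 g : 0 <= avgPe s p T g.
Proof. by rewrite -lee_fin -expectation_PeE integral_ge0// => w _; rewrite lee_fin. Qed.

Lemma avgPe_le1 g : avgPe s p T g <= 1.
Proof.
rewrite -lee_fin -expectation_PeE -(integral_probability_cst P).
by apply: ge0_le_integral => // w _; rewrite lee_fin.
Qed.

Lemma avgPe_nonincreasing : {homo avgPe s p T : g h /~ g <= h}.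
Proof.
move=> h g gh; rewrite -lee_fin -!expectation_PeE.
apply: ge0_le_integral; [exact: measurableT|by move=> w _; rewrite lee_fin|exact: mPeT|exact: mPeT|].
by move=> w _; rewrite lee_fin; apply: Pe_nonincreasing => //; rewrite ler_wpM2r.
Qed.

Lemma avgPe_continuous : continuous (avgPe s p T).
Proof.
move=> g; have gI : g \in `]g - 1, g + 1[%classic by rewrite inE/= in_itv/=; lra.
have one_int : P.-integrable setT (EFin \o (cst 1 : Om -> R)).
  apply/integrableP; split=> //=; first exact/measurable_EFinP.
  under eq_integral do rewrite normr1.
  by rewrite integral_probability_cst ltry.
have Pe1 h w : `|Pe s p (h * T w)| <= 1 by rewrite ger0_norm.
have -> : avgPe s p T = fun h => (\int[P]_w Pe s p (h * T w))%R.
  by apply/funext => h; rewrite /avgPe unlock.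
apply: (@continuity_under_integral R _ _ P (fun h w => Pe s p (h * T w)) setT
  measurableT (g - 1) (g + 1) _ _ (cst 1)) => //=.
- move=> h _; apply: (le_integrable _ _ _ one_int) => //.
    exact: (mPeT h).
  by move=> w _ /=; rewrite lee_fin normr1.
- apply: aeW => w _ h _.
  apply: (@continuous_comp R R R (fun h => h * T w) (Pe s p)).
    by apply: cvgM; [exact: cvg_id|exact: cvg_cst].
  exact: Pe_continuous.
- by move=> h _; apply: aeW => w _ /=.
Qed.

Lemma avgPeE g : 0 < g -> avgPe s p T g = 1 - avg_total_correct_prob g.
Proof.
move=> g0; apply/eqP; rewrite eq_sym subr_eq eq_sym; apply/eqP/EFin_inj.
rewrite EFinD -expectation_PeE -avg_total_correct_probE -ge0_integralD//; last 2 first.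
- by move=> w _; rewrite lee_fin.
- by move=> w _; rewrite lee_fin total_correct_prob_ge0.
rewrite -(integral_probability_cst P); apply: ge0_ae_eq_integral => //.
- exact: emeasurable_funD.
- by move=> w _; rewrite adde_ge0 ?lee_fin// total_correct_prob_ge0.
apply: filterS T_gt0 => w Tw _ /=.
by rewrite -EFinD PeE ?mulr_gt0// subrK.
Qed.

Lemma avg_total_correct_prob_increasing g1 g2 : 0 <= g1 -> g1 < g2 ->
  avg_total_correct_prob g1 < avg_total_correct_prob g2.
Proof.
move=> g10 g12; have [i pi0] := prior_pos p_prior.
have lt j := avg_correct_prob_increasing j M2 s_inj T_ge0 T_gt0 g10 g12.
apply: (ltr_sum_ex (i := i)) => [j|]; last by rewrite (ltr_pM2l pi0); exact: lt.
by apply: (ler_wpM2l (p_ge0 j)); exact/ltW/lt.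
Qed.

Lemma avg_total_correct_prob_ge0 g : 0 <= avg_total_correct_prob g.
Proof.
rewrite -lee_fin -avg_total_correct_probE; apply: integral_ge0 => w _.
by rewrite lee_fin total_correct_prob_ge0.
Qed.

Lemma avg_total_correct_prob_le1 g : avg_total_correct_prob g <= 1.
Proof.
rewrite -lee_fin -avg_total_correct_probE -(integral_probability_cst P).
apply: ge0_le_integral => // w _; rewrite lee_fin ?total_correct_prob_ge0//.
exact: total_correct_prob_le1.
Qed.

Lemma avgPe_lt1 g : 0 < g -> avgPe s p T g < 1.
Proof.
move=> g0; rewrite avgPeE// gtrBl; apply: le_lt_trans (avg_total_correct_prob_ge0 0) _.
exact: avg_total_correct_prob_increasing.
Qed.

Lemma avgPe_gt0 g : 0 <= g -> 0 < avgPe s p T g.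
Proof.
move=> g0; have g10 : 0 < g + 1 by lra.
apply: lt_le_trans (avgPe_nonincreasing (_ : g <= g + 1)); last by lra.
rewrite avgPeE// subr_gt0; apply: lt_le_trans (avg_total_correct_prob_le1 (g + 1 + 1)).
by apply: avg_total_correct_prob_increasing; lra.
Qed.

Lemma total_correct_prob_to1 e : 0 < e -> exists g, 1 - e < total_correct_prob s p g.
Proof.
move=> e0; have [g_ gP] := choice (fun i => correct_prob_to1 s i e0).
exists (\sum_i `|g_ i|); have [i0 pi0] := prior_pos p_prior.
have le i : 1 - e < correct_prob s i (\sum_i `|g_ i|).
  apply: lt_le_trans (gP i) _; apply: correct_prob_nondecreasing.
  rewrite (bigD1 i)//= (le_trans (ler_norm _))// lerDl; exact: sumr_ge0.
rewrite -[1 - e]mul1r -{1}p_sum mulr_suml.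
by apply: (ltr_sum_ex (i := i0)) => [j|]; [rewrite ler_wpM2l// ltW|rewrite ltr_pM2l].
Qed.

(** If the average stayed above [e], monotone convergence would bound by [1 - e] the mean of the
    limit of the correct probability at [k T]. That limit is at least 1 wherever [T > 0]. *)
Lemma avgPe_to0 e : 0 < e -> exists g, avgPe s p T g < e.
Proof.
move=> e0; apply: contrapT => /forallNP ne.
pose u k w := (total_correct_prob s p (k%:R * T w))%:E.
have umono w : {homo u ^~ w : k l / (k <= l)%N >-> (k <= l)%E}.
  move=> k l kl; rewrite lee_fin; apply: total_correct_prob_nondecreasing => //.
  by rewrite ler_wpM2r// ler_nat.
have mlim : measurable_fun setT (fun w => limn (u ^~ w)).
  apply: (emeasurable_fun_cvg u) => // [k|w _]; first exact: mtotalT.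
  exact: ereal_nondecreasing_is_cvgn.
have lim0 w : (0 <= limn (u ^~ w))%E.
  apply: lime_ge; first exact: ereal_nondecreasing_is_cvgn.
  by apply: nearW => k; rewrite lee_fin total_correct_prob_ge0.
have : (\int[P]_w limn (u ^~ w) <= (1 - e)%:E)%E.
  apply: integral_limn_le => // [k|k w|k]; [exact: mtotalT|by rewrite lee_fin total_correct_prob_ge0|].
  rewrite avg_total_correct_probE lee_fin.
  (* [avgPeE] holds at positive SNR only, so the index 0 is bounded through the value at 1. *)
  case: k => [|k].
    apply: (@le_trans _ _ (avg_total_correct_prob 1)).
      by apply/ltW/avg_total_correct_prob_increasing.
    by have /negP := ne 1; rewrite -leNgt avgPeE//; lra.
  by have /negP := ne k.+1%:R; rewrite -leNgt avgPeE ?ltr0n//; lra.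
apply/negP; rewrite -ltNge; apply: (@lt_le_trans _ _ 1%E); first by rewrite lte_fin; lra.
rewrite -(integral_probability_cst P); apply: ae_ge0_le_integral => //.
apply: filterS T_gt0 => w Tw _; apply/lee_addgt0Pr => r r0.
have [g hg] := total_correct_prob_to1 r0.
rewrite -leeBlDr// -EFinB; apply: lime_ge; first exact: ereal_nondecreasing_is_cvgn.
near=> k; rewrite lee_fin; apply: (le_trans (ltW hg)).
apply: total_correct_prob_nondecreasing => //; rewrite -ler_pdivrMr//.
by near: k; exact: nbhs_infty_ger.
Unshelve. all: by end_near.
Qed.

(** It dominates every [region_bound], so one SNR threshold serves all symbols. *)
Definition constellation_bound : R := \sum_(i < M) region_bound s i.

Lemma constellation_bound_ge0 : 0 <= constellation_bound.
Proof.
apply: sumr_ge0 => i _; exact: region_bound_ge0.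
Qed.

Lemma avgPe_strict_log_concave z0 x y : 0 <= z0 -> profile_decreasing n T z0 ->
  z0 * constellation_bound <= x -> 0 < x -> x < y ->
  (1 - avgPe s p T x) * (1 - avgPe s p T y) < (1 - avgPe s p T (2^-1 * (x + y))) ^+ 2.
Proof.
move=> z00 decr zx x0 xy; have y0 := lt_trans x0 xy.
set d1 := 2^-1 * (y - x).
have d10 : 0 < d1 by rewrite /d1; lra.
have yE : y = x + d1 + d1 by rewrite /d1; lra.
have mE : 2^-1 * (x + y) = x + d1 by rewrite /d1; lra.
have [i0 pi0] := prior_pos p_prior.
have conc i : avg_correct_prob s i T x + avg_correct_prob s i T (x + d1 + d1) <
    2 * avg_correct_prob s i T (x + d1).
  apply: (avg_correct_prob_concave M2 s_inj T_ge0 T_gt0 z00) => //; last exact: ltW.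
  apply: le_trans zx; rewrite ler_wpM2l// /constellation_bound (bigD1 i)//= lerDl.
  by apply: sumr_ge0 => j _; exact: region_bound_ge0.
have key : avg_total_correct_prob x + avg_total_correct_prob (x + d1 + d1) <
    2 * avg_total_correct_prob (x + d1).
  rewrite /avg_total_correct_prob -big_split/= mulr_sumr.
  apply: (ltr_sum_ex (i := i0)) => [j|].
    by rewrite -mulrDr mulrCA; apply: (ler_wpM2l (p_ge0 j)); exact/ltW/conc.
  by rewrite -mulrDr mulrCA (ltr_pM2l pi0); exact: conc.
apply: (strict_midpoint_log_concave avgPeE avg_total_correct_prob_ge0 x0 xy).
by rewrite mE {1}yE.
Qed.

End average_error_rate.

Lemma continuous_big_sum {R : realType} (V : topologicalType) (I : Type) (r : seq I)
    (F : I -> V -> R) :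
  (forall i, continuous (F i)) -> continuous (fun v => \sum_(i <- r) F i v).
Proof.
move=> Fc v; elim: r => [|i r IH].
  by rewrite /continuous_at; under eq_cvg do rewrite big_nil; rewrite big_nil; exact: cvg_cst.
rewrite /continuous_at; under eq_cvg do rewrite big_cons; rewrite big_cons.
by apply: cvgD => //; exact: Fc.
Qed.

Lemma continuous_big_prod {R : realType} (V : topologicalType) (I : Type) (r : seq I)
    (F : I -> V -> R) :
  (forall i, continuous (F i)) -> continuous (fun v => \prod_(i <- r) F i v).
Proof.
move=> Fc v; elim: r => [|i r IH].
  by rewrite /continuous_at; under eq_cvg do rewrite big_nil; rewrite big_nil; exact: cvg_cst.
rewrite /continuous_at; under eq_cvg do rewrite big_cons; rewrite big_cons.
by apply: cvgM => //; exact: Fc.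
Qed.

Lemma ltr_prod_ex {R : realType} (I : finType) (F G : I -> R) i :
  (forall j, 0 < F j) -> (forall j, F j <= G j) -> F i < G i -> \prod_j F j < \prod_j G j.
Proof.
move=> F0 FG FGi; rewrite (bigD1 i)//= [ltRHS](bigD1 i)//=.
apply: (@lt_le_trans _ _ (G i * \prod_(j | j != i) F j)).
  by rewrite ltr_pM2r// prodr_gt0.
rewrite ler_wpM2l ?(le_trans _ (FG i)) ?(ltW (F0 i))//.
by apply: ler_prod => j _; rewrite (ltW (F0 j)) FG.
Qed.

(** Bernoulli's inequality. *)
Lemma one_sub_expn_ge {R : realType} (e : R) k : 0 <= e <= 1 -> 1 - k%:R * e <= (1 - e) ^+ k.
Proof.
move=> /andP[e0 e1]; elim: k => [|k IH]; first by rewrite mul0r subr0 expr0.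
rewrite exprS; apply: (@le_trans _ _ ((1 - e) * (1 - k%:R * e))).
  have k0 : 0 <= k%:R :> R by [].
  have : 0 <= k%:R * (e * e) by rewrite !mulr_ge0.
  by rewrite -natr1; lra.
by rewrite ler_wpM2l// subr_ge0.
Qed.

(** * Power allocation *)

Section allocation.
Context {R : realType} (m : nat) (pe : R -> R).
Hypothesis pe_cont : continuous pe.
Hypothesis pe_ge0 : forall x, 0 <= pe x.
Hypothesis pe_le1 : forall x, pe x <= 1.
Hypothesis pe_noninc : {homo pe : x y /~ x <= y}.
Hypothesis pe_lt1 : forall x, 0 < x -> pe x < 1.

Let f x := 1 - pe x.

Let f_cont : continuous f.
Proof. by move=> x; apply: cvgB; [exact: cvg_cst|exact: pe_cont]. Qed.

Let f_ge0 x : 0 <= f x. Proof. by rewrite subr_ge0. Qed.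
Let f_le1 x : f x <= 1. Proof. by rewrite gerBl. Qed.
Let f_gt0 x : 0 < x -> 0 < f x. Proof. by move=> x0; rewrite subr_gt0 pe_lt1. Qed.
Let f_nondec : {homo f : x y / x <= y}.
Proof. by move=> x y xy; rewrite lerB// pe_noninc. Qed.

Section fixed_gains.
Variable gamma : 'I_m -> R.
Hypothesis gamma_gt0 : forall i, 0 < gamma i.

Let success (alpha : 'I_m -> R) : R := \prod_(i < m) f (alpha i * gamma i).

Let solutionE alpha : global_solution pe gamma alpha <->
  feasible alpha /\ forall beta, feasible beta -> success beta <= success alpha.
Proof.
by split=> -[fa opt]; split=> // beta fb; move: (opt _ fb); rewrite lerD2l lerN2.
Qed.

Lemma allocation_exists : exists alpha : {ffun 'I_m -> R}, global_solution pe gamma alpha.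
Proof.
(* The upper bound [m] follows from nonnegativity and the sum constraint; stating it exhibits the
   simplex as a closed part of a compact box. *)
pose A := [set v : 'rV[R]_m | forall i, `[0, m%:R]%classic (v ord0 i)] `&`
  [set v : 'rV[R]_m | \sum_i v ord0 i = m%:R].
have coord i : continuous (fun v : 'rV[R]_m => v ord0 i) by exact: coord_continuous.
have cA : compact A.
  apply: compact_closedI.
    by apply: (@rV_compact R m (fun=> `[0, m%:R]%classic)) => i; exact: segment_compact.
  have -> : [set v : 'rV[R]_m | \sum_i v ord0 i = m%:R] =
      (fun v : 'rV[R]_m => \sum_i v ord0 i) @^-1` [set m%:R] by [].
  apply: preimage_closed; last exact: closed_eq.
  by move=> v _; exact: continuous_big_sum.
have A0 : A !=set0.
  exists (const_mx 1); split.
    move=> i /=; rewrite mxE in_itv/= ler01/=.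
    by case: (m) i => [[]//|k i]; rewrite ler1n.
  rewrite /=; under eq_bigr do rewrite mxE.
  by rewrite sumr_const card_ord.
have sc : continuous (fun v : 'rV[R]_m => success (v ord0)).
  apply: continuous_big_prod => i v; rewrite /=.
  apply: (@continuous_comp _ R R (fun v : 'rV[R]_m => v ord0 i * gamma i) f).
    apply: (@cvgM _ _ (nbhs v) _ (fun v : 'rV[R]_m => v ord0 i) (cst (gamma i))).
      exact: coord.
    exact: cvg_cst.
  exact: f_cont.
have := EVT_max_rV A0 cA (continuous_subspaceT sc).
move=> [v /set_mem[vbox vsum] vmax].
exists [ffun i => v ord0 i]; apply/solutionE; split.
  split=> [i|]; first by rewrite ffunE; have := vbox i; rewrite /= in_itv/= => /andP[].
  by under eq_bigr do rewrite ffunE.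
move=> beta [b0 bsum].
have := vmax (\row_i beta i); rewrite inE => /(_ _).
have -> : success (fun i => (\row_i beta i) ord0 i) = success beta.
  by apply: eq_bigr => i _; rewrite mxE.
have -> : success [ffun i => v ord0 i] = success (v ord0).
  by apply: eq_bigr => i _; rewrite ffunE.
apply; split=> [i|] /=; last by under eq_bigr do rewrite mxE.
rewrite mxE in_itv/= b0/= -bsum (bigD1 i)//= lerDl.
exact: sumr_ge0.
Qed.

Let feasible1 : feasible (fun _ : 'I_m => 1 : R).
Proof. by split => //; rewrite sumr_const card_ord. Qed.

(** A vanishing factor would make the success probability 0, while the uniform allocation has a
    positive one. Positivity of all factors is what lets a strict inequality in one factor pass to
    the product. *)
Let solution_gt0 alpha : global_solution pe gamma alpha -> forall i, 0 < f (alpha i * gamma i).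
Proof.
move=> /solutionE[_ opt] i; rewrite lt_neqAle f_ge0 andbT eq_sym; apply/eqP => fz.
have := opt _ feasible1; apply/negP; rewrite -ltNge.
rewrite {1}/success (bigD1 i)//= fz mul0r.
by apply: prodr_gt0 => j _; rewrite f_gt0// mul1r.
Qed.

Variable x0 : R.
Hypothesis x0_ge0 : 0 <= x0.
Hypothesis f_strict : forall x y, x0 <= x -> 0 < x -> x < y ->
  f x * f y < f (2^-1 * (x + y)) ^+ 2.

(* The strict inequality extends to [x = 0]: a weak one holds there by continuity, and it
   is improved by the strict one at [(y/4, 3y/4)] and at [(y/2, y)]. *)
Let f0_weak y : x0 = 0 -> 0 < y -> f 0 * f y <= f (2^-1 * y) ^+ 2.
Proof.
move=> x00 y0.
have c1 : f x * f y @[x --> 0^'+] --> f 0 * f y.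
  apply: cvg_at_right_filter; apply: cvgM; [exact: f_cont|exact: cvg_cst].
have c2 : f (2^-1 * (x + y)) ^+ 2 @[x --> 0^'+] --> f (2^-1 * y) ^+ 2.
  apply: cvg_at_right_filter; rewrite -{2}[y]add0r.
  apply: (@continuous_comp R R R (fun x => f (2^-1 * (x + y))) (fun z => z ^+ 2)).
    apply: (@continuous_comp R R R (fun x => 2^-1 * (x + y)) f); last exact: f_cont.
    apply: cvgM; first exact: cvg_cst.
    by apply: cvgD; [exact: cvg_id|exact: cvg_cst].
  exact: exprn_continuous.
apply: (ler_cvg_to c1 c2); near=> x.
have xpos : 0 < x by near: x; exact: nbhs_right_gt.
have xy : x < y by near: x; exact: nbhs_right_lt.
by apply/ltW/f_strict => //; rewrite x00 ltW.
Unshelve. all: by end_near.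
Qed.

Let f_strict0 x y : x0 <= x -> x < y -> f x * f y < f (2^-1 * (x + y)) ^+ 2.
Proof.
move=> x0x xy; have := le_trans x0_ge0 x0x; rewrite le_eqVlt => /orP[/eqP xz|xpos]; last exact: f_strict.
have x00 : x0 = 0 by apply/le_anti; rewrite x0_ge0 xz x0x.
rewrite -xz in x0x xy *; rewrite add0r.
have q1 : f (2^-1 * (2^-1 * y)) * f (2^-1 * (2^-1 * y) + 2^-1 * y) < f (2^-1 * y) ^+ 2.
  rewrite [X in _ < f X ^+ 2](_ : _ = 2^-1 * (2^-1 * (2^-1 * y) + (2^-1 * (2^-1 * y) + 2^-1 * y))); last by lra.
  by apply: f_strict; rewrite ?x00; lra.
have q2 : f 0 * f (2^-1 * y) <= f (2^-1 * (2^-1 * y)) ^+ 2 by apply: f0_weak => //; lra.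
have q3 : f (2^-1 * y) * f y < f (2^-1 * (2^-1 * y) + 2^-1 * y) ^+ 2.
  rewrite [X in _ < f X ^+ 2](_ : _ = 2^-1 * (2^-1 * y + y)); last by lra.
  by apply: f_strict; rewrite ?x00; lra.
have p1 : 0 < f (2^-1 * y) by apply: f_gt0; lra.
have p2 : 0 < f (2^-1 * (2^-1 * y)) by apply: f_gt0; lra.
have p3 : 0 < f (2^-1 * (2^-1 * y) + 2^-1 * y) by apply: f_gt0; lra.
have p4 := f_gt0 xy; have p0 := f_ge0 0.
move: q1 q2 q3 p1 p2 p3 p4 p0.
move: (f 0) (f y) (f (2^-1 * y)) (f (2^-1 * (2^-1 * y))) (f (2^-1 * (2^-1 * y) + 2^-1 * y)).
move=> a b c u v q1 q2 q3 c0 u0 v0 b0 a0.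
(* The letters stand for [f] at 0 ([a]), [y] ([b]), [y/2] ([c]), [y/4] ([u]) and [3y/4] ([v]). If
   [c^2 <= a b], then [c^4 <= (a c)(c b) <= u^2 v^2 < c^4]. *)
rewrite ltNge; apply/negP => cab.
have cc0 : 0 < c ^+ 2 by rewrite exprn_gt0.
have h1 : (u * v) ^+ 2 < (c ^+ 2) ^+ 2.
  by rewrite ltr_pXn2r// nnegrE ltW// mulr_gt0.
have h2 : (a * c) * (c * b) <= u ^+ 2 * v ^+ 2.
  by apply: ler_pM => //; [rewrite mulr_ge0// ltW|rewrite mulr_ge0// ltW|exact: ltW].
have h3 : c ^+ 2 * c ^+ 2 <= c ^+ 2 * (a * b) by rewrite ler_pM2l.
have E1 : (u * v) ^+ 2 = u ^+ 2 * v ^+ 2 by ring.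
have E2 : (a * c) * (c * b) = c ^+ 2 * (a * b) by ring.
have E3 : (c ^+ 2) ^+ 2 = c ^+ 2 * c ^+ 2 by ring.
rewrite E1 E3 in h1; rewrite E2 in h2.
by have := le_lt_trans (le_trans h3 h2) h1; rewrite ltxx.
Qed.

(** The strict inequality is applied only between two solutions, so the threshold is required of
    solutions and not of all feasible allocations. *)
Lemma allocation_unique :
  (forall alpha, global_solution pe gamma alpha -> forall i, x0 <= alpha i * gamma i) ->
  unique_global_solution pe gamma.
Proof.
move=> far; have [alpha solA] := allocation_exists; exists alpha; split => // beta solB.
apply/ffunP => i0; apply: contrapT => /eqP neq.
have /solutionE[[A0 Asum] Aopt] := solA; have /solutionE[[B0 Bsum] Bopt] := solB.
pose mid i := 2^-1 * (alpha i + beta i).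
have fmid : feasible mid.
  split=> [i|]; first by rewrite mulr_ge0// addr_ge0.
  by rewrite -mulr_sumr big_split/= Asum Bsum; lra.
have AB : success alpha = success beta.
  by apply/le_anti; rewrite Bopt ?Aopt.
have strict i : alpha i != beta i ->
    f (alpha i * gamma i) * f (beta i * gamma i) < f (mid i * gamma i) ^+ 2.
  have -> : mid i * gamma i = 2^-1 * (alpha i * gamma i + beta i * gamma i).
    by rewrite /mid; ring.
  rewrite neq_lt => /orP[ab|ba].
    by apply: f_strict0; [exact: far|rewrite ltr_pM2r].
  by rewrite mulrC (addrC (alpha i * _)); apply: f_strict0; [exact: far|rewrite ltr_pM2r].
have : success alpha * success beta < success mid ^+ 2.
  rewrite /success -big_split -prodrXl/=; apply: (ltr_prod_ex (i := i0)) => [i|i|].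
  - by rewrite mulr_gt0 ?solution_gt0.
  - have [ab|/strict/ltW//] := eqVneq (alpha i) (beta i).
    by rewrite /mid ab expr2 (_ : 2^-1 * (beta i + beta i) = beta i)//; lra.
  - exact: strict.
rewrite -AB -expr2 ltr_pXn2r ?nnegrE//; last 2 first.
- by apply: prodr_ge0.
- by apply: prodr_ge0.
by rewrite ltNge (Aopt _ fmid).
Qed.

End fixed_gains.

Lemma unique_allocation (gamma : 'I_m -> R) : (forall i, 0 < gamma i) ->
  (forall x y, 0 < x -> x < y -> f x * f y < f (2^-1 * (x + y)) ^+ 2) ->
  unique_global_solution pe gamma.
Proof.
move=> g0 st; apply: (allocation_unique g0 (lexx 0)) => [x y _|alpha [[a0 _] _] i]; first exact: st.
by rewrite mulr_ge0// ltW.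
Qed.

(* If some stream had SNR below x0, the block would succeed with probability at most
   [1 - pe x0], which the uniform allocation beats once all gains are large. *)
Lemma unique_allocation_high_snr x0 : 0 <= x0 -> 0 < pe x0 ->
  (forall e, 0 < e -> exists g, pe g < e) ->
  (forall x y, x0 <= x -> 0 < x -> x < y -> f x * f y < f (2^-1 * (x + y)) ^+ 2) ->
  exists2 G : R, 0 < G & forall gamma : 'I_m -> R, (forall i, G <= gamma i) ->
    unique_global_solution pe gamma.
Proof.
move=> x00 pex0 pe0 st.
(* With every error rate at most [pe x0 / (m+1)], Bernoulli gives the uniform allocation success at
   least [1 - m/(m+1) pe x0], strictly above [1 - pe x0] thanks to the denominator [m+1]. *)
have e0 : 0 < pe x0 / m.+1%:R by rewrite divr_gt0.
have [g pg] := pe0 _ e0; exists (Num.max g 1); first by rewrite lt_max ltr01 orbT.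
move=> gamma gG.
have g0 i : 0 < gamma i by rewrite (lt_le_trans _ (gG i))// lt_max ltr01 orbT.
apply: (allocation_unique g0 x00) => // alpha [_ opt] i.
rewrite leNgt; apply/negP => ax.
have f1 : feasible (fun _ : 'I_m => 1 : R) by split => //; rewrite sumr_const card_ord.
have := opt _ f1; rewrite lerD2l lerN2; apply/negP; rewrite -ltNge.
apply: (@le_lt_trans _ _ (f x0)).
  rewrite (bigD1 i)//= -[leRHS]mulr1; apply: ler_pM => //.
  - exact: f_ge0.
  - by apply: prodr_ge0 => j _; exact: f_ge0.
  - exact/f_nondec/ltW.
  - by apply: prodr_ile1 => j _; rewrite f_ge0 f_le1.
apply: (@lt_le_trans _ _ ((1 - pe x0 / m.+1%:R) ^+ m)).
  apply: lt_le_trans (one_sub_expn_ge _ _); last first.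
    by rewrite (ltW e0)/= ler_pdivrMr// mul1r (le_trans (pe_le1 _))// ler1n.
  rewrite /f ltrD2l ltrN2 mulrCA gtr_pMr// ltr_pdivrMr// mul1r ltr_nat//.
rewrite -[X in _ ^+ X](card_ord m) -prodr_const; apply: ler_prod => j _.
rewrite mul1r lerB// ?andbT.
  rewrite subr_ge0 ler_pdivrMr// mul1r (le_trans (pe_le1 _))// ler1n//.
by apply: le_trans (ltW pg); apply: pe_noninc; rewrite (le_trans _ (gG j))// le_max lexx.
Qed.

End allocation.

(** * The channel without fading *)

Section nonfading.
Context {R : realType}.

Definition dirac_unit : probability unit R := \d_tt.

(* The AWGN channel is handled as the degenerate fading [T = 1]. *)
Definition nonfading : {RV dirac_unit >-> R} := cst 1.

Let one_ge0 w : 0 <= nonfading w. Proof. by []. Qed.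

Let one_gt0 : {ae dirac_unit, forall w, 0 < nonfading w}.
Proof. by apply: aeW => w; exact: ltr01. Qed.

Lemma avgPe_nonfading n M (s : 'I_M -> Rn R n) p : avgPe s p nonfading = Pe s p.
Proof.
apply/funext => g; rewrite /avgPe unlock.
under eq_integral do rewrite /= mulr1.
by rewrite integral_probability_cst.
Qed.

Lemma avg_correct_prob_nonfading n M (s : 'I_M -> Rn R n) i g :
  avg_correct_prob s i nonfading g = correct_prob s i g.
Proof.
rewrite /avg_correct_prob; under eq_integral do rewrite /= mulr1.
by rewrite integral_probability_cst.
Qed.

(** Here the profile is [exp (- z/2)]. With [t = (z' - z)/z], the bound [z'/z <= exp t] gives
    [z'^(n/2) <= z^(n/2) exp (n t / 2)], and [n <= z] bounds the exponent by [(z' - z)/2].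
    Strictness comes from [1/z' < 1/z]. *)
Lemma profile_decreasing_nonfading n : (0 < n)%N -> profile_decreasing n nonfading n%:R.
Proof.
move=> n0 z z' nz zz'.
have z0 : 0 < z by rewrite (le_lt_trans _ nz).
have z'0 := lt_trans z0 zz'.
have E q : snr_profile n nonfading q = expR (- (2^-1 * q)).
  rewrite /snr_profile /snr_kernel; under eq_integral do rewrite /= sqrtr1 expr1n !mul1r.
  by rewrite integral_probability_cst.
rewrite !E; set t := (z' - z) / z.
have t0 : 0 < t by rewrite divr_gt0// subr_gt0.
have tz : t * z = z' - z by rewrite /t divfK// gt_eqF.
have sz' : Num.sqrt z' <= Num.sqrt z * expR (2^-1 * t).
  have -> : Num.sqrt z * expR (2^-1 * t) = Num.sqrt (z * expR t).
    rewrite sqrtrM ?(ltW z0)//; congr (_ * _).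
    by rewrite -[expR t](_ : expR (2^-1 * t) ^+ 2 = _) ?sqrtr_sqr ?ger0_norm ?expR_ge0//
      -expRM_natl; congr expR; lra.
  rewrite ler_wsqrtr//; apply: (@le_trans _ _ (z * (1 + t))); first by rewrite mulrDr mulr1 mulrC tz; lra.
  by rewrite ler_wpM2l ?(ltW z0)// expR_ge1Dx.
have sn : Num.sqrt z' ^+ n <= Num.sqrt z ^+ n * expR (2^-1 * (z' - z)).
  apply: (@le_trans _ _ ((Num.sqrt z * expR (2^-1 * t)) ^+ n)).
    by apply: lerXn2r; rewrite ?nnegrE ?mulr_ge0 ?expR_ge0 ?sqrtr_ge0.
  rewrite exprMn ler_wpM2l ?exprn_ge0// -expRM_natl ler_expR -tz.
  by have := ler_wpM2r (ltW t0) (ltW nz); lra.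
apply: (@le_lt_trans _ _ (Num.sqrt z ^+ n * expR (2^-1 * (z' - z)) / z' * expR (- (2^-1 * z')))).
  by rewrite ler_wpM2r ?expR_ge0// ler_wpM2r// invr_ge0 ltW.
have -> : Num.sqrt z ^+ n * expR (2^-1 * (z' - z)) / z' * expR (- (2^-1 * z')) =
    Num.sqrt z ^+ n * expR (- (2^-1 * z)) / z'.
  rewrite [expR (- (2^-1 * z))](_ : _ = expR (2^-1 * (z' - z)) * expR (- (2^-1 * z'))); first by ring.
  by rewrite -expRD; congr expR; lra.
rewrite [ltRHS]mulrAC ltr_pM2l; first by rewrite ltf_pV2.
by rewrite mulr_gt0 ?expR_gt0// exprn_gt0// sqrtr_gt0.
Qed.

Lemma symmetric_strict_log_concave n M (s : 'I_M -> Rn R n) p x y : (2 <= M)%N -> injective s ->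
  symmetric_constellation s p -> 0 < x -> x < y ->
  (1 - Pe s p x) * (1 - Pe s p y) < (1 - Pe s p (2^-1 * (x + y))) ^+ 2.
Proof.
move=> M2 s_inj sym x0 xy; have y0 := lt_trans x0 xy.
pose i := Ordinal (ltnW M2).
have E t : 0 < t -> 1 - Pe s p t = correct_prob s i t.
  by move=> t0; rewrite -(sym i t t0) PeiE//; ring.
have z0 : 0 < 2^-1 * (x + y) by lra.
rewrite (E _ x0) (E _ y0) (E _ z0).
pose w := 2^-1 * (Num.sqrt x + Num.sqrt y).
have := correct_prob_log_concave i s_inj (sqrtr_ge0 x) (sqrtr_ge0 y).
rewrite (sqr_sqrtr (ltW x0)) (sqr_sqrtr (ltW y0)) -/w => /le_lt_trans; apply.
(* The gap is the square of [(sqrt y - sqrt x)/2]. Log-concavity in the square root of the SNR being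
   weak, all the strictness originates here. *)
have wz : w ^+ 2 < 2^-1 * (x + y).
  rewrite -subr_gt0 (_ : _ - _ = (2^-1 * (Num.sqrt y - Num.sqrt x)) ^+ 2).
    by rewrite exprn_even_gt0//= mulf_neq0 ?invr_eq0// subr_eq0 gt_eqF// ltr_sqrt.
  by rewrite -{1}(sqr_sqrtr (ltW x0)) -{1}(sqr_sqrtr (ltW y0)) /w; field.
have := avg_correct_prob_increasing i M2 s_inj one_ge0 one_gt0 (sqr_ge0 w) wz.
rewrite !avg_correct_prob_nonfading => lt.
by rewrite ltr_pXn2r// nnegrE correct_prob_ge0.
Qed.

End nonfading.

Section average_allocation.
Context {R : realType} (n M m : nat) (s : 'I_M -> Rn R n) (p : 'I_M -> R).
Hypothesis M2 : (2 <= M)%N.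
Hypothesis s_inj : injective s.
Hypothesis p_prior : is_prior p.
Context d (Om : measurableType d) (P : probability Om R) (T : {RV P >-> R}).
Hypothesis T_ge0 : forall w, 0 <= T w.
Hypothesis T_gt0 : {ae P, forall w, 0 < T w}.

Let cont : continuous (avgPe s p T). Proof. exact: avgPe_continuous. Qed.
Let ge0 x : 0 <= avgPe s p T x. Proof. exact: avgPe_ge0. Qed.
Let le1 x : avgPe s p T x <= 1. Proof. exact: avgPe_le1. Qed.
Let noninc : {homo avgPe s p T : x y /~ x <= y}. Proof. exact: avgPe_nonincreasing. Qed.
Let lt1 x : 0 < x -> avgPe s p T x < 1. Proof. exact: avgPe_lt1. Qed.

Lemma average_unique_allocation12 (gamma : 'I_m -> R) : n = 1%N \/ n = 2%N ->
  (forall i, 0 < gamma i) -> unique_global_solution (avgPe s p T) gamma.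
Proof.
move=> n12 g0; apply: (unique_allocation cont le1 lt1 g0) => x y x0 xy.
apply: (avgPe_strict_log_concave M2 s_inj p_prior T_ge0 T_gt0 (lexx 0)) => //.
  exact: profile_decreasing12.
by rewrite mul0r ltW.
Qed.

Lemma average_unique_allocation_high_snr z0 : 0 <= z0 -> profile_decreasing n T z0 ->
  exists2 G : R, 0 < G & forall gamma : 'I_m -> R, (forall i, G <= gamma i) ->
    unique_global_solution (avgPe s p T) gamma.
Proof.
move=> z00 decr; have B0 := constellation_bound_ge0 s.
have x00 : 0 <= z0 * constellation_bound s by rewrite mulr_ge0.
apply: (unique_allocation_high_snr m cont ge0 le1 noninc lt1 x00).
- exact: avgPe_gt0.
- by move=> e e0; exact: avgPe_to0.
- by move=> x y zx x0 xy; exact: (avgPe_strict_log_concave M2 s_inj p_prior T_ge0 T_gt0 z00 decr).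
Qed.

End average_allocation.

Theorem theorem11 (R : realType) (n M : nat) (s : 'I_M -> Rn R n) (p : 'I_M -> R)
    (m : nat) (hn : (1 <= n)%N) (hm : (1 <= m)%N)
    (hs : is_constellation s) (hp : is_prior p) :
  [/\ (* (i) 1-D and 2-D constellations, instantaneous and average BLER *)
      (n = 1%N \/ n = 2%N) ->
        forall gamma : 'I_m -> R, (forall i, 0 < gamma i) ->
          unique_global_solution (Pe s p) gamma /\
          forall (d : measure_display) (Om : measurableType d)
                 (P : probability Om R) (T : {RV P >-> R}),
            fading T -> unique_global_solution (avgPe s p T) gamma,
      (* (ii) symmetric constellations, instantaneous BLER *)
      symmetric_constellation s p ->
        forall gamma : 'I_m -> R, (forall i, 0 < gamma i) ->
          unique_global_solution (Pe s p) gamma &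
      (* (iii) any constellation at sufficiently high SNR *)
      (exists2 G : R, 0 < G & forall gamma : 'I_m -> R, (forall i, G <= gamma i) ->
          unique_global_solution (Pe s p) gamma) /\
      (forall (d : measure_display) (Om : measurableType d)
              (P : probability Om R) (T : {RV P >-> R}),
          fading T ->
          exists2 G : R, 0 < G & forall gamma : 'I_m -> R, (forall i, G <= gamma i) ->
            unique_global_solution (avgPe s p T) gamma)].
Proof.
have [M2 s_inj _] := hs.
have one_ge0 w : 0 <= @nonfading R w by [].
have one_gt0 : {ae @dirac_unit R, forall w, 0 < @nonfading R w}.
  by apply: aeW => w; exact: ltr01.
split.
- move=> n12 gamma g0; split.
    by rewrite -avgPe_nonfading; exact: average_unique_allocation12.
  move=> d Om P T fT; have T0 := fading_gt0 fT; have [T1 _ _] := fT.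
  exact: average_unique_allocation12.
- move=> sym gamma g0; rewrite -avgPe_nonfading.
  apply: unique_allocation => //.
  + exact: avgPe_continuous.
  + exact: avgPe_le1.
  + exact: avgPe_lt1.
  + by rewrite avgPe_nonfading => x y; exact: symmetric_strict_log_concave.
- split.
    rewrite -avgPe_nonfading; apply: (average_unique_allocation_high_snr _ M2 s_inj hp one_ge0 one_gt0 (ler0n R n)).
    exact: profile_decreasing_nonfading.
  move=> d Om P T fT; have T0 := fading_gt0 fT; have [T1 _ _] := fT.
  have [z0 z00 decr] := fading_profile_decreasing n fT.
  exact: (average_unique_allocation_high_snr _ M2 s_inj hp T1 T0 z00 decr).
Qed.
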